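(* Suppose the $\mathrm{Ad}$-invariant symmetric bilinear form $\bullet$ on $\mathfrak g$ is non-degenerate, and let $\ell\ge1$. Then, for a suitably chosen $2$-chain $c\in C_2(F)$ with $\partial c=[r]$, applying exponentiation to the weakly non-degenerate weakly $G$-quasi Hamiltonian $G$-manifold $(G^{2\ell},\sigma_\ell,\Phi_\ell)$ (the fusion of $\ell$ copies of the internally fused double) yields the extended moduli space $(\mathcal M(\mathcal P,G),\omega_{c,\mathcal P},\mu)$ for the genus $\ell$ case relative to $c$.
   Context: Conventions. $G$ is a Lie group over $\mathbb K=\mathbb R$ or $\mathbb C$ with Lie algebra $\mathfrak g$; $X_M(q)=\frac{d}{dt}|_{0}\exp(-tX)q$; $\omega,\bar\omega\in\Omega^1(G,\mathfrak g)$ left/right invariant Maurer–Cartan forms; $\lambda=\frac1{12}[\omega,\omega]\bullet\omega$, i.e. on left invariant fields $\lambda(X^L,Y^L,Z^L)=\frac12[X,Y]\bullet Z$; for forms on $G\times G$ subscripts $1,2$ denote pullback from the factors, and $(\alpha\bullet\beta)(U,V)=\alpha(U)\bullet\beta(V)-\alpha(V)\bullet\beta(U)$. $\psi^\bullet(X)=X\bullet(\cdot)$. A weakly $G$-quasi Hamiltonian structure on a $G$-manifold $M$ relative to $\bullet$ is a pair of a $G$-invariant $2$-form $\sigma$ and a $G$-equivariant map $\Phi\colon M\to G$ (conjugation on $G$) with $d\sigma=\Phi^*\lambda$ and $\sigma(X_M,\cdot)=\frac12\Phi^*(X\bullet(\omega+\bar\omega))$ for all $X\in\mathfrak g$. It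 is weakly non-degenerate if $\sigma_q$ is non-degenerate at every $q$ with $\Phi(q)$ in the center of $G$. Fusion: for a $(G\times G)$-manifold with $(\sigma,(\Phi^1,\Phi^2))$, put $\sigma_{\rm fus}=\sigma-\frac12(\Phi^1,\Phi^2)^*(\omega_1\bullet\bar\omega_2)$ and $\Phi_{\rm fus}=\Phi^1\Phi^2$, with the diagonal $G$-action. The internally fused double $(G\times G,\sigma_1,\Phi_1)$ is the fusion of $G\times G$ with $(G\times G)$-action $(x,y)\cdot(q_1,q_2)=(xq_1y^{-1},yq_2x^{-1})$, $2$-form $-\frac12(\omega_1\bullet\bar\omega_2+\bar\omega_1\bullet\omega_2)$ and map $(q_1,q_2)\mapsto(q_1q_2,q_1^{-1}q_2^{-1})$; so $\Phi_1(q_1,q_2)=[q_1,q_2]$. $(G^{2\ell},\sigma_\ell,\Phi_\ell)$ arises by successively fusing $\ell$ copies of it. Exponentiation of $(M,\sigma,\Phi)$: let $X$ be in the center of $\mathfrak g$ with $\exp X$ in the center of $G$ and $\Phi^{-1}(\exp X)\ne\emptyset$, $O\subseteq\mathfrak g$ an open $G$-invariant neighborhood of $X$ on which $\exp$ is an analytic diffeomorphism onto its image; $\mathcal H(M,G,\Phi)=\{(m,Y)\in M\times O:\Phi(m)=\exp Y\}$ with projections $\eta$ to $M$ and $\Phi_O$ to $O$; $\beta=h(\exp^*\lambda)\in\Omega^2(\mathfrak g)$ with $h$ the $\mathrm{Ad}$-invariant integration operator on forms on $\mathfrak g$ ($dh+hd=\mathrm{Id}$ in positive degrees). The result is the open $G$-subspace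 of $\mathcal H(M,G,\Phi)$ where the closed $2$-form $\eta^*\sigma-\Phi_O^*\beta$ is non-degenerate, with this form and the map $\psi^\bullet\circ\Phi_O$ to $\mathfrak g^*$ (a Hamiltonian $G$-manifold, up to sign). Extended moduli space: $F$ is free on $x_1,y_1,\dots,x_\ell,y_\ell$, $r=\prod_j[x_j,y_j]$, $\mathcal P=\langle x_1,\dots,y_\ell;r\rangle$. $C_*(F)$ is the (normalized inhomogeneous) group chain complex, $\partial[u|v]=[v]-[uv]+[u]$. For $c\in C_2(F)$ with $\partial c=[r]$, $\omega_c$ is the $2$-form on $\mathrm{Hom}(F,G)\cong G^{2\ell}$ obtained linearly from $[u|v]\mapsto\frac12(E_u,E_v)^*(\omega_1\bullet\bar\omega_2)$, $E_u(\chi)=\chi(u)$. Then $(\omega_c,r)$, with $r\colon G^{2\ell}\to G$ the word map, is a weakly $G$-quasi Hamiltonian structure, and the extended moduli space $(\mathcal M(\mathcal P,G),\omega_{c,\mathcal P},\mu)$ relative to $c$ is the Hamiltonian $G$-manifold (up to sign) obtained by exponentiation of $(G^{2\ell},\omega_c,r)$, with the same $X$ and $O$ as for $(G^{2\ell},\sigma_\ell,\Phi_\ell)$; that is, with $\mathcal H(G^{2\ell},G,r)=\{(m,Y)\in G^{2\ell}\times O:r(m)=\exp Y\}$ and its projections $\eta$ to $G^{2\ell}$ and $r_O$ to $O$, $\mathcal M(\mathcal P,G)$ is the open $G$-subspace of $\mathcal H(G^{2\ell},G,r)$ where the closed $2$-form $\eta^*\omega_c-r_O^*\beta$ is non-degenerate,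 $\omega_{c,\mathcal P}$ is the restriction of this $2$-form, and $\mu$ is the restriction of $\psi^\bullet\circ r_O$. *)

(* Defs.v *)
From HB Require Import structures.
From mathcomp Require Import all_boot all_order all_algebra.
From mathcomp Require Import all_classical all_reals all_analysis.
From mathcomp Require Import complex freeg.

Set Implicit Arguments.
Unset Strict Implicit.
Unset Printing Implicit Defensive.
Import Order.TTheory GRing.Theory Num.Theory.
Import numFieldNormedType.Exports.
Local Open Scope classical_set_scope.
Local Open Scope ring_scope.

(* Over the complex numbers, differentiability is complex differentiability, so
   that [smooth] and [analytic] both mean holomorphic there. *)
Fixpoint Ck (K : numFieldType) (E F : normedModType K) (k : nat) (U : set E)
    (f : E -> F) : Prop :=
  if k is k'.+1 then
    (forall x, U x -> differentiable f x) /\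
    (forall v, Ck k' U (fun x => 'D_v f x))
  else forall x, U x -> {for x, continuous f}.

Definition smooth (K : numFieldType) (E F : normedModType K) (U : set E)
    (f : E -> F) : Prop := forall k, Ck k U f.

(* [f] is the sum of its Taylor series near every point of [U]. *)
Definition analytic (K : numFieldType) (E F : normedModType K) (U : set E)
    (f : E -> F) : Prop :=
  smooth U f /\
  forall a, U a -> \forall h \near (0 : E),
    series (fun k => (k`!%:R : K)^-1 *: iter k (fun g x => 'D_h g x) f a)
      @ \oo --> f (a + h).

Definition pair_map (A A' B B' : Type) (f : A -> B) (g : A' -> B')
  (z : A * A') : B * B' := (f z.1, g z.2).

Section PairMap.
Context {K : numFieldType}.

Lemma differentiable_near_eq (E F : normedModType K) (f g : E -> F) (x : E) :
  (\forall y \near x, f y = g y) -> differentiable f x -> differentiable g x.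
Proof.
move=> fg df; have fgx : f x = g x := nbhs_singleton fg.
have [dfc dfe] := (diff_locallyP _ _).1 df.
have sh : (fun h : E => h + x) @ (0 : E) --> x.
  by rewrite -{2}(add0r x); apply: cvgD; [exact: cvg_id|exact: cvg_cst].
have ge : g \o shift x = (cst (g x) + 'd f x) +o_ (0 : E) id.
  apply/eqaddoP => eps e0; move/eqaddoP: dfe => /(_ _ e0) H.
  have fg0 : \forall h \near (0 : E), f (h + x) = g (h + x) := sh _ fg.
  apply: filterS2 fg0 H => h /= fgh.
  rewrite /GRing.add /GRing.opp /=.
  by rewrite fgh fgx.
have e := diff_unique dfc ge.
by apply/diff_locallyP; rewrite e.
Qed.

Lemma continuous_fst (M N : topologicalType) (z : M * N) : fst @ z --> z.1.
Proof. exact: cvg_fst. Qed.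

Lemma continuous_snd (M N : topologicalType) (z : M * N) : snd @ z --> z.2.
Proof. exact: cvg_snd. Qed.

Section Pair.
Context {E E' F F' : normedModType K}.
Implicit Types (f : E -> F) (g : E' -> F').

Lemma diff_pair_map f g (z : E * E') :
  differentiable f z.1 -> differentiable g z.2 ->
  differentiable (pair_map f g) z /\
  'd (pair_map f g) z = pair_map ('d f (z.1)) ('d g (z.2)) :> (E * E' -> F * F').
Proof.
move=> df dg.
have c1 : continuous (@fst E E' : {linear (E * E')%type -> E}).
  by move=> w; exact: cvg_fst.
have c2 : continuous (@snd E E' : {linear (E * E')%type -> E'}).
  by move=> w; exact: cvg_snd.
have d1 := linear_differentiable z c1; have d2 := linear_differentiable z c2.
have D1 := differentiable_comp d1 df; have D2 := differentiable_comp d2 dg.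
split; first exact: (differentiable_pair D1 D2).
have e1 := diff_comp d1 df; have e2 := diff_comp d2 dg.
have e := diff_pair D1 D2; rewrite e1 e2 in e.
by rewrite (diff_lin z c1) (diff_lin z c2) in e; exact: e.
Qed.

Lemma derive_pair_map f g (z v : E * E') :
  differentiable f z.1 -> differentiable g z.2 ->
  'D_v (pair_map f g) z = ('D_v.1 f z.1, 'D_v.2 g z.2).
Proof.
move=> df dg; have [d e] := diff_pair_map df dg.
by rewrite !deriveE // e.
Qed.

Lemma Ck_eq_in (k : nat) (U : set E) (f f' : E -> F) : open U ->
  (forall x, U x -> f x = f' x) -> Ck k U f -> Ck k U f'.
Proof.
move=> oU; elim: k f f' => [|k IH] f f' ff' /=.
  have near_ff' x : U x -> \forall y \near x, f y = f' y.
    by move=> Ux; apply: filterS (open_nbhs_nbhs (conj oU Ux)) => y /ff'.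
  move=> cf x Ux; have := cf x Ux; rewrite /prop_for /continuous_at (ff' x Ux).
  by apply: cvg_trans; apply: near_eq_cvg; exact: near_ff'.
have near_ff' x : U x -> \forall y \near x, f y = f' y.
  by move=> Ux; apply: filterS (open_nbhs_nbhs (conj oU Ux)) => y /ff'.
move=> [df Df]; split=> [x Ux|v].
  exact: differentiable_near_eq (near_ff' x Ux) (df x Ux).
by apply: IH (Df v) => x Ux; apply: near_eq_derive; exact: near_ff'.
Qed.

Lemma open_setX (M N : topologicalType) (A : set M) (B : set N) :
  open A -> open B -> open (A `*` B).
Proof.
rewrite !openE => oA oB [x y] [/= Ax By]; exists (A, B) => //=.
by split; [exact: oA|exact: oB].
Qed.

End Pair.

Section PairAnalytic.
Context {E E' F F' : normedModType K}.
Variables (U : set E) (V : set E').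
Hypotheses (oU : open U) (oV : open V).

Lemma Ck_pair_map k (f : E -> F) (g : E' -> F') :
  Ck k U f -> Ck k V g -> Ck k (U `*` V) (pair_map f g).
Proof.
elim: k f g => [|k IH] f g /=.
  move=> cf cg z [Uz Vz].
  have h1 := continuous_comp (@continuous_fst _ _ z) (cf _ Uz).
  have h2 := continuous_comp (@continuous_snd _ _ z) (cg _ Vz).
  exact: cvg_pair h1 h2.
move=> [df Df] [dg Dg]; split=> [z [Uz Vz]|v].
  by have [] := diff_pair_map (df _ Uz) (dg _ Vz).
apply: (@Ck_eq_in _ _ _ _ (pair_map (fun x => 'D_v.1 f x) (fun x => 'D_v.2 g x))).
- exact: open_setX.
- by move=> z [Uz Vz]; rewrite derive_pair_map //; [exact: df|exact: dg].
- exact: IH.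
Qed.

Lemma iter_derive_pair_map k (f : E -> F) (g : E' -> F') (v z : E * E') :
  smooth U f -> smooth V g -> (U `*` V) z ->
  iter k (fun h x => 'D_v h x) (pair_map f g) z =
  (iter k (fun h x => 'D_v.1 h x) f z.1, iter k (fun h x => 'D_v.2 h x) g z.2).
Proof.
move=> sf sg; elim: k z => [|k IH] z Wz; first by case: z Wz.
rewrite !iterS.
rewrite (@near_eq_derive _ _ _ _ (pair_map (iter k (fun h x => 'D_v.1 h x) f)
   (iter k (fun h x => 'D_v.2 h x) g))); last first.
  by near=> y; rewrite IH //; near: y; apply: open_nbhs_nbhs; split=> //; exact: open_setX.
have it (A B : normedModType K) (W : set A) (h : A -> B) (w : A) : smooth W h -> forall j i,
    Ck j W (iter i (fun h x => 'D_w h x) h).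
  move=> sh j i; elim: i j => [|i Hi] j /=; first exact: sh.
  by have [_ /(_ w)] := Hi j.+1.
have [Uz Vz] := Wz.
rewrite derive_pair_map //.
  by have [+ _] := it _ _ _ _ v.1 sf 1%N k; apply.
by have [+ _] := it _ _ _ _ v.2 sg 1%N k; apply.
Unshelve. all: by end_near. Qed.

Lemma analytic_pair_map (f : E -> F) (g : E' -> F') :
  analytic U f -> analytic V g -> analytic (U `*` V) (pair_map f g).
Proof.
move=> [sf tf] [sg tg]; split=> [k|]; first exact: Ck_pair_map.
move=> a Wa; have [Ua Va] := Wa.
have t1 := tf _ Ua; have t2 := tg _ Va.
have n1' : \forall h \near (0 : E * E'),
  series (fun k => (k`!%:R : K)^-1 *: iter k (fun g x => 'D_h.1 g x) f a.1)
      @ \oo --> f (a.1 + h.1) :=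
    @continuous_fst _ _ (0 : E * E') _ t1.
have n2' : \forall h \near (0 : E * E'),
  series (fun k => (k`!%:R : K)^-1 *: iter k (fun g x => 'D_h.2 g x) g a.2)
      @ \oo --> g (a.2 + h.2) :=
    @continuous_snd _ _ (0 : E * E') _ t2.
apply: filterS2 n1' n2' => h h1 h2.
have -> : series (fun k => (k`!%:R : K)^-1 *:
    iter k (fun g x => 'D_h g x) (pair_map f g) a) = (fun n =>
  (series (fun k => (k`!%:R : K)^-1 *: iter k (fun g x => 'D_h.1 g x) f a.1) n,
   series (fun k => (k`!%:R : K)^-1 *: iter k (fun g x => 'D_h.2 g x) g a.2) n)).
  apply: funext => n; rewrite /series /=; elim: n => [|n IHn].
    by rewrite !big_geq.
  by rewrite !big_nat_recr //= IHn iter_derive_pair_map.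
exact: cvg_pair h1 h2.
Qed.

End PairAnalytic.
End PairMap.

(* A manifold modelled on [E].  An atlas is given by choosing a chart around
   every point; [chart_fun] and [chart_inv] are only meaningful on [chart_dom]
   and on its image.  Second countability is not required. *)
Record chart (K : numFieldType) (E : normedModType K) (M : Type) := Chart {
  chart_dom : set M;
  chart_fun : M -> E;
  chart_inv : E -> M
}.

Definition chart_img (K : numFieldType) (E : normedModType K) (M : Type)
  (c : chart E M) : set E := chart_fun c @` chart_dom c.

Record is_chart (K : numFieldType) (E : normedModType K) (M : topologicalType)
    (c : chart E M) : Prop := IsChart {
  chart_dom_open : open (chart_dom c);
  chart_img_open : open (chart_img c);
  chart_funK : forall p, chart_dom c p -> chart_inv c (chart_fun c p) = p;
  chart_fun_cont : forall p, chart_dom c p -> {for p, continuous (chart_fun c)};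
  chart_inv_cont : forall x, chart_img c x -> {for x, continuous (chart_inv c)}
}.

Record manifold (K : numFieldType) (E : normedModType K) := Manifold {
  mfd_pt :> topologicalType;
  chart_at : mfd_pt -> chart E mfd_pt;
  mfd_hausdorff : hausdorff_space mfd_pt;
  mfd_chart : forall p, is_chart (chart_at p);
  mfd_mem : forall p, chart_dom (chart_at p) p;
  mfd_compat : forall p q, analytic
    (chart_fun (chart_at p) @` (chart_dom (chart_at p) `&` chart_dom (chart_at q)))
    (chart_fun (chart_at q) \o chart_inv (chart_at p))
}.

Lemma chart_overlap_open (K : numFieldType) (E : normedModType K)
    (M : manifold E) (p q : M) :
  open (chart_fun (chart_at p) @`
    (chart_dom (chart_at p) `&` chart_dom (chart_at q))).
Proof.
have c := mfd_chart p; have od := chart_dom_open (mfd_chart q).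
rewrite openE => _ [m [pm qm] <-].
have im : chart_img (chart_at p) (chart_fun (chart_at p) m) by exists m.
have n1 := open_nbhs_nbhs (conj (chart_img_open c) im).
have n2 : \forall x \near chart_fun (chart_at p) m,
    chart_dom (chart_at q) (chart_inv (chart_at p) x).
  have nb : nbhs (chart_inv (chart_at p) (chart_fun (chart_at p) m))
      (chart_dom (chart_at q)).
    by apply: (open_nbhs_nbhs (conj od _)); rewrite (chart_funK c).
  exact: (chart_inv_cont c im nb).
apply: filterS2 n1 n2 => _ [m' pm' <-]; rewrite (chart_funK c) // => qm'.
by exists m'.
Qed.

Section Product.
Context {K : numFieldType} {E F : normedModType K}.
Variables (M : manifold E) (N : manifold F).

Definition prod_chart (z : M * N) : chart (E * F)%type (M * N)%type :=
  let c := chart_at z.1 in let d := chart_at z.2 in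
  Chart (chart_dom c `*` chart_dom d)
    (pair_map (chart_fun c) (chart_fun d))
    (pair_map (chart_inv c) (chart_inv d)).

Lemma image_pair_map (A A' B B' : Type) (f : A -> B) (g : A' -> B')
    (X : set A) (Y : set A') :
  pair_map f g @` (X `*` Y) = (f @` X) `*` (g @` Y).
Proof.
apply/seteqP; split=> [_ [z [Xz Yz] <-]|[b b'] [/= [x Xx <-] [y Yy <-]]].
  by split; [exists z.1|exists z.2].
by exists (x, y).
Qed.

Lemma prod_hausdorff : hausdorff_space (M * N)%type.
Proof.
move=> p q pq; rewrite (surjective_pairing p) (surjective_pairing q).
congr pair; [apply: (@mfd_hausdorff _ _ M)|apply: (@mfd_hausdorff _ _ N)] => A B pA qB.
- have [z [? ?]] := pq _ _ (@continuous_fst _ _ p _ pA) (@continuous_fst _ _ q _ qB).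
  by exists z.1.
- have [z [? ?]] := pq _ _ (@continuous_snd _ _ p _ pA) (@continuous_snd _ _ q _ qB).
  by exists z.2.
Qed.

Lemma continuous_pair_map (A A' B B' : topologicalType) (f : A -> B)
    (g : A' -> B') (z : A * A') :
  {for z.1, continuous f} -> {for z.2, continuous g} ->
  {for z, continuous (pair_map f g)}.
Proof.
move=> cf cg.
have h1 := continuous_comp (@continuous_fst _ _ z) cf.
have h2 := continuous_comp (@continuous_snd _ _ z) cg.
exact: cvg_pair h1 h2.
Qed.

Lemma prod_is_chart z : is_chart (prod_chart z).
Proof.
have c := mfd_chart z.1; have d := mfd_chart z.2.
split=> [||p [p1 p2]|p [p1 p2]|x].
- by apply: open_setX; exact: chart_dom_open.
- by rewrite /chart_img image_pair_map; apply: open_setX; exact: chart_img_open.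
- by rewrite /= /pair_map /= !chart_funK //; case: p {p1 p2}.
- by apply: continuous_pair_map; exact: chart_fun_cont.
- rewrite /chart_img image_pair_map => -[x1 x2].
  by apply: continuous_pair_map; exact: chart_inv_cont.
Qed.

Lemma prod_mem z : chart_dom (prod_chart z) z.
Proof. by split; exact: mfd_mem. Qed.

Lemma prod_compat z w : analytic
  (chart_fun (prod_chart z) @` (chart_dom (prod_chart z) `&` chart_dom (prod_chart w)))
  (chart_fun (prod_chart w) \o chart_inv (prod_chart z)).
Proof.
have -> : chart_dom (prod_chart z) `&` chart_dom (prod_chart w) =
    (chart_dom (chart_at z.1) `&` chart_dom (chart_at w.1)) `*`
    (chart_dom (chart_at z.2) `&` chart_dom (chart_at w.2)).
  by apply/seteqP; split=> m [[? ?] [? ?]].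
rewrite image_pair_map.
exact: (analytic_pair_map (chart_overlap_open z.1 w.1)
  (chart_overlap_open z.2 w.2) (mfd_compat z.1 w.1) (mfd_compat z.2 w.2)).
Qed.

Definition prod_manifold : manifold (E * F)%type :=
  @Manifold K (E * F)%type (M * N)%type prod_chart prod_hausdorff prod_is_chart
    prod_mem prod_compat.

End Product.

Section Flat.
Context {K : numFieldType} (E : normedModType K).

Definition id_chart : chart E E := Chart setT id id.

Lemma id_is_chart : is_chart id_chart.
Proof.
by split=> // [||p _|p _]; rewrite /chart_img ?image_id; try exact: openT;
  exact: cvg_id.
Qed.

Lemma Ck_cst k (U : set E) (v : E) : Ck k U (fun=> v).
Proof.
elim: k v => [|k IH] v /=; first by move=> x _; exact: cvg_cst.
split=> [x _|w]; first exact: differentiable_cst.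
have -> : (fun x => 'D_w (fun=> v) x) = fun=> 0 by apply: funext => x; exact: derive_cst.
exact: IH.
Qed.

Lemma id_analytic (U : set E) : analytic U (@id E).
Proof.
have Did v : (fun x => 'D_v (@id E) x) = fun=> v.
  by apply: funext => x; exact: derive_id.
split.
  case=> [x _|k]; first exact: cvg_id.
  split=> [x _|v]; last by rewrite Did; exact: Ck_cst.
  exact: (@ex_diff _ _ _ _ _ _ _ (is_diff_id x)).
move=> a _; near=> h; apply: cvg_near_cst; exists 2%N => // n /= n2.
pose D (g : E -> E) x := 'D_h g x; rewrite -/D.
have D0 j : iter j.+2 D id = fun=> 0.
  elim: j => [|j IHj]; last by rewrite iterS IHj; apply: funext => x; exact: derive_cst.
  by rewrite /= {2}/D Did; apply: funext => x; exact: derive_cst.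
rewrite /series /= big_ltn ?(ltn_trans _ n2) // big_ltn //=.
rewrite fact0 factS fact0 muln1 invr1 !scale1r {1}/D derive_id.
rewrite big_nat big1 ?addr0 // => i /andP[i2 _].
have -> : i = (i - 2).+2 by rewrite -addn2 subnK.
by rewrite D0 scaler0.
Unshelve. all: by end_near. Qed.

Lemma flat_compat (p q : E) : analytic
  (chart_fun id_chart @` (chart_dom id_chart `&` chart_dom id_chart))
  (chart_fun id_chart \o chart_inv id_chart).
Proof. exact: id_analytic. Qed.

Definition flat : manifold E :=
  @Manifold K E E (fun=> id_chart) (@norm_hausdorff _ _) (fun=> id_is_chart)
    (fun=> I) flat_compat.

End Flat.

Section Calculus.
Context {K : numFieldType} {E F : normedModType K}.
Variables (M : manifold E) (N : manifold F).

(* The tangent space at [p] is identified with [E] by the chart [chart_at p]. *)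
Definition chart_expr (f : M -> N) (p : M) : E -> F :=
  chart_fun (chart_at (f p)) \o f \o chart_inv (chart_at p).

Definition chart_expr_dom (U : set M) (f : M -> N) (p : M) : set E :=
  chart_fun (chart_at p) @`
    (U `&` chart_dom (chart_at p) `&` f @^-1` chart_dom (chart_at (f p))).

Definition smooth_map (f : M -> N) : Prop :=
  forall p, {for p, continuous f} /\
    smooth (chart_expr_dom setT f p) (chart_expr f p).

Definition analytic_on (U : set M) (f : M -> N) : Prop :=
  forall p, U p -> {for p, continuous f} /\
    analytic (chart_expr_dom U f p) (chart_expr f p).

Definition mdiff (f : M -> N) (p : M) : E -> F :=
  'd (chart_expr f p) (chart_fun (chart_at p) p).

Definition pullback2 (f : M -> N) (a : N -> F -> F -> K) (p : M) (u v : E) : K :=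
  a (f p) (mdiff f p u) (mdiff f p v).

Definition pullback3 (f : M -> N) (a : N -> F -> F -> F -> K) (p : M)
    (u v w : E) : K :=
  a (f p) (mdiff f p u) (mdiff f p v) (mdiff f p w).

End Calculus.

Section Forms.
Context {K : numFieldType} {E : normedModType K}.
Variable M : manifold E.

(* The differential at [x] of the inverse of the chart around [p]. *)
Definition chart_tangent (p : M) (x : E) : E -> E :=
  'd (chart_fun (chart_at (chart_inv (chart_at p) x)) \o chart_inv (chart_at p)) x.

Definition form2_in_chart (p : M) (a : M -> E -> E -> K) (u v : E) : E -> K^o :=
  fun x => a (chart_inv (chart_at p) x) (chart_tangent p x u) (chart_tangent p x v).

Record is_form2 (a : M -> E -> E -> K) : Prop := IsForm2 {
  form2_linearl : forall p v k u u',
    a p (k *: u + u') v = k * a p u v + a p u' v;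
  form2_linearr : forall p u k v v',
    a p u (k *: v + v') = k * a p u v + a p u v';
  form2_alternating : forall p u, a p u u = 0;
  form2_smooth : forall p u v,
    smooth (chart_img (chart_at p)) (form2_in_chart p a u v)
}.

Definition ext_deriv2 (a : M -> E -> E -> K) (p : M) (u v w : E) : K :=
  let x := chart_fun (chart_at p) p in
  'D_u (form2_in_chart p a v w) x - 'D_v (form2_in_chart p a u w) x
  + 'D_w (form2_in_chart p a u v) x.

Definition field_in_chart (p : M) (V : M -> E) : E -> E :=
  fun x => 'd (chart_fun (chart_at p) \o
               chart_inv (chart_at (chart_inv (chart_at p) x)))
              (chart_fun (chart_at (chart_inv (chart_at p) x))
                         (chart_inv (chart_at p) x))
              (V (chart_inv (chart_at p) x)).

Definition field_bracket (V W : M -> E) (p : M) : E :=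
  let x := chart_fun (chart_at p) p in
  'D_(V p) (field_in_chart p W) x - 'D_(W p) (field_in_chart p V) x.

End Forms.

Record lieGroup (K : numFieldType) (n : nat) := LieGroup {
  lie_mfd :> manifold 'rV[K]_n;
  lie_one : lie_mfd;
  lie_inv : lie_mfd -> lie_mfd;
  lie_mul : lie_mfd -> lie_mfd -> lie_mfd;
  lie_mulA : associative lie_mul;
  lie_mul1 : left_id lie_one lie_mul;
  lie_mulV : left_inverse lie_one lie_inv lie_mul;
  lie_mul_analytic : analytic_on (M := prod_manifold lie_mfd lie_mfd)
    setT (fun z => lie_mul z.1 z.2);
  lie_inv_analytic : analytic_on setT lie_inv
}.
Arguments lie_one {K n}.
Arguments lie_inv {K n l}.
Arguments lie_mul {K n l}.

Local Notation "g ** h" := (lie_mul g h) (at level 40, left associativity).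

Section LieTheory.
Context {K : numFieldType} {n : nat}.
Variable G : lieGroup K n.

(* The Lie algebra is the tangent space ['rV[K]_n] at the unit. *)
Local Notation g := 'rV[K]_n.

Definition lie_central (a : G) : Prop := forall b, a ** b = b ** a.

Definition mc_left (a : G) (u : g) : g := mdiff (fun b => lie_inv a ** b) a u.

Definition mc_right (a : G) (u : g) : g := mdiff (fun b => b ** lie_inv a) a u.

Definition left_field (X : g) (a : G) : g := mdiff (fun b => a ** b) (lie_one G) X.

Definition lie_bracket (X Y : g) : g :=
  field_bracket (left_field X) (left_field Y) (lie_one G).

Definition lie_Ad (a : G) (X : g) : g :=
  mdiff (fun b => a ** b ** lie_inv a) (lie_one G) X.

(* [exp X] is the value at [1] of the one-parameter subgroup with velocity [X]. *)
Definition lie_exp (X : g) : G :=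
  xget (lie_one G) [set a | exists c : K^o -> G,
    [/\ smooth_map (M := flat K^o) c,
        forall s t, c (s + t) = c s ** c t,
        mdiff (M := flat K^o) c 0 1 = X & a = c 1]].

Record invariant_form (bul : g -> g -> K) : Prop := InvariantForm {
  bul_linear : forall k X Y Z, bul (k *: X + Y) Z = k * bul X Z + bul Y Z;
  bul_sym : forall X Y, bul X Y = bul Y X;
  bul_Ad : forall a X Y, bul (lie_Ad a X) (lie_Ad a Y) = bul X Y
}.

Definition nondegenerate_form (bul : g -> g -> K) : Prop :=
  forall X, (forall Y, bul X Y = 0) -> X = 0.

End LieTheory.

Section QuasiHamiltonian.
Context {K : numFieldType} {n : nat}.
Variable G : lieGroup K n.
Local Notation g := 'rV[K]_n.
Variable bul : g -> g -> K.

(* [[omega, omega] bul omega / 12], evaluated on left invariant fields. *)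
Definition lambda (a : G) (u v w : g) : K :=
  2^-1 * bul (lie_bracket G (mc_left a u) (mc_left a v)) (mc_left a w).

(* [omega_1 bul bar-omega_2] and [bar-omega_1 bul omega_2] as 2-forms on [G x G]. *)
Definition mc_lr (z : prod_manifold G G) (u v : g * g) : K :=
  bul (mc_left z.1 u.1) (mc_right z.2 v.2)
  - bul (mc_left z.1 v.1) (mc_right z.2 u.2).

Definition mc_rl (z : prod_manifold G G) (u v : g * g) : K :=
  bul (mc_right z.1 u.1) (mc_left z.2 v.2)
  - bul (mc_right z.1 v.1) (mc_left z.2 u.2).

Record qdata (E : normedModType K) (M : manifold E) := QData {
  q_act : G -> M -> M;
  q_form : M -> E -> E -> K;
  q_map : M -> G
}.

Record qdata2 (E : normedModType K) (M : manifold E) := QData2 {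
  q2_act : G * G -> M -> M;
  q2_form : M -> E -> E -> K;
  q2_map : M -> prod_manifold G G
}.

(* The curve [exp (- t X)] has velocity [- X] at the unit. *)
Definition fundamental_field (E : normedModType K) (M : manifold E)
    (act : G -> M -> M) (X : g) (q : M) : E :=
  mdiff (fun a => act a q) (lie_one G) (- X).

Record weakly_quasi_hamiltonian (E : normedModType K) (M : manifold E)
    (A : qdata M) : Prop := WeaklyQuasiHamiltonian {
  wqh_act1 : forall q, q_act A (lie_one G) q = q;
  wqh_actM : forall a b q, q_act A (a ** b) q = q_act A a (q_act A b q);
  wqh_act_smooth :
    smooth_map (M := prod_manifold G M) (fun z => q_act A z.1 z.2);
  wqh_form : is_form2 (q_form A);
  wqh_invariant : forall a, pullback2 (q_act A a) (q_form A) = q_form A;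
  wqh_map_smooth : smooth_map (q_map A);
  wqh_equivariant : forall a q,
    q_map A (q_act A a q) = a ** q_map A q ** lie_inv a;
  wqh_deriv : ext_deriv2 (q_form A) = pullback3 (q_map A) lambda;
  wqh_moment : forall X q v,
    q_form A q (fundamental_field (q_act A) X q) v =
    2^-1 * bul X (mc_left (q_map A q) (mdiff (q_map A) q v) +
                 mc_right (q_map A q) (mdiff (q_map A) q v))
}.

Definition weakly_nondegenerate (E : normedModType K) (M : manifold E)
    (A : qdata M) : Prop :=
  forall q, lie_central (q_map A q) ->
    forall u, (forall v, q_form A q u v = 0) -> u = 0.

Definition fusion (E : normedModType K) (M : manifold E) (A : qdata2 M) :
    qdata M :=
  {| q_act a := q2_act A (a, a);
     q_form q u v := q2_form A q u v - 2^-1 * pullback2 (q2_map A) mc_lr q u v;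
     q_map q := (q2_map A q).1 ** (q2_map A q).2 |}.

Definition prod_qdata (E F : normedModType K) (M : manifold E) (N : manifold F)
    (A : qdata M) (B : qdata N) : qdata2 (prod_manifold M N) :=
  @QData2 _ (prod_manifold M N)
    (fun c q => (q_act A c.1 q.1, q_act B c.2 q.2))
    (fun q u v => q_form A q.1 u.1 v.1 + q_form B q.2 u.2 v.2)
    (fun q => (q_map A q.1, q_map B q.2)).

Definition double : qdata2 (prod_manifold G G) :=
  @QData2 _ (prod_manifold G G)
    (fun c q => (c.1 ** q.1 ** lie_inv c.2, c.2 ** q.2 ** lie_inv c.1))
    (fun q u v => - 2^-1 * (mc_lr q u v + mc_rl q u v))
    (fun q => (q.1 ** q.2, lie_inv q.1 ** lie_inv q.2)).

(* [G^(2 l)] for [l = k.+1], as [k.+1] successive factors [G x G]. *)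
Fixpoint gpow_model (k : nat) : normedModType K :=
  if k is k'.+1 then (gpow_model k' * (g * g))%type else (g * g)%type.

Fixpoint gpow (k : nat) : manifold (gpow_model k) :=
  match k return manifold (gpow_model k) with
  | 0 => prod_manifold G G
  | k'.+1 => prod_manifold (gpow k') (prod_manifold G G)
  end.

Fixpoint fused_doubles (k : nat) : qdata (gpow k) :=
  match k return qdata (gpow k) with
  | 0 => fusion double
  | k'.+1 => fusion (prod_qdata (fused_doubles k') (fusion double))
  end.

End QuasiHamiltonian.

(* The free group on [T], as reduced words in the letters [(x, false)] for [x]
   and [(x, true)] for the inverse of [x]. *)
Section FreeGroup.
Variable T : choiceType.
Local Notation letter := (T * bool)%type.

Definition letter_inv (a : letter) : letter := (a.1, ~~ a.2).

Definition reduced (w : seq letter) : bool :=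
  sorted (fun a b => b != letter_inv a) w.

Definition push (a : letter) (w : seq letter) : seq letter :=
  if w is b :: w' then if b == letter_inv a then w' else a :: w else [:: a].

Lemma letter_invK : involutive letter_inv.
Proof. by move=> [x b]; rewrite /letter_inv /= negbK. Qed.

Lemma reduced_cons a w : reduced (a :: w) -> reduced w.
Proof. by case: w => //= b w /andP[]. Qed.

Lemma reduced_push a w : reduced w -> reduced (push a w).
Proof.
case: w => [|b w] //= h; case: eqP => [_|/eqP ne]; first exact: reduced_cons h.
by rewrite /= ne.
Qed.

Lemma push_reduced a w : reduced (a :: w) -> push a w = a :: w.
Proof. by case: w => [|b w] //= /andP[/negbTE ->]. Qed.

Lemma pushK a w : reduced w -> push (letter_inv a) (push a w) = w.
Proof.
case: w => [|b w] /=; first by rewrite letter_invK eqxx.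
move=> h; case: eqP => [e|_] /=; last by rewrite letter_invK eqxx.
by rewrite -e push_reduced.
Qed.

Record free_group := FreeGroup {
  free_word :> seq letter;
  free_reduced : reduced free_word
}.

HB.instance Definition _ := [isSub for free_word].
HB.instance Definition _ := [Choice of free_group by <:].

Lemma reduced_foldr u w : reduced w -> reduced (foldr push w u).
Proof. by move=> h; elim: u => //= a u; exact: reduced_push. Qed.

Lemma reduced_inv w : reduced w -> reduced (rev (map letter_inv w)).
Proof.
rewrite /reduced rev_sorted sorted_map; apply: sub_sorted => a b /=.
by rewrite letter_invK eq_sym (inv_eq letter_invK).
Qed.

Definition free_mul (u v : free_group) : free_group :=
  FreeGroup (reduced_foldr u (free_reduced v)).
Definition free_inv (u : free_group) : free_group :=
  FreeGroup (reduced_inv (free_reduced u)).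
Definition free_one : free_group := @FreeGroup [::] isT.

Lemma foldr_push a u w : reduced u -> reduced w ->
  foldr push w (push a u) = push a (foldr push w u).
Proof.
case: u => [|b u] //= ru rw; case: eqP => [e|] //.
rewrite e -{1}(letter_invK a) pushK //; exact: reduced_foldr.
Qed.

Lemma free_mulA : associative free_mul.
Proof.
move=> u v w; apply: val_inj => /=; case: u => u /=; elim: u => //= a u IH ru.
rewrite (IH (reduced_cons ru)) foldr_push //; last exact: free_reduced.
exact/reduced_foldr/free_reduced.
Qed.

Lemma free_mul1 : left_id free_one free_mul.
Proof. by move=> u; exact: val_inj. Qed.

Lemma foldr_nil u : reduced u -> foldr push [::] u = u.
Proof. by elim: u => //= a u IH ru; rewrite IH ?push_reduced ?(reduced_cons ru). Qed.

Lemma free_mulr1 : right_id free_one free_mul.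
Proof. by move=> u; apply: val_inj; exact/foldr_nil/free_reduced. Qed.

Lemma free_mulV : left_inverse free_one free_inv free_mul.
Proof.
move=> u; apply: val_inj => /=; case: u => u /=; elim: u => //= a u IH ru.
by rewrite rev_cons foldr_rcons -(push_reduced ru) pushK ?IH ?(reduced_cons ru).
Qed.

Lemma free_invK : involutive free_inv.
Proof.
move=> u; apply: val_inj; rewrite /= map_rev revK -map_comp.
by rewrite (eq_map (g := id)) ?map_id // => a /=; rewrite letter_invK.
Qed.

Lemma free_mulrV : right_inverse free_one free_inv free_mul.
Proof. by move=> u; rewrite -{1}(free_invK u) free_mulV. Qed.

HB.instance Definition _ := isGroup.Build free_group
  free_mulA free_mul1 free_mulr1 free_mulV free_mulrV.

Definition free_gen (x : T) : free_group := @FreeGroup [:: (x, false)] isT.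

End FreeGroup.

(* Normalized inhomogeneous chains: [C_1] and [C_2] are free abelian on the
   tuples without entries equal to the unit. *)
Section Chains.
Variable F : groupType.
Local Open Scope group_scope.

Definition nontrivial := {w : F | w != 1}.
Definition chain1 := {freeg nontrivial / int}.
Definition chain2 := {freeg (nontrivial * nontrivial)%type / int}.

Definition bar1 (w : F) : chain1 :=
  if insub w is Some w' then << w' >> else 0%R.

Definition linear_ext (X : choiceType) (V : zmodType) (f : X -> V)
    (c : {freeg X / int}) : V := (\sum_(x <- dom c) f x *~ coeff x c)%R.

Definition boundary2 (c : chain2) : chain1 :=
  linear_ext
    (fun uv => bar1 (val uv.2) - bar1 (val uv.1 * val uv.2) + bar1 (val uv.1))%R c.

End Chains.

Section Moduli.
Context {K : numFieldType} {n : nat}.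
Variable G : lieGroup K n.
Local Notation g := 'rV[K]_n.
Variable bul : g -> g -> K.

(* [(j, false)] stands for [x_j] and [(j, true)] for [y_j]. *)
Definition surface_free (l : nat) : groupType := free_group ('I_l * bool)%type.

Definition relator (l : nat) : surface_free l :=
  (\prod_(j < l)
     (free_gen (j, false) * free_gen (j, true)
      * (free_gen (j, false))^-1 * (free_gen (j, true))^-1))%g.

(* The homomorphism from the free group with the given values on generators. *)
Definition free_eval (T : choiceType) (f : T -> G) (w : free_group T) : G :=
  foldr (fun a b => (if a.2 then lie_inv (f a.1) else f a.1) ** b) (lie_one G) w.

Fixpoint gpow_coord (k : nat) : gpow G k -> nat -> G * G :=
  match k return gpow G k -> nat -> G * G with
  | 0 => fun q _ => q
  | k'.+1 => fun q i => if i == k'.+1 then q.2 else gpow_coord q.1 i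
  end.

(* [E_u chi = chi u], with [Hom(F, G)] identified with [G^(2 l)] by evaluation
   on the generators. *)
Definition word_map (k : nat) (u : surface_free k.+1) (q : gpow G k) : G :=
  free_eval (fun x : 'I_k.+1 * bool => let c := gpow_coord q x.1 in if x.2 then c.2 else c.1) u.

Definition chain_form (k : nat) (c : chain2 (surface_free k.+1))
    (q : gpow G k) (U V : @gpow_model K n k) : K :=
  linear_ext (fun uv =>
    2^-1 * pullback2 (M := gpow G k) (N := prod_manifold G G)
      (fun q => (word_map (val uv.1) q, word_map (val uv.2) q)) (mc_lr bul) q U V) c.

Fixpoint gpow_conj (k : nat) (a : G) : gpow G k -> gpow G k :=
  match k return gpow G k -> gpow G k with
  | 0 => fun q => (a ** q.1 ** lie_inv a, a ** q.2 ** lie_inv a)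
  | k'.+1 => fun q =>
      (gpow_conj a q.1, (a ** q.2.1 ** lie_inv a, a ** q.2.2 ** lie_inv a))
  end.

Definition hom_qdata (k : nat) (c : chain2 (surface_free k.+1)) :
    qdata G (gpow G k) :=
  {| q_act := @gpow_conj k;
     q_form := chain_form c;
     q_map := word_map (relator k.+1) |}.

(* A subspace of [M x g], with its tangent spaces, a 2-form, a map to the dual
   of [g] and an action. *)
Record ham_data (E : normedModType K) (M : manifold E) := HamData {
  ham_pt : set (M * g);
  ham_tangent : M * g -> set (E * g);
  ham_form : M * g -> E * g -> E * g -> K;
  ham_map : M * g -> g -> K;
  ham_act : G -> M * g -> M * g
}.

Definition ham_eq (E : normedModType K) (M : manifold E) (A B : ham_data M) :
    Prop :=
  ham_pt A = ham_pt B /\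
  forall z, ham_pt A z ->
    [/\ ham_tangent A z = ham_tangent B z,
        forall a b, ham_tangent A z a -> ham_tangent A z b ->
          ham_form A z a b = ham_form B z a b,
        ham_map A z = ham_map B z &
        forall h, ham_act A h z = ham_act B h z].

Record exp_domain (E : normedModType K) (M : manifold E) (Phi : M -> G)
    (X : g) (O : set g) : Prop := ExpDomain {
  expd_center : forall Y, lie_bracket G X Y = 0;
  expd_exp_center : lie_central (lie_exp G X);
  expd_fibre : exists q, Phi q = lie_exp G X;
  expd_open : open O;
  expd_mem : O X;
  expd_invariant : forall a Y, O Y -> O (lie_Ad (G := G) a Y);
  expd_image_open : open (lie_exp G @` O);
  expd_analytic : analytic_on (M := flat g) O (lie_exp G);
  expd_inverse : exists L : G -> flat g,
    (forall Y, O Y -> L (lie_exp G Y) = Y) /\ analytic_on (lie_exp G @` O) L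
}.

End Moduli.

Variant ground_field := Reals | Complexes.

Definition scalars (R : realType) (k : ground_field) : numFieldType :=
  match k with Reals => R | Complexes => R[i] end.

Definition of_real (R : realType) (k : ground_field) : R -> scalars R k :=
  match k return R -> scalars R k with
  | Reals => id
  | Complexes => fun t => Complex t 0
  end.

Definition integral01 (R : realType) (k : ground_field) :
    (R -> scalars R k) -> scalars R k :=
  let I (f : R -> R) := Rintegral lebesgue_measure `[0, 1] f in
  match k return (R -> scalars R k) -> scalars R k with
  | Reals => I
  | Complexes => fun f => Complex (I (fun t => complex.Re (f t)))
                                (I (fun t => complex.Im (f t)))
  end.

Section Exponentiation.
Context {R : realType} {k : ground_field} {n : nat}.
Local Notation K := (scalars R k).
Variable G : lieGroup K n.
Local Notation g := 'rV[K]_n.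
Variable bul : g -> g -> K.

(* The operator [h] in degree 3: the integral over [t] in [0, 1] of
   [t ^ 2 * a_(t Y) (Y, u, v)]. *)
Definition radial_integral (a : flat g -> g -> g -> g -> K) (Y u v : g) : K :=
  integral01 (fun t : R =>
    of_real k (t ^+ 2) * a (of_real k t *: Y) Y u v).

Definition beta : g -> g -> g -> K :=
  radial_integral (pullback3 (M := flat g) (lie_exp G) (lambda bul)).

(* The tangent space at [(m, Y)] of [{(m, Y) | Phi m = exp Y}] consists of the
   pairs with the same image in the tangent space of [G]. *)
Definition exponentiation (E : normedModType K) (M : manifold E) (A : qdata G M)
    (O : set g) : ham_data G M :=
  let tangent (z : M * g) : set (E * g) :=
    [set w | mdiff (q_map A) z.1 w.1 = mdiff (M := flat g) (lie_exp G) z.2 w.2] in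
  let form (z : M * g) (a b : E * g) : K :=
    q_form A z.1 a.1 b.1 - beta z.2 a.2 b.2 in
  {| ham_pt := [set z | [/\ O z.2, q_map A z.1 = lie_exp G z.2 &
       forall a, tangent z a -> (forall b, tangent z b -> form z a b = 0) ->
         a = 0]];
     ham_tangent := tangent;
     ham_form := form;
     ham_map := fun z => bul z.2;
     ham_act := fun a z => (q_act A a z.1, lie_Ad a z.2) |}.

Definition extended_moduli_space (l : nat) (c : chain2 (surface_free l.+1))
    (O : set g) : ham_data G (gpow G l) :=
  exponentiation (hom_qdata G bul c) O.

End Exponentiation.

(* Main.v *)
Require Import Defs.
From HB Require Import structures.
From mathcomp Require Import all_boot all_order all_algebra.
From mathcomp Require Import all_classical all_reals all_analysis.
From mathcomp Require Import complex freeg.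
From mathcomp Require Import ring.

(** Let theta_f and theta'_f = Ad_f theta_f be the pullbacks of the left and
    right Maurer-Cartan forms by a map f from a manifold to the group ([logd]
    and [rlogd]).  All 2-forms of the theorem are combinations of the forms
    theta_f . theta'_h, antisymmetrized ([pair_form]), where f and h are word
    maps.  Two identities about one such form carry the proof:
    - half of its exterior derivative is lambda_f + lambda_h - lambda_(fh),
      where lambda_f is the pullback of lambda by f ([pair_form_deriv]);
    - if f and h are equivariant, its contraction with the fundamental field of
      X is X . (eta_f + eta_h - eta_(fh)), with eta = theta + theta'
      ([pair_form_moment]).
    The right-hand sides are those of a function evaluated on the boundary of
    the cell [f|h].  Hence, if the boundary of the 2-chain c is the word r, then
    d omega_c is the pullback of lambda by r and omega_c has the moment r: the
    pair (omega_c, r) is weakly quasi-Hamiltonian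
    ([hom_weakly_quasi_hamiltonian]).

    Fusion subtracts half of a form of this kind, so that it adds the cell
    - [u|v] to a chain; the double itself is given by - [x|y] - [x^-1|y^-1].
    The cells [x|x^-1] and [y|y^-1], which have the form 0 since the bilinear
    form is symmetric, correct the boundary.  The resulting chain
    ([fusion_chain]) has the boundary r ([boundary_fusion_chain]), and its
    quasi-Hamiltonian data are equal to those of the iterated fusion
    ([fused_doubles_hom]).  This gives the first claim, and the two
    exponentiations coincide because they are applied to the same data.

    For the non-degeneracy, the property that ker sigma and ker dPhi meet only
    in 0 ([trivial_kernel]) holds for the fused double ([double_kernel]) and is
    inherited by fusions ([fusion_trivial_kernel]).  Where Phi is central, the
    moment condition reads sigma(X_M, v) = X . theta_Phi(v), so that ker sigma
    lies in ker dPhi.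

    The analytic input is the Maurer-Cartan equation for theta_f in a chart
    ([maurer_cartan]), which rests on the symmetry of second derivatives; over
    both fields of scalars this is reduced to the mean value theorem along real
    lines ([schwarz]).  The Ad-equivariance of the bracket and the infinitesimal
    invariance of the bilinear form are in turn consequences of the
    Maurer-Cartan equation, for right translations and for the multiplication
    of the group ([lie_Ad_bracket], [bul_bracket_skew]). *)

Set Implicit Arguments.
Unset Strict Implicit.
Unset Printing Implicit Defensive.
Import Order.TTheory GRing.Theory Num.Theory.
Import numFieldNormedType.Exports.
Local Open Scope classical_set_scope.
Local Open Scope ring_scope.

(** * Differential calculus in finite dimension *)

Section Scale.
Context {K : numFieldType} {F : normedModType K}.

(** Scalar multiplication under a name of its own, so that it can carry a
    structure of bilinear map. *)
Definition scale_op (a : K^o) (b : F) : F := a *: b.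

Lemma scale_op_bilinear : bilinear_for
  (GRing.Scale.Law.clone _ _ *:%R _) (GRing.Scale.Law.clone _ _ *:%R _) scale_op.
Proof.
split=> [u'|u] a x y /=; rewrite /scale_op.
- by rewrite scalerDl scalerA.
- by rewrite scalerDr !scalerA mulrC.
Qed.

HB.instance Definition _ :=
  bilinear_isBilinear.Build K K^o F F _ _ scale_op scale_op_bilinear.

Lemma scale_op_cont : continuous (fun p : K^o * F => scale_op p.1 p.2).
Proof. by move=> p; exact: scale_continuous. Qed.

End Scale.

Section CkTheory.
Context {K : numFieldType}.
Implicit Types E F : normedModType K.

(** [Ck] constrains the iterated directional derivatives point by point, so
    that smoothness can be tested near each point. *)
Lemma Ck_pointwise E F k (U : set E) (f : E -> F) :
  Ck k U f <-> forall x, U x -> Ck k [set x] f.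
Proof.
elim: k f => [|k IH] f /=.
  split=> [H x Ux _ ->|H x Ux]; first exact: H.
  exact: (H x Ux).
split=> [[df Df] x Ux|H].
  split=> [_ ->|v]; first exact: df.
  exact: (IH _).1 (Df v) x Ux.
split=> [x Ux|v]; first by have [+ _] := H x Ux; apply.
by apply/IH => x Ux; have [_] := H x Ux; apply.
Qed.

Lemma Ck_sub E F k (U V : set E) (f : E -> F) : U `<=` V -> Ck k V f -> Ck k U f.
Proof. by move=> UV /Ck_pointwise H; apply/Ck_pointwise => x /UV; exact: H. Qed.

Lemma CkW E F k (U : set E) (f : E -> F) : Ck k.+1 U f -> Ck k U f.
Proof.
elim: k f => [|k IH] f [df Df] /=.
  by move=> x Ux; exact: differentiable_continuous (df x Ux).
by split=> // v; exact: IH (Df v).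
Qed.

Lemma diff_linear_comp E F F' (L : {linear F -> F'}) (f : E -> F) x v :
  continuous L -> differentiable f x -> 'D_v (L \o f) x = L ('D_v f x).
Proof.
move=> cL df; have dL := linear_differentiable (f x) cL.
have dc : differentiable (L \o f) x by exact: differentiable_comp.
by rewrite (deriveE _ dc) (deriveE _ df) (diff_comp df dL) /= (diff_lin _ cL).
Qed.

Lemma Ck_linear E F F' k (U : set E) (f : E -> F) (L : {linear F -> F'}) :
  open U -> continuous L -> Ck k U f -> Ck k U (L \o f).
Proof.
move=> oU cL; elim: k f => [|k IH] f /=.
  by move=> cf x Ux; apply: continuous_comp; [exact: cf|exact: cL].
move=> [df Df]; split=> [x Ux|v].
  by apply: differentiable_comp; [exact: df|exact: linear_differentiable].
apply: Ck_eq_in oU _ (IH _ (Df v)) => x Ux.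
by rewrite diff_linear_comp //; exact: df.
Qed.

Lemma Ck_const E F k (U : set E) (w : F) : Ck k U (fun=> w).
Proof.
elim: k w => [|k IH] w /=; first by move=> x _; exact: cvg_cst.
split=> [x _|v]; first exact: differentiable_cst.
have -> : (fun x => 'D_v (fun=> w) x) = fun=> 0.
  by apply: funext => x; exact: derive_cst.
exact: IH.
Qed.

Lemma Ck_id E k (U : set E) : Ck k U id.
Proof. by have [+ _] := id_analytic U; apply. Qed.

Lemma Ck_add E F k (U : set E) (f g : E -> F) : open U ->
  Ck k U f -> Ck k U g -> Ck k U (fun x => f x + g x).
Proof.
move=> oU; elim: k f g => [|k IH] f g /=.
  by move=> cf cg x Ux; apply: cvgD; [exact: cf|exact: cg].
move=> [df Df] [dg Dg]; split=> [x Ux|v].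
  by apply: differentiableD; [exact: df|exact: dg].
apply: Ck_eq_in oU _ (IH _ _ (Df v) (Dg v)) => x Ux.
by rewrite deriveD //; apply: diff_derivable; [exact: df|exact: dg].
Qed.

Lemma Ck_sum E F (I : Type) (r : seq I) k (U : set E) (f : I -> E -> F) : open U ->
  (forall i, Ck k U (f i)) -> Ck k U (fun x => \sum_(i <- r) f i x).
Proof.
move=> oU cf; elim: r => [|i r IH].
  by under eq_fun do rewrite big_nil; exact: Ck_const.
by under eq_fun do rewrite big_cons; exact: Ck_add.
Qed.

Lemma diff_scale E F (a : E -> K^o) (b : E -> F) x :
  differentiable a x -> differentiable b x ->
  differentiable (fun y => a y *: b y) x /\
  forall v, 'D_v (fun y => a y *: b y) x = a x *: 'D_v b x + 'D_v a x *: b x.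
Proof.
move=> da db; have dab := differentiable_pair da db.
have ds := differentiable_bilin (f := @scale_op K F) (a x, b x) (@scale_op_cont K F).
have d : differentiable (fun y => a y *: b y) x by exact: differentiable_comp dab ds.
split=> // v; rewrite (deriveE _ d) (diff_comp dab ds) /= diff_pair //=.
by rewrite (diff_bilin (f := @scale_op K F) _ (@scale_op_cont K F)) /scale_op /= -!deriveE.
Qed.

Lemma Ck_scale E F k (U : set E) (a : E -> K^o) (b : E -> F) : open U ->
  Ck k U a -> Ck k U b -> Ck k U (fun x => a x *: b x).
Proof.
move=> oU; elim: k a b => [|k IH] a b.
  move=> /= ca cb x Ux; exact: (cvgZ (ca x Ux) (cb x Ux)).
move=> ca cb; have [da Da] := ca; have [db Db] := cb.
have /(_ _ _)dab x Ux := diff_scale (da x Ux) (db x Ux).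
split=> [x Ux|v]; first by have [] := dab x Ux.
have := Ck_add oU (IH _ _ (CkW ca) (Db v)) (IH _ _ (Da v) (CkW cb)).
by apply: Ck_eq_in oU _ => x Ux; have [_ ->] := dab x Ux.
Qed.

(** Continuous coordinates are what the chain rule needs: [Ck] speaks of
    derivatives in fixed directions, whereas the derivative of a composite
    applies the outer differential to a moving vector. *)
Definition findim E := exists (I : finType) (e : I -> E) (c : I -> {linear E -> K^o}),
  (forall i, continuous (c i)) /\ forall v, v = \sum_i c i v *: e i.

(** In the coordinates of the middle space, the derivative of the composite is
    a sum of products of a coordinate of the inner derivative with a partial
    derivative of the outer map, all of one class lower. *)
Lemma Ck_comp E F F' k (U : set E) (V : set F) (f : E -> F) (g : F -> F') :
  findim F -> open U -> (forall x, U x -> V (f x)) ->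
  Ck k U f -> Ck k V g -> Ck k U (g \o f).
Proof.
move=> [I [e [c [cc cE]]]] oU UV; elim: k g => [|k IH] g.
  by move=> cf cg x Ux; apply: continuous_comp; [exact: cf|exact/cg/UV].
move=> cf [dg Dg]; have [df Df] := cf; split=> [x Ux|v].
  by apply: differentiable_comp; [exact: df|exact/dg/UV].
have : Ck k U (fun x => \sum_i c i ('D_v f x) *: ('D_(e i) g \o f) x).
  apply: Ck_sum => // i; apply: Ck_scale => //; first exact: Ck_linear (Df v).
  exact: IH (CkW cf) (Dg (e i)).
apply: Ck_eq_in oU _ => x Ux; have dfx := df _ Ux; have dgx := dg _ (UV _ Ux).
have dc : differentiable (g \o f) x := differentiable_comp dfx dgx.
rewrite (deriveE _ dc) (diff_comp dfx dgx) /= -(deriveE _ dfx).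
transitivity ('d g (f x) (\sum_i c i ('D_v f x) *: e i)); last by rewrite -cE.
rewrite linear_sum; apply: eq_bigr => i _.
by rewrite linearZ /= (deriveE _ dgx).
Qed.

Definition smooth_at E F (f : E -> F) (x : E) :=
  exists U : set E, [/\ open U, U x & smooth U f].

Lemma smooth_atP E F (f : E -> F) x :
  smooth_at f x <-> \forall y \near x, smooth [set y] f.
Proof.
split=> [[U [oU Ux sf]]|].
  apply: filterS (open_nbhs_nbhs (conj oU Ux)) => y Uy k.
  by apply: Ck_sub (sf k) => _ ->.
move=> H; have : nbhs x [set y | smooth [set y] f] by exact: H.
rewrite nbhsE => -[U [oU Ux] sU]; exists U; split=> // k.
by apply/Ck_pointwise => y /sU; exact.
Qed.

Lemma smooth_at_eq E F (f g : E -> F) x :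
  (\forall y \near x, f y = g y) -> smooth_at f x -> smooth_at g x.
Proof.
move=> H; have : nbhs x [set y | f y = g y] by exact: H.
rewrite nbhsE => -[V [oV Vx] fg] [U [oU Ux sf]].
exists (U `&` V); split=> [| // |k]; first exact: openI.
apply: (@Ck_eq_in _ _ _ _ _ f); [exact: openI|by move=> y [_ /fg]|].
exact: Ck_sub (sf k).
Qed.

Lemma smooth_at_diff E F (f : E -> F) x : smooth_at f x -> differentiable f x.
Proof. by move=> [U [oU Ux /(_ 1%N) [df _]]]; exact: df. Qed.

Lemma smooth_at_cont E F (f : E -> F) x : smooth_at f x -> {for x, continuous f}.
Proof. by move/smooth_at_diff; exact: differentiable_continuous. Qed.

Lemma smooth_at_near E F (f : E -> F) x :
  smooth_at f x -> \forall y \near x, smooth_at f y.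
Proof.
by move=> [U [oU Ux sf]]; apply: filterS (open_nbhs_nbhs (conj oU Ux)) => y; exists U.
Qed.

Lemma smooth_at_derive E F (f : E -> F) x v :
  smooth_at f x -> smooth_at (fun y => 'D_v f y) x.
Proof.
by move=> [U [oU Ux sf]]; exists U; split=> // k; have [_] := sf k.+1; apply.
Qed.

Lemma smooth_at_const E F (w : F) (x : E) : smooth_at (fun=> w) x.
Proof. by exists setT; split=> [|//|k]; [exact: openT|exact: Ck_const]. Qed.

Lemma smooth_at_id E (x : E) : smooth_at id x.
Proof. by exists setT; split=> [|//|k]; [exact: openT|exact: Ck_id]. Qed.

Lemma smooth_at_linear E F F' (L : {linear F -> F'}) (f : E -> F) x :
  continuous L -> smooth_at f x -> smooth_at (L \o f) x.
Proof. by move=> cL [U [oU Ux sf]]; exists U; split=> // k; exact: Ck_linear. Qed.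

Lemma smooth_at_add E F (f g : E -> F) x :
  smooth_at f x -> smooth_at g x -> smooth_at (fun y => f y + g y) x.
Proof.
move=> [U [oU Ux sf]] [V [oV Vx sg]]; have oI := openI oU oV.
exists (U `&` V); split=> // k.
by apply: Ck_add => //; [apply: Ck_sub (sf k)|apply: Ck_sub (sg k)].
Qed.

Lemma smooth_at_scale E F (a : E -> K^o) (b : E -> F) x :
  smooth_at a x -> smooth_at b x -> smooth_at (fun y => a y *: b y) x.
Proof.
move=> [U [oU Ux sf]] [V [oV Vx sg]]; have oI := openI oU oV.
exists (U `&` V); split=> // k.
by apply: Ck_scale => //; [apply: Ck_sub (sf k)|apply: Ck_sub (sg k)].
Qed.

Lemma smooth_at_opp E F (f : E -> F) x : smooth_at f x -> smooth_at (fun y => - f y) x.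
Proof.
move=> sf; under eq_fun do rewrite -scaleN1r.
exact: smooth_at_scale (smooth_at_const _ _) sf.
Qed.

Lemma smooth_at_sub E F (f g : E -> F) x :
  smooth_at f x -> smooth_at g x -> smooth_at (fun y => f y - g y) x.
Proof. by move=> sf sg; apply: smooth_at_add => //; exact: smooth_at_opp. Qed.

Lemma smooth_at_sum E F (I : Type) (r : seq I) (f : I -> E -> F) x :
  (forall i, smooth_at (f i) x) -> smooth_at (fun y => \sum_(i <- r) f i y) x.
Proof.
move=> sf; elim: r => [|i r IH].
  by under eq_fun do rewrite big_nil; exact: smooth_at_const.
by under eq_fun do rewrite big_cons; exact: smooth_at_add.
Qed.

Lemma smooth_at_comp E F F' (f : E -> F) (g : F -> F') x : findim F ->
  smooth_at f x -> smooth_at g (f x) -> smooth_at (g \o f) x.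
Proof.
move=> fF sf [V [oV Vx sg]]; have [U [oU Ux sU]] := sf.
have : nbhs x (f @^-1` V) by exact: (smooth_at_cont sf) (open_nbhs_nbhs (conj oV Vx)).
rewrite nbhsE => -[W [oW Wx WV]]; have oI := openI oU oW.
exists (U `&` W); split=> // k; apply: (Ck_comp (V := V)) => // [y [_ /WV] //|].
exact: Ck_sub (sU k).
Qed.

Lemma smooth_at_smooth E F (U : set E) (f : E -> F) :
  (forall x, U x -> smooth_at f x) -> smooth U f.
Proof.
move=> H k; apply/Ck_pointwise => x /H[V [oV Vx sf]].
by apply: Ck_sub (sf k) => _ ->.
Qed.

End CkTheory.

Section FiniteDimension.
Context {K : numFieldType}.
Implicit Types E F : normedModType K.

Definition mx_coord m n (i : 'I_m) (j : 'I_n) (A : 'M[K]_(m, n)) : K^o := A i j.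

Lemma mx_coord_linear m n i j : linear (@mx_coord m n i j).
Proof. by move=> a u v; rewrite /mx_coord !mxE. Qed.

HB.instance Definition _ m n i j :=
  GRing.isLinear.Build K 'M[K]_(m, n) K^o _ (@mx_coord m n i j) (@mx_coord_linear m n i j).

Lemma mx_coord_cont m n i j : continuous (@mx_coord m n i j).
Proof. exact: coord_continuous. Qed.

Lemma findim_row n : @findim K 'rV[K]_n.
Proof.
exists 'I_n, (fun i => delta_mx 0 i), (fun i => mx_coord 0 i); split=> [i|v].
  exact: mx_coord_cont.
exact: row_sum_delta.
Qed.

Lemma fst_linear E F : linear (@fst E F). Proof. by []. Qed.
Lemma snd_linear E F : linear (@snd E F). Proof. by []. Qed.
Lemma pair0r_linear E F : linear (fun x : E => (x, 0 : F)).
Proof. by move=> a u v; congr pair; rewrite /= scaler0 add0r. Qed.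
Lemma pair0l_linear E F : linear (fun y : F => (0 : E, y)).
Proof. by move=> a u v; congr pair; rewrite /= scaler0 add0r. Qed.

Definition lin_fst E F : {linear (E * F)%type -> E} :=
  HB.pack (@fst E F) (GRing.isLinear.Build _ _ _ _ _ (@fst_linear E F)).
Definition lin_snd E F : {linear (E * F)%type -> F} :=
  HB.pack (@snd E F) (GRing.isLinear.Build _ _ _ _ _ (@snd_linear E F)).
Definition lin_inl E F : {linear E -> (E * F)%type} :=
  HB.pack (fun x : E => (x, 0 : F)) (GRing.isLinear.Build _ _ _ _ _ (@pair0r_linear E F)).
Definition lin_inr E F : {linear F -> (E * F)%type} :=
  HB.pack (fun y : F => (0 : E, y)) (GRing.isLinear.Build _ _ _ _ _ (@pair0l_linear E F)).

Lemma lin_fst_cont E F : continuous (lin_fst E F).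
Proof. by move=> z; exact: cvg_fst. Qed.
Lemma lin_snd_cont E F : continuous (lin_snd E F).
Proof. by move=> z; exact: cvg_snd. Qed.
Lemma lin_inl_cont E F : continuous (lin_inl E F).
Proof. by move=> z; apply: cvg_pair; [exact: cvg_id|exact: cvg_cst]. Qed.
Lemma lin_inr_cont E F : continuous (lin_inr E F).
Proof. by move=> z; apply: cvg_pair; [exact: cvg_cst|exact: cvg_id]. Qed.

Lemma comp_linear E F F' (L : {linear F -> F'}) (L' : {linear E -> F}) : linear (L \o L').
Proof. exact: linearP. Qed.
Definition lin_comp E F F' (L : {linear F -> F'}) (L' : {linear E -> F}) :
  {linear E -> F'} :=
  HB.pack (L \o L') (GRing.isLinear.Build _ _ _ _ _ (comp_linear L L')).

Lemma findim_prod E F : findim E -> findim F -> @findim K (E * F)%type.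
Proof.
move=> [I [e [c [cc cE]]]] [J [e' [c' [cc' cE']]]].
exists (I + J)%type,
  (fun s => match s with inl i => (e i, 0) | inr j => (0, e' j) end),
  (fun s => match s with inl i => lin_comp (c i) (lin_fst E F)
                       | inr j => lin_comp (c' j) (lin_snd E F) end); split.
  case=> i z; apply: continuous_comp;
    by [exact: lin_fst_cont|exact: lin_snd_cont|exact: cc|exact: cc'].
move=> [x y]; rewrite big_sumType /=.
have -> : \sum_i c i x *: (e i, 0 : F) = lin_inl E F x.
  by rewrite [in RHS](cE x) linear_sum; apply: eq_bigr => i _; rewrite linearZ.
have -> : \sum_i c' i y *: (0 : E, e' i) = lin_inr E F y.
  by rewrite [in RHS](cE' y) linear_sum; apply: eq_bigr => i _; rewrite linearZ.
by congr pair; rewrite /= ?addr0 ?add0r.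
Qed.

Lemma smooth_at_pair E F F' (f : E -> F) (g : E -> F') x :
  smooth_at f x -> smooth_at g x -> smooth_at (fun y => (f y, g y)) x.
Proof.
move=> sf sg.
have := smooth_at_add (smooth_at_linear (@lin_inl_cont F F') sf)
                      (smooth_at_linear (@lin_inr_cont F F') sg).
by apply: smooth_at_eq; near=> y; congr pair; rewrite /= ?addr0 ?add0r.
Unshelve. all: by end_near. Qed.

Lemma smooth_at_lin E F (L : {linear E -> F}) x : continuous L -> smooth_at L x.
Proof. by move=> cL; have := smooth_at_linear cL (smooth_at_id x). Qed.

Lemma smooth_at_fst E F (z : E * F) : smooth_at (@fst E F) z.
Proof. exact: (smooth_at_lin _ (@lin_fst_cont E F)). Qed.

Lemma smooth_at_snd E F (z : E * F) : smooth_at (@snd E F) z.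
Proof. exact: (smooth_at_lin _ (@lin_snd_cont E F)). Qed.

End FiniteDimension.

(** * Symmetry of second derivatives *)

Section RealSchwarz.
Context {R : realType}.

(** The mean value theorem in the first variable, then in the second one.  The
    left-hand side is symmetric in the two variables. *)
Lemma second_difference (h hs hst : R -> R -> R) (d : R) : 0 < d ->
  (forall s t, `|s| <= d -> `|t| <= d ->
    is_derive (s : R) 1 (h ^~ t) (hs s t) /\ is_derive (t : R) 1 (hs s) (hst s t)) ->
  exists s t, [/\ `|s| <= d, `|t| <= d &
    (h d d - h 0 d) - (h d 0 - h 0 0) = hst s t * d * d].
Proof.
move=> d0 H; have dd := ltW d0.
have nd : `|d| <= d by rewrite ger0_norm.
have n0 : `|0 : R| <= d by rewrite normr0.
have itvP (x : R) : x \in `[0, d] -> `|x| <= d.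
  by rewrite in_itv /= => /andP[x0 xd]; rewrite ger0_norm.
have oitvP (x : R) : x \in `]0, d[ -> `|x| <= d.
  by move=> /subset_itv_oo_cc; exact: itvP.
pose g s := h s d - h s 0.
have dg s : `|s| <= d -> is_derive (s : R) 1 g (hs s d - hs s 0).
  by move=> sd; apply: is_deriveB; [have [] := H s d sd nd|have [] := H s 0 sd n0].
have [s sd gE] : exists2 s, s \in `]0, d[ & g d - g 0 = (hs s d - hs s 0) * (d - 0).
  apply: MVT => // [s /oitvP|]; first exact: dg.
  by apply: derivable_within_continuous => s /itvP /dg ds; exact: (@ex_derive _ _ _ _ _ _ _ ds).
have [t td hE] : exists2 t, t \in `]0, d[ & hs s d - hs s 0 = hst s t * (d - 0).
  apply: MVT => // [t /oitvP td|]; first by have [] := H s t (oitvP _ sd) td.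
  apply: derivable_within_continuous => t /itvP td.
  exact: (@ex_derive _ _ _ _ _ _ _ (H s t (oitvP _ sd) td).2).
exists s, t; split; [exact: oitvP|exact: oitvP|].
move: gE; rewrite hE subr0 /g => <-.
ring.
Qed.

Lemma schwarz_real (h hs ht hst hts : R -> R -> R) :
  (\forall z \near (0 : R * R), [/\ is_derive (z.1 : R) 1 (h ^~ z.2) (hs z.1 z.2),
    is_derive (z.2 : R) 1 (h z.1) (ht z.1 z.2),
    is_derive (z.2 : R) 1 (hs z.1) (hst z.1 z.2) &
    is_derive (z.1 : R) 1 (ht ^~ z.2) (hts z.1 z.2)]) ->
  {for (0 : R * R), continuous (fun z => hst z.1 z.2)} ->
  {for (0 : R * R), continuous (fun z => hts z.1 z.2)} ->
  hst 0 0 = hts 0 0.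
Proof.
move=> D cst cts; apply/eqP; rewrite -subr_eq0 -normr_le0; apply/ler_addgt0Pr => e e0.
rewrite add0r; have e2 : 0 < e / 2 by rewrite divr_gt0.
have n1 := (cvgrPdist_lt _ _).1 cst _ e2.
have n2 := (cvgrPdist_lt _ _).1 cts _ e2.
have : \forall z \near (0 : R * R), [/\ is_derive (z.1 : R) 1 (h ^~ z.2) (hs z.1 z.2),
    is_derive (z.2 : R) 1 (h z.1) (ht z.1 z.2),
    is_derive (z.2 : R) 1 (hs z.1) (hst z.1 z.2) &
    is_derive (z.1 : R) 1 (ht ^~ z.2) (hts z.1 z.2)] /\
    (`|hst 0 0 - hst z.1 z.2| < e / 2 /\ `|hts 0 0 - hts z.1 z.2| < e / 2).
  by near=> z; split; [|split]; near: z; [exact: D|exact: n1|exact: n2].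
move/nbhs_ballP => [r /= r0 B].
pose d := r / 2; have d0 : 0 < d by rewrite divr_gt0.
have dr : d < r by rewrite /d ltr_pdivrMr // ltr_pMr // ltr1n.
have inB s t : `|s| <= d -> `|t| <= d -> ball (0 : R * R) r (s, t).
  by move=> sd td; split; rewrite /= -ball_normE /= sub0r normrN; exact: le_lt_trans dr.
have {B inB} B (s t : R) (sd : `|s| <= d) (td : `|t| <= d) := B (s, t) (inB s t sd td).
have [s [t [sd td E1]]] : exists s t, [/\ `|s| <= d, `|t| <= d &
    (h d d - h 0 d) - (h d 0 - h 0 0) = hst s t * d * d].
  by apply: (second_difference (hs := hs)) => // s t sd td; have [[]] := B s t sd td.
have [t' [s' [td' sd' E2]]] : exists t s, [/\ `|t| <= d, `|s| <= d &
    (h d d - h d 0) - (h 0 d - h 0 0) = hts s t * d * d].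
  apply: (@second_difference (fun t s => h s t) (fun t s => ht s t) (fun t s => hts s t)) => // t' s' td' sd'.
  by have [[]] := B s' t' sd' td'.
have E : hst s t = hts s' t'.
  have dn0 : d != 0 by rewrite gt_eqF.
  apply: (mulIf dn0); apply: (mulIf dn0); rewrite -E1 -E2; ring.
have [_ [b1 _]] := B s t sd td.
have [_ [_ b2]] := B s' t' sd' td'.
have -> : hst 0 0 - hts 0 0 = (hst 0 0 - hst s t) - (hts 0 0 - hts s' t').
  by rewrite E opprB addrA subrK.
rewrite (le_trans (ler_normB _ _)) // [leRHS](splitr e).
by rewrite lerD // ltW.
Unshelve. all: by end_near. Qed.

End RealSchwarz.

Section RestrictionToReals.
Context {R : realType} {K : numFieldType}.
Variables (i : R -> K^o) (re : K^o -> R).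
Hypotheses (iD : forall s t, i (s + t) = i s + i t)
  (iV : forall t, (i t)^-1 = i t^-1)
  (i_cont : continuous i)
  (i_neq0 : forall t, t != 0 -> i t != 0)
  (reB : forall z w, re (z - w) = re z - re w)
  (reM : forall t z, re (i t * z) = t * re z)
  (re_cont : continuous re).

Let i0 : i 0 = 0.
Proof. by apply: (addrI (i 0)); rewrite -iD !addr0. Qed.

(** A derivative over [K] in the direction [u] becomes a real derivative along
    the real line [x + t u], after composition with the real-linear map [re]. *)
Lemma is_derive_real_path (E : normedModType K) (f : E -> K^o) (x u : E) (s : R) :
  differentiable f (x + i s *: u) ->
  is_derive s 1 (fun s' : R => re (f (x + i s' *: u)))
    (re ('D_u f (x + i s *: u))).
Proof.
move=> /diff_derivable-/(_ u) df; set y := x + _ in df *.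
pose q (h : K) := h^-1 *: ((f \o shift y) (h *: u) - f y).
have {}df : q h @[h --> 0^'] --> 'D_u f y := df.
have ci : (i : R -> K) @ (0 : R)^' --> (0 : K)^'.
  move=> A /= nA; have {}nA : nbhs (0 : K) (fun z => z != 0 -> A z) := nA.
  have := i_cont (x := 0); rewrite /continuous_at i0 => /(_ _ nA) H.
  have {}H : \forall t \near (0 : R), i t != 0 -> A (i t) by exact: H.
  suff : \forall t \near (0 : R), t != 0 -> A (i t) by [].
  by near=> t => /i_neq0; near: t.
pose g (s' : R) := re (f (x + i s' *: u)).
have cv : h^-1 *: ((g \o shift s) (h *: (1 : R)) - g s) @[h --> (0 : R)^'] -->
    re ('D_u f y).
  have := cvg_comp _ _ (cvg_comp _ _ ci df) (re_cont (x := 'D_u f y)).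
  apply: cvg_trans; apply: near_eq_cvg; near=> h.
  transitivity (re (i h^-1 * (f (i h *: u + y) - f y))); first by rewrite /= /q /= iV.
  by rewrite reM reB /g /= (mulr1 h : h *: (1 : R) = h) iD scalerDl addrCA.
exact: DeriveDef (cvgP _ cv) (cvg_lim (@norm_hausdorff _ _) cv).
Unshelve. all: by end_near. Qed.

(** The mixed derivatives are those of a function of two real parameters, the
    coefficients of [u] and [v]. *)
Lemma schwarz_re (E : normedModType K) (f : E -> K^o) (x u v : E) :
  smooth_at f x ->
  re ('D_v (fun y => 'D_u f y) x) = re ('D_u (fun y => 'D_v f y) x).
Proof.
move=> sf; pose p (z : R * R) : E := x + i z.1 *: u + i z.2 *: v.
have p0 : p 0 = x by rewrite /p /= i0 !scale0r !addr0.
have cp : {for (0 : R * R), continuous p}.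
  apply: cvgD.
    apply: cvgD; first exact: cvg_cst.
    apply: cvgZr_tmp.
    exact: (continuous_comp (@continuous_fst R R (0 : R * R)) (@i_cont _)).
  apply: cvgZr_tmp.
  exact: (continuous_comp (@continuous_snd R R (0 : R * R)) (@i_cont _)).
pose h s t := re (f (p (s, t))).
pose D1 w s t := re ('D_w f (p (s, t))).
pose D2 w w' s t := re ('D_w' (fun y => 'D_w f y) (p (s, t))).
have cD w w' : {for (0 : R * R), continuous (fun z => D2 w w' z.1 z.2)}.
  have cf : {for x, continuous (fun y => 'D_w' (fun y => 'D_w f y) y)}.
    exact/smooth_at_cont/smooth_at_derive/smooth_at_derive.
  rewrite -p0 in cf.
  have := continuous_comp (continuous_comp cp cf) (@re_cont _).
  by apply: cvg_trans; apply: near_eq_cvg; near=> z; rewrite /= /D2 -surjective_pairing.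
have -> : x = p (0, 0) by rewrite p0.
apply: (@schwarz_real R h (D1 u) (D1 v) (D2 u v) (D2 v u)) => //.
have : \forall y \near p 0, smooth_at f y by rewrite p0; exact: smooth_at_near.
move=> H; have {}H : \forall z \near (0 : R * R), smooth_at f (p z) := cp _ H.
apply: filterS H => -[s t] /= spt.
have d g w : smooth_at g (p (s, t)) ->
    differentiable g (p (s, t)) by move=> *; exact: smooth_at_diff.
have E1 g : smooth_at g (p (s, t)) ->
    is_derive s 1 (fun s' => re (g (p (s', t)))) (re ('D_u g (p (s, t)))).
  move=> sg; have := @is_derive_real_path E g (x + i t *: v) u s.
  rewrite -addrAC => /(_ (smooth_at_diff sg)).
  by congr is_derive; apply: funext => s'; rewrite /p /= addrAC.
have E2 g : smooth_at g (p (s, t)) ->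
    is_derive t 1 (fun t' => re (g (p (s, t')))) (re ('D_v g (p (s, t)))).
  move=> sg; exact: (@is_derive_real_path E g (x + i s *: u) v t (smooth_at_diff sg)).
split; [exact: E1|exact: E2|apply: (E2 (fun y => 'D_u f y))|
  apply: (E1 (fun y => 'D_v f y))]; exact: smooth_at_derive.
Unshelve. all: by end_near. Qed.

End RestrictionToReals.

(** Used with the real and the imaginary part for [p]. *)
Lemma uniform_continuous_scalar (R : realType) (K : numFieldType) (p : K^o -> R) :
  (forall e : R, 0 < e -> exists2 d : K, 0 < d &
     forall z w : K, `|z - w| < d -> `|p z - p w| < e) -> continuous p.
Proof.
move=> H z.
apply: (@cvgrPdist_lt _ _ _ (nbhs (z : K^o)) (nbhs_filter (z : K^o)) _ _).2 => e /H[d d0 Hd].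
have : \forall w \near (z : K^o), `|(z : K^o) - w| < d.
  exact: (@cvgrPdist_lt _ _ _ (nbhs (z : K^o)) (nbhs_filter (z : K^o)) _ _).1 cvg_id _ d0.
by apply: filterS => w; exact: Hd.
Qed.

Section Schwarz.
Context {R : realType}.
Local Notation C := (R[i] : numFieldType).

Definition real_to_C (t : R) : C^o := Complex t 0.
Definition Re_fun (z : C^o) : R := complex.Re z.
Definition Im_fun (z : C^o) : R := complex.Im z.

Lemma norm_real_to_C (t : R) : `|Complex t 0 : C| = Complex `|t| 0.
Proof. by rewrite normc_def /= expr0n /= addr0 sqrtr_sqr. Qed.

Lemma real_to_C_cont : continuous real_to_C.
Proof.
move=> t; apply/cvgrPdist_lt => e; rewrite ltcE /= => /andP[/eqP e1 e0].
near=> t'; rewrite (_ : real_to_C t - real_to_C t' = Complex (t - t') 0); last first.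
  by apply/eqP; rewrite eq_complex /= !subr0 !eqxx.
rewrite norm_real_to_C ltcE /= e1 eqxx /=; near: t'.
exact: (cvgrPdist_lt _ _).1 (@cvg_id _ (nbhs t)) _ e0.
Unshelve. all: by end_near. Qed.

Lemma norm_Im_le (z : C) : Complex `|complex.Im z| 0 <= `|z|.
Proof.
by rewrite normc_def lecE /= eqxx /= -sqrtr_sqr ler_sqrt ?lerDr ?addr_ge0 ?sqr_ge0.
Qed.

Lemma ReIm_cont : continuous Re_fun /\ continuous Im_fun.
Proof.
have H (p : C^o -> R) : (forall z w, p (z - w) = p z - p w) ->
    (forall z : C, Complex `|p z| 0 <= `|z|) -> continuous p.
  move=> pB pn; apply: uniform_continuous_scalar => e e0; exists (Complex e 0).
    by rewrite ltcE /= eqxx.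
  move=> z w zw; rewrite -pB; have := le_lt_trans (pn (z - w)) zw.
  by rewrite ltcE /= eqxx.
split; apply: H; [by move=> [a b] [a' b']|exact: normc_ge_Re|by move=> [a b] [a' b']|].
exact: norm_Im_le.
Qed.

(** Over the complex numbers, real and imaginary parts are treated separately. *)
Lemma schwarz_scalar (k : ground_field) (E : normedModType (scalars R k))
    (f : E -> (scalars R k)^o) (x u v : E) : smooth_at f x ->
  'D_v (fun y => 'D_u f y) x = 'D_u (fun y => 'D_v f y) x.
Proof.
case: k E f x u v => /= E f x u v sf.
  apply: (@schwarz_re R R (fun t => t) (fun t => t)) => // t; exact: cvg_id.
have Hm (t : R) (z : C) : (Re_fun (real_to_C t * z) = t * Re_fun z) *
   (Im_fun (real_to_C t * z) = t * Im_fun z).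
  by case: z => a b; rewrite /Re_fun /Im_fun /= !mul0r subr0 addr0.
have [cr ci] := ReIm_cont.
have S (p : C^o -> R) : (forall z w, p (z - w) = p z - p w) ->
    (forall t z, p (real_to_C t * z) = t * p z) -> continuous p ->
    p ('D_v (fun y => 'D_u f y) x) = p ('D_u (fun y => 'D_v f y) x).
  move=> pB pM pc; apply: (@schwarz_re R C real_to_C p) => //.
  - by move=> s t; apply/eqP; rewrite eq_complex /= addr0 !eqxx.
  - move=> t; have [->|t0] := eqVneq t 0; first by rewrite [in RHS]invr0; exact: (@invr0 C).
    apply: (mulIf (x := (real_to_C t : C))).
      by apply: contra t0; rewrite eq_complex /= => /andP[].
    rewrite mulVf.
      by apply/eqP; rewrite eq_complex /= !mulr0 mul0r subr0 addr0 mulVf // !eqxx.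
    by apply: contra t0; rewrite eq_complex /= => /andP[].
  - exact: real_to_C_cont.
  - by move=> t; apply: contra; rewrite eq_complex /= => /andP[].
apply/eqP; rewrite eq_complex; apply/andP; split; apply/eqP.
  by apply: (S Re_fun) => //; [move=> [a b] [a' b']|move=> t z; exact: (Hm t z).1].
by apply: (S Im_fun) => //; [move=> [a b] [a' b']|move=> t z; exact: (Hm t z).2].
Qed.

Lemma schwarz (k : ground_field) (E : normedModType (scalars R k)) n
    (f : E -> 'rV[scalars R k]_n) (x u v : E) : smooth_at f x ->
  'D_v (fun y => 'D_u f y) x = 'D_u (fun y => 'D_v f y) x.
Proof.
move=> sf; apply/rowP => j; set K := scalars R k in E f x u v sf *.
have cc := @mx_coord_cont K 1 n 0 j.
have H w w' : ('D_w' (fun y => 'D_w f y) x) 0 j =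
    'D_w' (fun y => 'D_w (mx_coord 0 j \o f) y) x.
  transitivity ('D_w' (mx_coord 0 j \o (fun y => 'D_w f y)) x).
    have d : differentiable (fun y => 'D_w f y) x by exact/smooth_at_diff/smooth_at_derive.
    by rewrite (diff_linear_comp w' cc d).
  apply: (@near_eq_derive _ _ _ (mx_coord 0 j \o (fun y => 'D_w f y))
    (fun y => 'D_w (mx_coord 0 j \o f) y)).
  apply: filterS (smooth_at_near sf) => y sy.
  by rewrite (diff_linear_comp w cc (smooth_at_diff sy)).
have sc := schwarz_scalar u v (smooth_at_linear cc sf).
exact: etrans (H u v) (etrans sc (esym (H v u))).
Qed.

End Schwarz.

(** All that the sequel needs to know about the field of scalars; Lie groups can
    then be treated over an abstract field. *)
Definition symmetric_derivatives (K : numFieldType) : Prop :=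
  forall (E : normedModType K) n (f : E -> 'rV[K]_n) (x u v : E), smooth_at f x ->
  'D_v (fun y => 'D_u f y) x = 'D_u (fun y => 'D_v f y) x.

(** * Smooth maps between manifolds *)

Section SmoothAtPoint.
Context {K : numFieldType}.
Implicit Types E F H : normedModType K.

(** Smoothness at one point, in the charts attached to this point and to its
    image: this notion composes without a change of charts. *)
Definition msmooth E F (M : manifold E) (N : manifold F) (f : M -> N) (p : M) : Prop :=
  {for p, continuous f} /\
  smooth_at (chart_expr f p) (chart_fun (chart_at p) p).

Section Charts.
Context {E : normedModType K} (M : manifold E).
Implicit Types p q : M.

Lemma chart_inv_fun p q : chart_dom (chart_at p) q ->
  chart_inv (chart_at p) (chart_fun (chart_at p) q) = q.
Proof. exact: (chart_funK (mfd_chart p)). Qed.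

Lemma chart_inv_center p : chart_inv (chart_at p) (chart_fun (chart_at p) p) = p.
Proof. exact/chart_inv_fun/mfd_mem. Qed.

Lemma chart_img_center p : chart_img (chart_at p) (chart_fun (chart_at p) p).
Proof. by exists p => //; exact: mfd_mem. Qed.

Lemma chart_fun_inv p x : chart_img (chart_at p) x ->
  chart_fun (chart_at p) (chart_inv (chart_at p) x) = x.
Proof. by move=> [q pq <-]; rewrite chart_inv_fun. Qed.

Lemma chart_img_dom p x : chart_img (chart_at p) x ->
  chart_dom (chart_at p) (chart_inv (chart_at p) x).
Proof. by move=> [q pq <-]; rewrite chart_inv_fun. Qed.

Lemma near_chart_dom p q : chart_dom (chart_at p) q ->
  \forall q' \near q, chart_dom (chart_at p) q'.
Proof.
by move=> pq; apply: open_nbhs_nbhs; split=> //; exact: (chart_dom_open (mfd_chart p)).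
Qed.

Lemma near_chart_img p x : chart_img (chart_at p) x ->
  \forall y \near x, chart_img (chart_at p) y.
Proof.
by move=> px; apply: open_nbhs_nbhs; split=> //; exact: (chart_img_open (mfd_chart p)).
Qed.

Lemma near_chart_inv p (A : set M) : nbhs p A ->
  \forall x \near chart_fun (chart_at p) p, A (chart_inv (chart_at p) x).
Proof.
move=> nA; have := chart_inv_cont (mfd_chart p) (chart_img_center p).
by rewrite /prop_for /continuous_at chart_inv_center => /(_ _ nA).
Qed.

End Charts.

Lemma chart_expr_comp E F H (M : manifold E) (N : manifold F) (P : manifold H)
    (f : M -> N) (g : N -> P) p : {for p, continuous f} ->
  \forall x \near chart_fun (chart_at p) p,
    (chart_expr g (f p) \o chart_expr f p) x = chart_expr (g \o f) p x.
Proof.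
move=> cf; have := near_chart_inv (cf _ (near_chart_dom (mfd_mem (f p)))).
by apply: filterS => x /= ?; rewrite /chart_expr /= chart_inv_fun.
Qed.

Lemma chart_expr_center E F (M : manifold E) (N : manifold F) (f : M -> N) p :
  chart_expr f p (chart_fun (chart_at p) p) = chart_fun (chart_at (f p)) (f p).
Proof. by rewrite /chart_expr /= chart_inv_center. Qed.

Lemma msmooth_comp E F H (M : manifold E) (N : manifold F) (P : manifold H)
    (f : M -> N) (g : N -> P) p : findim F ->
  msmooth f p -> msmooth g (f p) -> msmooth (g \o f) p.
Proof.
move=> fF [cf sf] [cg sg]; split; first exact: continuous_comp.
apply: smooth_at_eq (chart_expr_comp g cf) _.
by apply: smooth_at_comp => //; rewrite chart_expr_center.
Qed.

Lemma mdiffE E F (M : manifold E) (N : manifold F) (f : M -> N) p u : msmooth f p ->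
  mdiff f p u = 'D_u (chart_expr f p) (chart_fun (chart_at p) p).
Proof. by move=> [_ /smooth_at_diff d]; rewrite /mdiff (deriveE _ d). Qed.

(** The chart attached to [f p] serves both as target of [f] and as source of
    [g], so that the charts cancel near [p]. *)
Lemma mdiff_comp E F H (M : manifold E) (N : manifold F) (P : manifold H)
    (f : M -> N) (g : N -> P) p u : findim F ->
  msmooth f p -> msmooth g (f p) -> mdiff (g \o f) p u = mdiff g (f p) (mdiff f p u).
Proof.
move=> fF sf sg; rewrite (mdiffE _ (msmooth_comp fF sf sg)).
have [cf /smooth_at_diff df] := sf; have [cg /smooth_at_diff dg] := sg.
rewrite -(near_eq_derive _ (chart_expr_comp g cf)).
rewrite -chart_expr_center in dg; have dc := differentiable_comp df dg.
by rewrite (deriveE _ dc) (diff_comp df dg) /= chart_expr_center.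
Qed.

Lemma mdiff_ext E F (M : manifold E) (N : manifold F) (f g : M -> N) p u :
  f =1 g -> mdiff f p u = mdiff g p u.
Proof. by move=> /funext ->. Qed.

Lemma mdiff_at E F (M : manifold E) (N : manifold F) (f : M -> N) p q u :
  p = q -> mdiff f p u = mdiff f q u.
Proof. by move->. Qed.

Lemma mdiff_lin E F (M : manifold E) (N : manifold F) (f : M -> N) p :
  linear (mdiff f p).
Proof. by move=> a u v; rewrite /mdiff linearP. Qed.

Lemma mdiff0 E F (M : manifold E) (N : manifold F) (f : M -> N) p : mdiff f p 0 = 0.
Proof. exact: linear0. Qed.
Lemma mdiffD E F (M : manifold E) (N : manifold F) (f : M -> N) p u v :
  mdiff f p (u + v) = mdiff f p u + mdiff f p v.
Proof. exact: linearD. Qed.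
Lemma mdiffN E F (M : manifold E) (N : manifold F) (f : M -> N) p u :
  mdiff f p (- u) = - mdiff f p u.
Proof. exact: linearN. Qed.

Lemma msmooth_id E (M : manifold E) (p : M) : msmooth id p.
Proof.
split; first exact: cvg_id.
apply: smooth_at_eq (smooth_at_id _).
by apply: filterS (near_chart_img (chart_img_center p)) => x px; rewrite /chart_expr /= chart_fun_inv.
Qed.

Lemma mdiff_id E (M : manifold E) (p : M) u : mdiff id p u = u.
Proof.
rewrite (mdiffE _ (msmooth_id p)).
rewrite -(@near_eq_derive _ _ _ id) ?derive_id //.
by apply: filterS (near_chart_img (chart_img_center p)) => x px; rewrite /chart_expr /= chart_fun_inv.
Qed.

Lemma msmooth_cst E F (M : manifold E) (N : manifold F) (c : N) (p : M) : msmooth (fun=> c) p.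
Proof. by split; [exact: cvg_cst|exact: smooth_at_const]. Qed.

Lemma mdiff_cst E F (M : manifold E) (N : manifold F) (c : N) (p : M) u :
  mdiff (fun=> c) p u = 0.
Proof. by rewrite (mdiffE _ (msmooth_cst _ _)); exact: derive_cst. Qed.

Lemma msmooth_flat E F (f : flat E -> flat F) x : smooth_at f x -> msmooth f x.
Proof. by move=> sf; split; [exact: smooth_at_cont|]. Qed.

Lemma msmooth_flat_smooth E F (f : flat E -> flat F) x : msmooth f x -> smooth_at f x.
Proof. by move=> [_]. Qed.

Lemma mdiff_flat E F (f : flat E -> flat F) x u : smooth_at f x ->
  mdiff f x u = 'D_u (f : E -> F) x.
Proof. by move=> /msmooth_flat/mdiffE ->. Qed.

Lemma analytic_smooth_at E F (U : set E) (f : E -> F) x :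
  open U -> analytic U f -> U x -> smooth_at f x.
Proof. by move=> oU [sf _] Ux; exists U. Qed.

Lemma msmooth_chart_fun E (M : manifold E) (p q : M) : chart_dom (chart_at p) q ->
  msmooth (N := flat E) (chart_fun (chart_at p)) q.
Proof.
move=> pq; split; first exact: (chart_fun_cont (mfd_chart p)).
apply: (analytic_smooth_at (chart_overlap_open q p) (mfd_compat q p)).
by exists q => //; split=> //; exact: mfd_mem.
Qed.

Lemma msmooth_chart_inv E (M : manifold E) (p : M) x : chart_img (chart_at p) x ->
  msmooth (M := flat E) (chart_inv (chart_at p)) x.
Proof.
move=> px; split; first exact: (chart_inv_cont (mfd_chart p)).
apply: (analytic_smooth_at (chart_overlap_open p _) (mfd_compat p (chart_inv (chart_at p) x))).
exists (chart_inv (chart_at p) x); last exact: chart_fun_inv.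
by split; [exact: chart_img_dom|exact: mfd_mem].
Qed.

(** At a point of the domain of the chart of [p], the expression of [f] is the
    composite of an inverse chart, [f] and a chart, each of them smooth there. *)
Lemma msmooth_smooth_map E F (M : manifold E) (N : manifold F) (f : M -> N) :
  findim E -> findim F -> (forall p, msmooth f p) -> smooth_map f.
Proof.
move=> fE fF sf p; split; first by have [] := sf p.
apply: smooth_at_smooth => x [q [[_ pq] /= fpq] <-].
have px : chart_img (chart_at p) (chart_fun (chart_at p) q) by exists q.
have s1 := msmooth_chart_inv px.
have s2 := msmooth_comp fE s1 (sf _).
have s3 : msmooth (N := flat F) (chart_fun (chart_at (f p)))
    (f (chart_inv (chart_at p) (chart_fun (chart_at p) q))).
  by rewrite chart_inv_fun //; exact: msmooth_chart_fun.
exact: msmooth_flat_smooth (msmooth_comp fF s2 s3).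
Qed.

Lemma smooth_map_near E F (M : manifold E) (N : manifold F) (f : M -> N) p :
  {for p, continuous f} ->
  \forall x \near chart_fun (chart_at p) p, chart_expr_dom setT f p x.
Proof.
move=> cf; have n1 := near_chart_inv (cf _ (near_chart_dom (mfd_mem (f p)))).
apply: filterS2 n1 (near_chart_img (chart_img_center p)) => x fx px.
exists (chart_inv (chart_at p) x); last exact: chart_fun_inv.
by split=> //; split=> //; exact: chart_img_dom.
Qed.

Lemma smooth_map_msmooth E F (M : manifold E) (N : manifold F) (f : M -> N) :
  smooth_map f -> forall p, msmooth f p.
Proof.
move=> sf p; have [cf /= sp] := sf p; split=> //; apply/smooth_atP.
apply: filterS (smooth_map_near cf) => y dy k.
by apply: Ck_sub (sp k) => _ ->.
Qed.

Lemma analytic_on_msmooth E F (M : manifold E) (N : manifold F) (f : M -> N) :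
  analytic_on setT f -> forall p, msmooth f p.
Proof. by move=> af; apply: smooth_map_msmooth => p; have [cf [sf _]] := af p I. Qed.

Lemma msmooth_continuous E F (M : manifold E) (N : manifold F) (f : M -> N) p :
  msmooth f p -> {for p, continuous f}.
Proof. by case. Qed.

Section Product.
Context {E F : normedModType K} (M : manifold E) (N : manifold F).
Local Notation MN := (prod_manifold M N).

Lemma msmooth_fst (z : MN) : msmooth (M := MN) (@fst M N) z.
Proof.
split; first exact: continuous_fst.
apply: smooth_at_eq (smooth_at_fst _).
apply: filterS (near_chart_img (chart_img_center z)).
by move=> x [w [/= d1 d2] <-]; rewrite /chart_expr /= chart_inv_fun.
Qed.

Lemma msmooth_snd (z : MN) : msmooth (M := MN) (@snd M N) z.
Proof.
split; first exact: continuous_snd.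
apply: smooth_at_eq (smooth_at_snd _).
apply: filterS (near_chart_img (chart_img_center z)).
by move=> x [w [/= d1 d2] <-]; rewrite /chart_expr /= chart_inv_fun.
Qed.

Lemma mdiff_fst (z : MN) u : mdiff (M := MN) (@fst M N) z u = u.1.
Proof.
rewrite (mdiffE _ (msmooth_fst z)).
rewrite -(@near_eq_derive _ _ _ (@fst E F)); last first.
  apply: filterS (near_chart_img (chart_img_center z)).
  by move=> x [w [/= d1 d2] <-]; rewrite /chart_expr /= chart_inv_fun.
have d := smooth_at_diff (smooth_at_fst (chart_fun (chart_at z) z)).
by rewrite (deriveE _ d) (diff_lin _ (@lin_fst_cont _ E F)).
Qed.

Lemma mdiff_snd (z : MN) u : mdiff (M := MN) (@snd M N) z u = u.2.
Proof.
rewrite (mdiffE _ (msmooth_snd z)).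
rewrite -(@near_eq_derive _ _ _ (@snd E F)); last first.
  apply: filterS (near_chart_img (chart_img_center z)).
  by move=> x [w [/= d1 d2] <-]; rewrite /chart_expr /= chart_inv_fun.
have d := smooth_at_diff (smooth_at_snd (chart_fun (chart_at z) z)).
by rewrite (deriveE _ d) (diff_lin _ (@lin_snd_cont _ E F)).
Qed.

Context {H : normedModType K} (P : manifold H).

Lemma msmooth_pair (f : P -> M) (g : P -> N) p :
  msmooth f p -> msmooth g p -> msmooth (N := MN) (fun q => (f q, g q)) p.
Proof.
move=> [cf sf] [cg sg]; split; first exact: cvg_pair.
exact: smooth_at_pair sf sg.
Qed.

Lemma mdiff_pair (f : P -> M) (g : P -> N) p u : msmooth f p -> msmooth g p ->
  mdiff (N := MN) (fun q => (f q, g q)) p u = (mdiff f p u, mdiff g p u).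
Proof.
move=> [cf /smooth_at_diff df] [cg /smooth_at_diff dg]; rewrite /mdiff.
have -> : chart_expr (N := MN) (fun q => (f q, g q)) p =
   (fun x => (chart_expr f p x, chart_expr g p x)) by [].
by rewrite (diff_pair df dg).
Qed.

End Product.

Lemma mdiff_partial E F H (M : manifold E) (N : manifold F) (P : manifold H)
    (f : prod_manifold M N -> P) p q u v : findim E -> findim F ->
  msmooth f (p, q) ->
  mdiff f (p, q) (u, v) = mdiff (fun p' => f (p', q)) p u + mdiff (fun q' => f (p, q')) q v.
Proof.
move=> fE fF sf; have fEF := findim_prod fE fF.
have -> : (u, v) = (u, 0) + (0, v) :> (E * F)%type.
  by congr pair; rewrite /= ?addr0 ?add0r.
rewrite mdiffD; congr (_ + _).
  have s1 := msmooth_id p; have s2 := msmooth_cst q p.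
  rewrite (mdiff_comp (M := M) (N := prod_manifold M N) (f := fun p' => (p', q)) (g := f) u fEF (msmooth_pair s1 s2) sf).
  by rewrite (mdiff_pair _ s1 s2) mdiff_id mdiff_cst.
have s1 := msmooth_cst p q; have s2 := msmooth_id q.
rewrite (mdiff_comp (M := N) (N := prod_manifold M N) (f := fun q' => (p, q')) (g := f) v fEF (msmooth_pair s1 s2) sf).
by rewrite (mdiff_pair _ s1 s2) mdiff_id mdiff_cst.
Qed.

Lemma msmooth_fst_comp E F H (M : manifold E) (N : manifold F) (P : manifold H)
    (f : P -> prod_manifold M N) p :
  findim E -> findim F -> msmooth f p -> msmooth (fun q => (f q).1) p.
Proof.
move=> fE fF sf.
exact: (@msmooth_comp _ _ _ P (prod_manifold M N) M f fst p (findim_prod fE fF) sf (msmooth_fst _)).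
Qed.

Lemma msmooth_snd_comp E F H (M : manifold E) (N : manifold F) (P : manifold H)
    (f : P -> prod_manifold M N) p :
  findim E -> findim F -> msmooth f p -> msmooth (fun q => (f q).2) p.
Proof.
move=> fE fF sf.
exact: (@msmooth_comp _ _ _ P (prod_manifold M N) N f snd p (findim_prod fE fF) sf (msmooth_snd _)).
Qed.

Lemma msmooth_comp2 E F H H' (M : manifold E) (N : manifold F) (P : manifold H)
    (Q : manifold H') (f : P -> M) (g : P -> N) (h : prod_manifold M N -> Q) p :
  findim E -> findim F -> msmooth f p -> msmooth g p -> msmooth h (f p, g p) ->
  msmooth (fun q => h (f q, g q)) p.
Proof.
move=> fE fF sf sg sh.
exact: (@msmooth_comp _ _ _ P (prod_manifold M N) Q (fun q => (f q, g q)) h p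
  (findim_prod fE fF) (msmooth_pair sf sg) sh).
Qed.

Lemma mdiff_comp2 E F H H' (M : manifold E) (N : manifold F) (P : manifold H)
    (Q : manifold H') (f : P -> M) (g : P -> N) (h : prod_manifold M N -> Q) p u :
  findim E -> findim F -> msmooth f p -> msmooth g p -> msmooth h (f p, g p) ->
  mdiff (fun q => h (f q, g q)) p u =
  mdiff (fun x => h (x, g p)) (f p) (mdiff f p u) +
  mdiff (fun y => h (f p, y)) (g p) (mdiff g p u).
Proof.
move=> fE fF sf sg sh.
rewrite (@mdiff_comp _ _ _ P (prod_manifold M N) Q (fun q => (f q, g q)) h p u
  (findim_prod fE fF) (msmooth_pair sf sg) sh).
by rewrite (mdiff_pair _ sf sg) (mdiff_partial _ _ fE fF sh).
Qed.

End SmoothAtPoint.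

(** * Maurer-Cartan forms of a Lie group *)

Local Notation "g ** h" := (lie_mul g h) (at level 40, left associativity).

Section LieGroupAlgebra.
Context {K : numFieldType} {n : nat} (G : lieGroup K n).
Implicit Types a b c : G.

Lemma lmulA a b c : a ** (b ** c) = a ** b ** c. Proof. exact: lie_mulA. Qed.
Lemma lmul1 a : lie_one G ** a = a. Proof. exact: lie_mul1. Qed.
Lemma lmulV a : lie_inv a ** a = lie_one G. Proof. exact: lie_mulV. Qed.

Lemma lmulIK a b : lie_inv a ** (a ** b) = b.
Proof. by rewrite lmulA lmulV lmul1. Qed.

Lemma lmulrV a : a ** lie_inv a = lie_one G.
Proof.
rewrite -(lmul1 (a ** _)) -{1}(lmulV (lie_inv a)) -(lmulA _ (lie_inv a)).
by rewrite (lmulIK a) lmulV.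
Qed.

Lemma lmulr1 a : a ** lie_one G = a.
Proof. by rewrite -(lmulV a) lmulA lmulrV lmul1. Qed.

Lemma lmulKI a b : a ** (lie_inv a ** b) = b.
Proof. by rewrite lmulA lmulrV lmul1. Qed.

Lemma lmulK a b : b ** a ** lie_inv a = b.
Proof. by rewrite -lmulA lmulrV lmulr1. Qed.

Lemma lmulKV a b : b ** lie_inv a ** a = b.
Proof. by rewrite -lmulA lmulV lmulr1. Qed.

Lemma linv_unique a b : a ** b = lie_one G -> b = lie_inv a.
Proof. by move=> e; rewrite -(lmulIK a b) e lmulr1. Qed.

Lemma linvK a : lie_inv (lie_inv a) = a.
Proof. by rewrite -(linv_unique (lmulV a)). Qed.

Lemma linvM a b : lie_inv (a ** b) = lie_inv b ** lie_inv a.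
Proof. by rewrite -(@linv_unique (a ** b) (lie_inv b ** lie_inv a)) // lmulA lmulK lmulrV. Qed.

Lemma linv1 : lie_inv (lie_one G) = lie_one G.
Proof. by rewrite -(@linv_unique (lie_one G) (lie_one G)) // lmul1. Qed.

End LieGroupAlgebra.

Section LogarithmicDerivative.
Context {K : numFieldType} {n : nat} (G : lieGroup K n).
Local Notation g := 'rV[K]_n.
Let fg : findim g := findim_row n.
Implicit Types a b : G.

Section Maps.
Context {E : normedModType K} (M : manifold E).
Implicit Types (f h : M -> G) (p : M).

Lemma msmooth_mul f h p : msmooth f p -> msmooth h p -> msmooth (fun q => f q ** h q) p.
Proof.
move=> sf sh; have sm := analytic_on_msmooth (@lie_mul_analytic _ _ G) (f p, h p).
exact: (msmooth_comp2 fg fg sf sh sm).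
Qed.

Lemma msmooth_inv f p : msmooth f p -> msmooth (fun q => lie_inv (f q)) p.
Proof.
move=> sf; exact: msmooth_comp fg sf (analytic_on_msmooth (@lie_inv_analytic _ _ G) (f p)).
Qed.

End Maps.

Section MapsDerivative.
Context {E : normedModType K} (M : manifold E).
Implicit Types (f h : M -> G) (p : M).

(** The two partial derivatives of the multiplication. *)
Lemma mdiff_mul f h p u : msmooth f p -> msmooth h p ->
  mdiff (fun q => f q ** h q) p u =
  mdiff (fun q => f q ** h p) p u + mdiff (fun q => f p ** h q) p u.
Proof.
move=> sf sh; have sm := analytic_on_msmooth (@lie_mul_analytic _ _ G) (f p, h p).
rewrite (mdiff_comp2 u fg fg sf sh sm) /=.
have s1 : msmooth (fun x => x ** h p) (f p) by apply: msmooth_mul; [exact: msmooth_id|exact: msmooth_cst].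
have s2 : msmooth (fun x => f p ** x) (h p) by apply: msmooth_mul; [exact: msmooth_cst|exact: msmooth_id].
by rewrite (mdiff_comp (f := f) u fg sf s1) (mdiff_comp (f := h) u fg sh s2).
Qed.

End MapsDerivative.

Lemma msmooth_lmul a b : msmooth (fun x => a ** x) b.
Proof. by apply: msmooth_mul; [exact: msmooth_cst|exact: msmooth_id]. Qed.
Lemma msmooth_rmul a b : msmooth (fun x => x ** a) b.
Proof. by apply: msmooth_mul; [exact: msmooth_id|exact: msmooth_cst]. Qed.
Lemma msmooth_conj a b : msmooth (fun x => a ** x ** lie_inv a) b.
Proof. by apply: msmooth_mul; [exact: msmooth_lmul|exact: msmooth_cst]. Qed.

Lemma lie_Ad_lin a : linear (lie_Ad (G := G) a). Proof. exact: mdiff_lin. Qed.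
Lemma lie_Ad0 a : lie_Ad a 0 = 0 :> g. Proof. exact: mdiff0. Qed.
Lemma lie_AdD a X Y : lie_Ad (G := G) a (X + Y) = lie_Ad a X + lie_Ad a Y.
Proof. exact: mdiffD. Qed.
Lemma lie_AdN a X : lie_Ad (G := G) a (- X) = - lie_Ad a X.
Proof. exact: mdiffN. Qed.

Lemma lie_Ad1 X : lie_Ad (lie_one G) X = X.
Proof.
apply: etrans (mdiff_ext _ _ _) (mdiff_id _ _) => b.
by rewrite linv1 lmulr1 lmul1.
Qed.

Lemma lie_AdM a b X : lie_Ad (a ** b) X = lie_Ad a (lie_Ad b X).
Proof.
pose C (c x : G) := c ** x ** lie_inv c.
have sC c b' : msmooth (C c) b' by exact: msmooth_conj.
have e : C b (lie_one G) = lie_one G by rewrite /C lmulr1 lmulrV.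
apply: etrans (etrans (mdiff_comp X fg (sC b (lie_one G)) (sC a _)) (mdiff_at (C a) _ e)).
by apply: mdiff_ext => x; rewrite /C /= linvM !lmulA.
Qed.

Lemma lie_AdK a X : lie_Ad (lie_inv a) (lie_Ad a X) = X.
Proof. by rewrite -lie_AdM lmulV lie_Ad1. Qed.

Lemma lie_AdVK a X : lie_Ad a (lie_Ad (lie_inv a) X) = X.
Proof. by rewrite -lie_AdM lmulrV lie_Ad1. Qed.

Lemma lie_Ad_central a X : lie_central a -> lie_Ad a X = X.
Proof.
move=> ca; apply: etrans (mdiff_ext _ _ _) (mdiff_id _ _) => b.
by rewrite ca lmulK.
Qed.

Lemma mc_right_Ad a u : mc_right a u = lie_Ad a (mc_left a u).
Proof.
pose C (c x : G) := c ** x ** lie_inv c.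
have sC b' : msmooth (C a) b' by exact: msmooth_conj.
have sL : msmooth (fun x => lie_inv a ** x) a by exact: msmooth_lmul.
apply: etrans (etrans (mdiff_comp u fg sL (sC _)) (mdiff_at (C a) _ (lmulV a))).
by apply: mdiff_ext => x; rewrite /C /= lmulKI.
Qed.

Lemma mc_left_lin a : linear (mc_left (G := G) a). Proof. exact: mdiff_lin. Qed.
Lemma mc_left0 a : mc_left (G := G) a 0 = 0. Proof. exact: mdiff0. Qed.
Lemma mc_left_trans a X : mc_left a (mdiff (fun x => a ** x) (lie_one G) X) = X.
Proof.
have s1 : msmooth (fun x => a ** x) (lie_one G) by exact: msmooth_lmul.
have s2 b : msmooth (fun x => lie_inv a ** x) b by exact: msmooth_lmul.
apply: etrans (esym (mdiff_at _ _ (lmulr1 a))) _.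
apply: etrans (esym (mdiff_comp X fg s1 (s2 _))) _.
by apply: etrans (mdiff_ext _ _ _) (mdiff_id _ _) => b; rewrite /= lmulIK.
Qed.

Lemma mc_left_inj a u : mc_left (G := G) a u = 0 -> u = 0.
Proof.
have s1 b : msmooth (fun x => a ** x) b by exact: msmooth_lmul.
have s2 : msmooth (fun x => lie_inv a ** x) a by exact: msmooth_lmul.
move=> e; have : mdiff (fun x => a ** x) (lie_one G) (mc_left a u) = u.
  apply: etrans (esym (mdiff_at _ _ (lmulV a))) _.
  apply: etrans (esym (mdiff_comp u fg s2 (s1 _))) _.
  by apply: etrans (mdiff_ext _ _ _) (mdiff_id _ _) => b; rewrite /= lmulKI.
by rewrite e mdiff0.
Qed.

Lemma mc_left_surj a X : exists u, mc_left (G := G) a u = X.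
Proof. by exists (mdiff (fun x => a ** x) (lie_one G) X); exact: mc_left_trans. Qed.

Lemma mc_left_one X : mc_left (lie_one G) X = X.
Proof.
apply: etrans (mdiff_ext _ _ _) (mdiff_id _ _) => b.
by rewrite linv1 lmul1.
Qed.

Section Logd.
Context {E : normedModType K} (M : manifold E).
Implicit Types (f h : M -> G) (p : M) (u v : E).

(** The pullback of the left Maurer-Cartan form by [f]. *)
Definition logd f p u : g := mc_left (f p) (mdiff f p u).

Lemma logd_lin f p : linear (logd f p).
Proof. by move=> a u v; rewrite /logd mdiff_lin mc_left_lin. Qed.

(** The form is the differential of a map with value the unit at [p], so that
    only the chart of the unit is involved, whatever the point [f p]. *)
Lemma logdE f p u : msmooth f p -> logd f p u = mdiff (fun q => lie_inv (f p) ** f q) p u.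
Proof.
by move=> sf; rewrite /logd /mc_left -(mdiff_comp u fg sf (msmooth_lmul _ _)).
Qed.

Lemma logd_cst a p u : logd (fun=> a) p u = 0.
Proof. by rewrite /logd mdiff_cst mc_left0. Qed.

(** [(f h)(p)^-1 f h] is the product of [h(p)^-1 (f(p)^-1 f) h(p)] and
    [h(p)^-1 h], both equal to the unit at [p]. *)
Lemma logd_mul f h p u : msmooth f p -> msmooth h p ->
  logd (fun q => f q ** h q) p u = lie_Ad (lie_inv (h p)) (logd f p u) + logd h p u.
Proof.
move=> sf sh; have sfh := msmooth_mul sf sh; rewrite (logdE _ sfh).
pose f0 q := lie_inv (f p) ** f q.
have s0 : msmooth f0 p by apply: msmooth_mul sf; exact: msmooth_cst.
have s1 : msmooth (fun q => lie_inv (h p) ** f0 q) p by apply: msmooth_mul s0; exact: msmooth_cst.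
have e0 : f0 p = lie_one G by exact: lmulV.
apply: etrans (mdiff_ext (g := fun q => lie_inv (h p) ** f0 q ** h q) _ _ _) _.
  by move=> q; rewrite /f0 linvM !lmulA.
rewrite (mdiff_mul _ s1 sh); congr (_ + _); last first.
  by rewrite (logdE _ sh); apply: mdiff_ext => q; rewrite e0 lmulr1.
rewrite (logdE _ sf) -/f0.
pose C (c x : G) := c ** x ** lie_inv c.
have sC : msmooth (C (lie_inv (h p))) (f0 p) by exact: msmooth_conj.
apply: etrans (etrans (mdiff_comp u fg s0 sC) (mdiff_at (C _) _ e0)).
by apply: mdiff_ext => q; rewrite /C /= linvK.
Qed.

Lemma logd_inv f p u : msmooth f p ->
  logd (fun q => lie_inv (f q)) p u = - lie_Ad (f p) (logd f p u).
Proof.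
move=> sf; have := logd_mul u sf (msmooth_inv sf).
have -> : (fun q => f q ** lie_inv (f q)) = fun=> lie_one G.
  by apply: funext => q; rewrite lmulrV.
by rewrite logd_cst linvK => /esym/eqP; rewrite addrC addr_eq0 => /eqP.
Qed.

Lemma rlogd_inv f p u : msmooth f p ->
  mc_right (f p) (mdiff f p u) = - logd (fun q => lie_inv (f q)) p u.
Proof. by move=> sf; rewrite mc_right_Ad (logd_inv _ sf) opprK. Qed.

Lemma logd_conj a f p u : msmooth f p ->
  logd (fun q => a ** f q ** lie_inv a) p u = lie_Ad a (logd f p u).
Proof.
move=> sf; have sa (b : G) := msmooth_cst b p.
rewrite (logd_mul _ (msmooth_mul (sa a) sf) (sa _)) (logd_mul _ (sa a) sf) !logd_cst.
by rewrite lie_Ad0 add0r addr0 linvK.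
Qed.

End Logd.

Lemma logd_comp (E F : normedModType K) (M : manifold E) (N : manifold F)
    (k : N -> M) (f : M -> G) q v : findim E ->
  msmooth k q -> msmooth f (k q) ->
  logd (fun q => f (k q)) q v = logd f (k q) (mdiff k q v).
Proof. by move=> fE sk sf; rewrite /logd -(mdiff_comp v fE sk sf). Qed.

End LogarithmicDerivative.

(** * The Maurer-Cartan equation *)

Section ChartDerivatives.
Context {K : numFieldType} {E : normedModType K} (M : manifold E).

Lemma mdiff_chart_fun (p : M) w : mdiff (N := flat E) (chart_fun (chart_at p)) p w = w.
Proof. exact: mdiff_id. Qed.

Lemma chart_tangentE (p : M) x u : chart_img (chart_at p) x ->
  chart_tangent p x u = mdiff (M := flat E) (chart_inv (chart_at p)) x u.
Proof. by []. Qed.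

(** At its own centre the chart induces the identification of the tangent space
    with the model. *)
Lemma chart_tangent_center (p : M) u : chart_tangent p (chart_fun (chart_at p) p) u = u.
Proof. by rewrite /chart_tangent chart_inv_center; exact: mdiff_id. Qed.

End ChartDerivatives.

Lemma derive_snd_direction {K : numFieldType} (E E' F : normedModType K)
    (h : E * E' -> F) x y v : smooth_at h (x, y) ->
  'D_(0, v) h (x, y) = 'D_v (fun y' => h (x, y')) y.
Proof.
move=> sk; have sp : smooth_at (fun y' : E' => (x, y')) y.
  exact: smooth_at_pair (smooth_at_const _ _) (smooth_at_id _).
have dk := smooth_at_diff sk; have dp := smooth_at_diff sp.
have dc : differentiable (fun y' => h (x, y')) y.
  exact: differentiable_comp dp dk.
rewrite (deriveE _ dc) (diff_comp dp dk) (deriveE _ dk) /=; congr ('d _ _ _).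
rewrite (diff_pair (differentiable_cst _ _) (smooth_at_diff (smooth_at_id _))).
by rewrite -!deriveE ?derive_id ?derive_cst //; exact: differentiable_cst.
Qed.

Section LogdInChart.
Context {K : numFieldType} {n : nat} (G : lieGroup K n).
Local Notation g := 'rV[K]_n.
Let fg : findim g := findim_row n.
Context {E : normedModType K} (M : manifold E) (fE : findim E).
Variables (f : M -> G) (sf : forall q, msmooth f q) (p : M).
Local Notation phi1 := (chart_fun (chart_at (lie_one G))).
Local Notation e := (phi1 (lie_one G)).

(** The function obtained from the form and the constant vector field [u] in the
    chart of [p]. *)
Definition logd_chart (u : E) (x : E) : g :=
  logd f (chart_inv (chart_at p) x) (chart_tangent p x u).

(** [f(x)^-1 f(y)] in the chart of the unit.  The form is the derivative in [y] on
    the diagonal ([logd_chart_kernelE]); this shows its smoothness. *)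
Definition logd_chart_kernel (z : E * E) : g :=
  phi1 (lie_inv (f (chart_inv (chart_at p) z.1)) ** f (chart_inv (chart_at p) z.2)).

Let fx (x : flat E) : G := f (chart_inv (chart_at p) x).

Let sfx x : chart_img (chart_at p) x -> msmooth fx x.
Proof. by move=> px; exact: msmooth_comp fE (msmooth_chart_inv px) (sf _). Qed.

Lemma logd_chart_logd u x : chart_img (chart_at p) x -> logd_chart u x = logd fx x u.
Proof. by move=> px; rewrite /fx (logd_comp _ fE (msmooth_chart_inv px) (sf _)). Qed.

Lemma kernel_smooth x y : chart_img (chart_at p) x -> chart_img (chart_at p) y ->
  chart_dom (chart_at (lie_one G)) (lie_inv (fx x) ** fx y) ->
  smooth_at logd_chart_kernel (x, y).
Proof.
move=> px py dxy.
have s1 : msmooth (M := flat (E * E)%type) (fun z => fx z.1) (x, y).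
  exact: (@msmooth_comp _ _ _ _ (flat (E * E)%type) (flat E) G fst fx (x, y) fE
    (msmooth_flat (smooth_at_fst _)) (sfx px)).
have s2 : msmooth (M := flat (E * E)%type) (fun z => fx z.2) (x, y).
  exact: (@msmooth_comp _ _ _ _ (flat (E * E)%type) (flat E) G snd fx (x, y) fE
    (msmooth_flat (smooth_at_snd _)) (sfx py)).
have sm := msmooth_mul (msmooth_inv s1) s2.
exact: msmooth_flat_smooth (msmooth_comp fg sm (msmooth_chart_fun dxy)).
Qed.

Lemma kernel_smooth_diag x : chart_img (chart_at p) x -> smooth_at logd_chart_kernel (x, x).
Proof. by move=> px; apply: kernel_smooth => //; rewrite lmulV; exact: mfd_mem. Qed.

Lemma logd_chart_kernelE u x : chart_img (chart_at p) x ->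
  logd_chart u x = 'D_(0, u) logd_chart_kernel (x, x).
Proof.
move=> px; rewrite derive_snd_direction; last exact: kernel_smooth_diag.
rewrite logd_chart_logd // (logdE _ (sfx px)).
have sm : msmooth (fun y => lie_inv (fx x) ** fx y) x.
  by apply: msmooth_mul; [exact: msmooth_cst|exact: sfx].
have s1 : msmooth (N := flat g) phi1 (lie_inv (fx x) ** fx x).
  by apply: msmooth_chart_fun; rewrite lmulV; exact: mfd_mem.
have := mdiff_comp (N := G) u fg sm s1; rewrite mdiff_flat; last first.
  exact: msmooth_flat_smooth (msmooth_comp fg sm s1).
by move->; rewrite lmulV mdiff_chart_fun.
Qed.

Lemma logd_chart_smooth u x : chart_img (chart_at p) x -> smooth_at (logd_chart u) x.
Proof.
move=> px; have sd : smooth_at (fun y : E => (y, y)) x.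
  exact: smooth_at_pair (smooth_at_id _) (smooth_at_id _).
have := smooth_at_comp (findim_prod fE fE) sd
  (smooth_at_derive (0, u) (kernel_smooth_diag px)).
apply: smooth_at_eq; apply: filterS (near_chart_img px) => y py.
by rewrite /= logd_chart_kernelE.
Qed.

End LogdInChart.

Section LeftFieldInChart.
Context {K : numFieldType} {n : nat} (G : lieGroup K n).
Local Notation g := 'rV[K]_n.
Let fg : findim g := findim_row n.
Local Notation phi1 := (chart_fun (chart_at (lie_one G))).
Local Notation psi1 := (chart_inv (chart_at (lie_one G))).
Local Notation e := (phi1 (lie_one G)).

Definition left_chart (X : g) : g -> g := field_in_chart (lie_one G) (left_field X).

Let mu (z : g * g) : g := phi1 (psi1 z.1 ** psi1 z.2).

(** The field is the derivative of the multiplication in its second variable at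
    the unit. *)
Lemma left_chart_smooth X : smooth_at (left_chart X) e.
Proof.
have ie := chart_img_center (lie_one G).
have smu s : chart_img (chart_at (lie_one G)) s -> smooth_at mu (s, e).
  move=> ps.
  have s1 : msmooth (M := flat (g * g)%type) (fun z => psi1 z.1) (s, e).
    exact: (@msmooth_comp _ _ _ _ (flat (g * g)%type) (flat g) G fst psi1 (s, e) fg
      (msmooth_flat (smooth_at_fst _)) (msmooth_chart_inv ps)).
  have s2 : msmooth (M := flat (g * g)%type) (fun z => psi1 z.2) (s, e).
    exact: (@msmooth_comp _ _ _ _ (flat (g * g)%type) (flat g) G snd psi1 (s, e) fg
      (msmooth_flat (smooth_at_snd _)) (msmooth_chart_inv ie)).
  have d : chart_dom (chart_at (lie_one G)) (psi1 (s, e).1 ** psi1 (s, e).2).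
    by rewrite /= chart_inv_center lmulr1; exact: chart_img_dom.
  exact: msmooth_flat_smooth (msmooth_comp fg (msmooth_mul s1 s2) (msmooth_chart_fun d)).
have sd : smooth_at (fun s : g => (s, e)) e.
  exact: smooth_at_pair (smooth_at_id _) (smooth_at_const _ _).
have := smooth_at_comp (findim_prod fg fg) sd (smooth_at_derive (0, X) (smu _ ie)).
apply: smooth_at_eq; apply: filterS (near_chart_img ie) => s ps.
rewrite /= derive_snd_direction; last exact: smu.
have db : chart_dom (chart_at (lie_one G)) (psi1 s ** lie_one G).
  by rewrite lmulr1; exact: chart_img_dom.
have sb := msmooth_chart_fun db.
have sL : msmooth (N := flat g) (fun x => phi1 (psi1 s ** x)) (lie_one G).
  exact: msmooth_comp fg (msmooth_lmul _ _) sb.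
have si := msmooth_chart_inv ie.
have sL' : msmooth (N := flat g) (fun x => phi1 (psi1 s ** x)) (psi1 e).
  by rewrite chart_inv_center.
have E1 := mdiff_comp X fg si sL'; rewrite mdiff_flat in E1; last first.
  exact: msmooth_flat_smooth (msmooth_comp fg si sL').
transitivity (mdiff (N := flat g) (fun x => phi1 (psi1 s ** x)) (lie_one G) X).
  apply: etrans E1 _; rewrite -chart_tangentE // chart_tangent_center.
  by apply: mdiff_at; exact: chart_inv_center.
apply: etrans (@mdiff_comp _ _ _ _ _ _ (flat g) (fun x => psi1 s ** x) phi1
  (lie_one G) X fg (msmooth_lmul _ _) sb) _.
exact: (mdiff_at (N := flat g) phi1 _ (lmulr1 (psi1 s))).
Qed.

Lemma left_field_one X : left_field X (lie_one G) = X.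
Proof.
by apply: etrans (mdiff_ext _ _ _) (mdiff_id _ _) => b; rewrite lmul1.
Qed.

Lemma lie_bracketE X Y :
  lie_bracket G X Y = 'D_X (left_chart Y) e - 'D_Y (left_chart X) e.
Proof. by rewrite /lie_bracket /field_bracket !left_field_one. Qed.

Lemma lie_bracketC X Y : lie_bracket G X Y = - lie_bracket G Y X.
Proof. by rewrite !lie_bracketE opprB. Qed.

End LeftFieldInChart.

Lemma cancel_common_term (V : zmodType) (a b s : V) :
  (- a + s) - (- b + s) = - (a - b).
Proof. by rewrite [- b + s]addrC opprD opprK addrA addrK opprB addrC. Qed.

Section MaurerCartan.
Context {K : numFieldType} {n : nat}.
Hypothesis schK : symmetric_derivatives K.
Variable G : lieGroup K n.
Local Notation g := 'rV[K]_n.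
Let fg : findim g := findim_row n.
Context {E : normedModType K} (M : manifold E) (fE : findim E).
Variables (f : M -> G) (sf : forall q, msmooth f q) (p : M).
Local Notation phi1 := (chart_fun (chart_at (lie_one G))).
Local Notation psi1 := (chart_inv (chart_at (lie_one G))).
Local Notation e := (phi1 (lie_one G)).
Let fx (x : flat E) : G := f (chart_inv (chart_at p) x).

Let sfx x : chart_img (chart_at p) x -> msmooth fx x.
Proof. by move=> px; exact: msmooth_comp fE (msmooth_chart_inv px) (sf _). Qed.

Let F := logd_chart_kernel f p.

(** Moving along the diagonal moves both variables of the kernel. *)
Lemma logd_chart_derive x u v : chart_img (chart_at p) x ->
  'D_u (logd_chart f p v) x =
  'D_(u, 0) (fun z => 'D_(0, v) F z) (x, x) + 'D_(0, u) (fun z => 'D_(0, v) F z) (x, x).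
Proof.
move=> px; have sd : smooth_at (fun y : E => (y, y)) x.
  exact: smooth_at_pair (smooth_at_id _) (smooth_at_id _).
have sDF := smooth_at_derive (0, v) (kernel_smooth_diag fE sf px).
have dd := smooth_at_diff sd; have dF := smooth_at_diff sDF.
rewrite -(@near_eq_derive _ _ _ ((fun z => 'D_(0, v) F z) \o (fun y => (y, y)))); last first.
  by apply: filterS (near_chart_img px) => y py; rewrite /= logd_chart_kernelE.
rewrite (deriveE _ (differentiable_comp dd dF)) (diff_comp dd dF) /= !(deriveE _ dF).
have di := smooth_at_diff (smooth_at_id x).
rewrite (diff_pair di di) -linearD; congr ('d _ _ _).
by rewrite -(deriveE u di) derive_id; congr pair; rewrite /= ?addr0 ?add0r.
Qed.

(** With [b(y) = f(y)^-1 f(x)], the kernel [f(y)^-1 f(z)] is [b(y)] times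
    [f(x)^-1 f(z)].  Its derivative in [z] at [x] is therefore the value at
    [b(y)] of the left invariant field of [logd_chart f p v x], and [b] has at
    [x] the velocity opposite to that of [f(x)^-1 f]. *)
Lemma kernel_cross_derivative x u v : chart_img (chart_at p) x ->
  'D_(u, 0) (fun z => 'D_(0, v) F z) (x, x) =
  - 'D_(logd_chart f p u x) (left_chart G (logd_chart f p v x)) e.
Proof.
move=> px; set U := logd_chart f p u x; set V := logd_chart f p v x.
have sDF := smooth_at_derive (0, v) (kernel_smooth_diag fE sf px).
have dF := smooth_at_diff sDF.
have si : smooth_at (fun y : E => (y, x)) x.
  exact: smooth_at_pair (smooth_at_id _) (smooth_at_const _ _).
have di := smooth_at_diff si.
have -> : 'D_(u, 0) (fun z => 'D_(0, v) F z) (x, x) = 'D_u (fun y => 'D_(0, v) F (y, x)) x.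
  rewrite (deriveE _ (differentiable_comp di dF)) (diff_comp di dF) /= (deriveE _ dF).
  have d0 := smooth_at_diff (smooth_at_id x).
  rewrite (diff_pair d0 (differentiable_cst _ _)).
  rewrite -(deriveE u d0) derive_id; congr ('d _ _ _); congr pair.
  by rewrite -(deriveE u (differentiable_cst _ _)) derive_cst.
(* [b] carries the dependence on the first variable, [c] below that on the second one *)
pose a := fx x; pose b (y : flat E) := lie_inv (fx y) ** a.
pose delta (y : flat E) : flat g := phi1 (b y).
have sb y : chart_img (chart_at p) y -> msmooth b y.
  by move=> py; apply: msmooth_mul; [exact/msmooth_inv/sfx|exact: msmooth_cst].
have bx : b x = lie_one G by exact: lmulV.
have nb : \forall y \near x, chart_dom (chart_at (lie_one G)) (b y).
  apply: (msmooth_continuous (sb x px)); rewrite bx.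
  exact: near_chart_dom (mfd_mem _).
have sphi : msmooth (N := flat g) phi1 (b x) by rewrite bx; exact/msmooth_chart_fun/mfd_mem.
have sdelta : smooth_at delta x.
  exact: msmooth_flat_smooth (msmooth_comp fg (sb x px) sphi).
have Ddelta : 'D_u delta x = - U.
  transitivity (mdiff b x u).
    rewrite -(mdiff_flat u sdelta) (mdiff_comp u fg (sb x px) sphi).
    by rewrite bx mdiff_chart_fun.
  pose c (y : flat E) := lie_inv a ** fx y.
  have sc : msmooth c x by apply: msmooth_mul; [exact: msmooth_cst|exact: sfx].
  have cx : c x = lie_one G by exact: lmulV.
  have := mdiff_mul u (sb x px) sc; rewrite bx cx.
  rewrite (_ : (fun y => b y ** c y) = fun=> lie_one G); last first.
    by apply: funext => y; rewrite /b /c -lmulA lmulKI lmulV.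
  rewrite mdiff_cst (_ : (fun q => b q ** _) = b); last first.
    by apply: funext => y; rewrite lmulr1.
  rewrite (_ : (fun q => _ ** c q) = c); last by apply: funext => y; rewrite lmul1.
  rewrite /U (logd_chart_logd fE sf u px) (logdE u (sfx px)) -/a -/c.
  by move/esym/eqP; rewrite addr_eq0 => /eqP.
have De : delta x = e by rewrite /delta bx.
have sL : smooth_at (left_chart G V) (delta x) by rewrite De; exact: left_chart_smooth.
have EQ : \forall y \near x, (left_chart G V \o delta) y = 'D_(0, v) F (y, x).
  apply: filterS2 nb (near_chart_img px) => y dy py.
  pose c (y' : flat E) := lie_inv a ** fx y'.
  have sc : msmooth c x by apply: msmooth_mul; [exact: msmooth_cst|exact: sfx].
  have cx : c x = lie_one G by exact: lmulV.
  rewrite derive_snd_direction; last exact: kernel_smooth.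
  have sl : msmooth (fun z => b y ** z) (c x) by exact: msmooth_lmul.
  have sp' : msmooth (N := flat g) phi1 (b y ** c x).
    by rewrite cx lmulr1; exact: msmooth_chart_fun.
  have s2 := msmooth_comp fg sc sl.
  have -> : (fun y' => F (y, y')) = (fun y' : flat E => phi1 (b y ** c y')).
    by apply: funext => y'; rewrite /F /logd_chart_kernel /= /b /c -lmulA lmulKI.
  have s3 := msmooth_comp fg s2 sp'.
  rewrite -[RHS](mdiff_flat (f := fun y' : flat E => (phi1 (b y ** c y') : flat g))); last first.
    exact: msmooth_flat_smooth s3.
  rewrite (mdiff_comp v fg s2 sp') (mdiff_comp v fg sc sl).
  transitivity (mdiff (N := flat g) phi1 (b y ** c x)
    (mdiff (fun z => b y ** z) (c x) (mdiff c x v))); last by [].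
  rewrite cx lmulr1.
  rewrite /= /delta /left_chart /field_in_chart chart_inv_fun // /left_field.
  by rewrite /V (logd_chart_logd fE sf v px) (logdE v (sfx px)).
rewrite -(near_eq_derive _ EQ).
have ds := smooth_at_diff sdelta; have dL := smooth_at_diff sL.
rewrite (deriveE _ (differentiable_comp ds dL)) (diff_comp ds dL) /=.
rewrite -(deriveE _ ds) Ddelta linearN De; congr (- _).
by rewrite De in dL; rewrite (deriveE _ dL).
Qed.

(** The second derivatives in the second variable of the kernel are symmetric
    and cancel; the mixed ones are derivatives of left invariant fields and
    make up the bracket. *)
Theorem maurer_cartan x u v : chart_img (chart_at p) x ->
  'D_u (logd_chart f p v) x - 'D_v (logd_chart f p u) x =
  - lie_bracket G (logd_chart f p u x) (logd_chart f p v x).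
Proof.
move=> px; rewrite !logd_chart_derive // (schK (0, v) (0, u)); last first.
  exact: kernel_smooth_diag.
rewrite !kernel_cross_derivative // lie_bracketE.
exact: cancel_common_term.
Qed.

End MaurerCartan.

(** * Brackets and invariant forms *)

(** In coordinates a linear map is a sum of continuous coordinates times
    constant vectors. *)
Lemma findim_linear_cont (K : numFieldType) (E F : normedModType K)
    (L : {linear E -> F}) : findim E -> continuous L.
Proof.
move=> [I [e [c [cc cE]]]] x.
have : smooth_at (fun v => \sum_i c i v *: L (e i)) x.
  apply: smooth_at_sum => i; apply: smooth_at_scale; last exact: smooth_at_const.
  exact: smooth_at_lin.
have -> : (fun v => \sum_i c i v *: L (e i)) = L; last exact: smooth_at_cont.
apply: funext => v; rewrite [in RHS](cE v) linear_sum.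
by apply: eq_bigr => i _; rewrite linearZ.
Qed.

Lemma derive_fst_direction {K : numFieldType} (E E' F : normedModType K)
    (h : E * E' -> F) x y v : smooth_at h (x, y) ->
  'D_(v, 0) h (x, y) = 'D_v (fun x' => h (x', y)) x.
Proof.
move=> sk; have sp : smooth_at (fun x' : E => (x', y)) x.
  exact: smooth_at_pair (smooth_at_id _) (smooth_at_const _ _).
have dk := smooth_at_diff sk; have dp := smooth_at_diff sp.
have dc : differentiable (fun x' => h (x', y)) x.
  exact: differentiable_comp dp dk.
rewrite (deriveE _ dc) (diff_comp dp dk) (deriveE _ dk) /=; congr ('d _ _ _).
have d0 := smooth_at_diff (smooth_at_id x).
rewrite (diff_pair d0 (differentiable_cst _ _)).
by rewrite -(deriveE v d0) -(deriveE v (differentiable_cst _ _)) derive_id derive_cst.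
Qed.

Section BilinearForm.
Context {K : numFieldType} {n : nat}.
Local Notation g := 'rV[K]_n.
Variable bul : g -> g -> K.
Hypotheses (bul_lin : forall k X Y Z, bul (k *: X + Y) Z = k * bul X Z + bul Y Z)
  (bul_symm : forall X Y, bul X Y = bul Y X).

Lemma bulDl X Y Z : bul (X + Y) Z = bul X Z + bul Y Z.
Proof. by rewrite -[X]scale1r bul_lin mul1r scale1r. Qed.
Lemma bul0l Z : bul 0 Z = 0.
Proof. by apply: (addrI (bul 0 Z)); rewrite -bulDl !addr0. Qed.
Lemma bulNl X Z : bul (- X) Z = - bul X Z.
Proof. by apply: (addrI (bul X Z)); rewrite -bulDl !subrr bul0l. Qed.
Lemma bulZl k X Z : bul (k *: X) Z = k * bul X Z.
Proof. by rewrite -[k *: X]addr0 bul_lin bul0l addr0. Qed.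
Lemma bulDr X Y Z : bul X (Y + Z) = bul X Y + bul X Z.
Proof. by rewrite !(bul_symm X) bulDl. Qed.
Lemma bulNr X Z : bul X (- Z) = - bul X Z.
Proof. by rewrite !(bul_symm X) bulNl. Qed.
Lemma bul0r X : bul X 0 = 0.
Proof. by rewrite bul_symm bul0l. Qed.
Lemma bulZr k X Z : bul X (k *: Z) = k * bul X Z.
Proof. by rewrite !(bul_symm X) bulZl. Qed.
(** The form with values in the normed module [K^o]. *)
Definition bulo (X Y : g) : K^o := bul X Y.

Lemma bulo_bilinear : bilinear_for
  (GRing.Scale.Law.clone _ _ *:%R _) (GRing.Scale.Law.clone _ _ *:%R _) bulo.
Proof.
split=> [u'|u] a x y /=; rewrite /bulo; first exact: bul_lin.
by rewrite bulDr bulZr.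
Qed.

Let bulL : {bilinear g -> g -> K^o} :=
  HB.pack bulo (bilinear_isBilinear.Build K g g K^o _ _ bulo bulo_bilinear).

Lemma smooth_at_bul (E : normedModType K) (a b : E -> g) x :
  smooth_at a x -> smooth_at b x -> smooth_at (fun y => bulo (a y) (b y)) x.
Proof.
move=> sa sb.
have -> : (fun y => bulo (a y) (b y)) =
    (fun y => \sum_i mx_coord 0 i (a y) *: \sum_j mx_coord 0 j (b y) *:
      bulo (delta_mx 0 i) (delta_mx 0 j)).
  apply: funext => y; rewrite {1}(row_sum_delta (a y)) /bulo.
  rewrite (big_morph (bul^~ (b y)) (fun X Y => bulDl X Y (b y)) (bul0l _)).
  apply: eq_bigr => i _; rewrite bulZl; congr (_ * _).
  rewrite {1}(row_sum_delta (b y)).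
  rewrite (big_morph (bul (delta_mx 0 i)) (bulDr (delta_mx 0 i)) (bul0r _)).
  by apply: eq_bigr => j _; rewrite bulZr.
apply: smooth_at_sum => i; apply: smooth_at_scale.
  exact: (smooth_at_linear (@mx_coord_cont K 1 n 0 i) sa).
apply: smooth_at_sum => j; apply: smooth_at_scale; last exact: smooth_at_const.
exact: (smooth_at_linear (@mx_coord_cont K 1 n 0 j) sb).
Qed.

Lemma bulo_cont : continuous (fun z : g * g => bulL z.1 z.2).
Proof.
move=> z; apply: smooth_at_cont.
exact: (smooth_at_bul (smooth_at_fst _) (smooth_at_snd _)).
Qed.

Lemma derive_bul (E : normedModType K) (a b : E -> g) x v :
  smooth_at a x -> smooth_at b x ->
  'D_v (fun y => bulo (a y) (b y)) x = bul ('D_v a x) (b x) + bul (a x) ('D_v b x).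
Proof.
move=> /smooth_at_diff da /smooth_at_diff db.
have dab := differentiable_pair da db.
have dL := differentiable_bilin (f := bulL) (a x, b x) bulo_cont.
have dc : differentiable (fun y => bulo (a y) (b y)) x by exact: differentiable_comp dab dL.
have eL := diff_bilin (f := bulL) (a x, b x) bulo_cont.
have ep := congr1 (fun h => h v) (diff_pair da db).
rewrite (deriveE _ dc); apply: etrans (congr1 (fun h => h v) (diff_comp dab dL)) _.
rewrite /= ep; apply: etrans (congr1 (fun h => h ('d a x v, 'd b x v)) eL) _.
exact: etrans (addrC _ _) (congr2 +%R (congr1 (bul^~ (b x)) (esym (deriveE v da)))
  (congr1 (bul (a x)) (esym (deriveE v db)))).
Qed.

End BilinearForm.

Lemma mdiff_flat_fst {K : numFieldType} (E E' : normedModType K) (z u : E * E') :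
  mdiff (M := flat (E * E')%type) (N := flat E) fst z u = u.1.
Proof.
rewrite (mdiff_flat _ (smooth_at_fst _)) (deriveE _ (smooth_at_diff (smooth_at_fst z))).
by rewrite (diff_lin _ (@lin_fst_cont _ E E')).
Qed.

Lemma mdiff_flat_snd {K : numFieldType} (E E' : normedModType K) (z u : E * E') :
  mdiff (M := flat (E * E')%type) (N := flat E') snd z u = u.2.
Proof.
rewrite (mdiff_flat _ (smooth_at_snd _)) (deriveE _ (smooth_at_diff (smooth_at_snd z))).
by rewrite (diff_lin _ (@lin_snd_cont _ E E')).
Qed.

Lemma opp_of_add0 (V : zmodType) (a b : V) : a + b = 0 -> - a = b.
Proof. by move/eqP; rewrite addrC addr_eq0 => /eqP ->. Qed.

Section BracketIdentities.
Context {K : numFieldType} {n : nat}.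
Hypothesis schK : symmetric_derivatives K.
Variable G : lieGroup K n.
Local Notation g := 'rV[K]_n.
Let fg : findim g := findim_row n.
Local Notation phi1 := (chart_fun (chart_at (lie_one G))).
Local Notation psi1 := (chart_inv (chart_at (lie_one G))).
Local Notation e := (phi1 (lie_one G)).
Local Notation "[[ X , Y ]]" := (lie_bracket G X Y).

Lemma left_chart_lin a X Y x :
  left_chart G (a *: X + Y) x = a *: left_chart G X x + left_chart G Y x.
Proof. by rewrite /left_chart /field_in_chart /left_field mdiff_lin linearP. Qed.

Lemma lie_bracketDr X Y Z : [[X, Y + Z]] = [[X, Y]] + [[X, Z]].
Proof.
have dX W := smooth_at_diff (left_chart_smooth G W).
rewrite !lie_bracketE.
have -> : left_chart G (Y + Z) = left_chart G Y + left_chart G Z.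
  by apply: funext => x; rewrite -[Y]scale1r left_chart_lin !scale1r.
rewrite (deriveD (diff_derivable (dX Y)) (diff_derivable (dX Z))).
have -> : 'D_(Y + Z) (left_chart G X) e = 'D_Y (left_chart G X) e + 'D_Z (left_chart G X) e.
  by rewrite !(deriveE _ (dX X)) linearD.
by rewrite opprD addrACA.
Qed.

Lemma lie_bracketDl X Y Z : [[X + Y, Z]] = [[X, Z]] + [[Y, Z]].
Proof. by rewrite lie_bracketC lie_bracketDr opprD (lie_bracketC G X Z) (lie_bracketC G Y Z). Qed.

Lemma lie_bracketNr X Y : [[X, - Y]] = - [[X, Y]].
Proof.
apply/eqP; rewrite -addr_eq0 -lie_bracketDr addNr.
by apply/eqP; apply: (addrI [[X, 0]]); rewrite -lie_bracketDr !addr0.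
Qed.

Lemma lie_bracketNl X Y : [[- X, Y]] = - [[X, Y]].
Proof. by rewrite lie_bracketC lie_bracketNr (lie_bracketC G X Y). Qed.

Let id1 u : logd_chart (fun q : G => q) (lie_one G) u e = u.
Proof.
rewrite /logd_chart chart_tangent_center chart_inv_center /logd mdiff_id.
exact: mc_left_one.
Qed.

Let mc_id u v :
  'D_u (logd_chart (fun q : G => q) (lie_one G) v) e -
  'D_v (logd_chart (fun q : G => q) (lie_one G) u) e = - [[u, v]].
Proof.
have s q : msmooth (fun q : G => q) q by exact: msmooth_id.
by rewrite (maurer_cartan schK fg s u v (chart_img_center _)) !id1.
Qed.

(** The Maurer-Cartan equation for [q |-> q a^-1], whose pullback form is
    [Ad_a] of the one of the identity. *)
Lemma lie_Ad_bracket (a : G) X Y : lie_Ad a [[X, Y]] = [[lie_Ad a X, lie_Ad a Y]].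
Proof.
pose f (q : G) := q ** lie_inv a.
have sid (q : G) : msmooth (fun q : G => q) q by exact: msmooth_id.
have sf q : msmooth f q by exact: msmooth_rmul.
pose A : {linear g -> g} :=
  HB.pack (lie_Ad (G := G) a) (GRing.isLinear.Build _ _ _ _ _ (lie_Ad_lin a)).
have fE u : logd_chart f (lie_one G) u = A \o logd_chart (fun q : G => q) (lie_one G) u.
  apply: funext => x; rewrite /logd_chart /f.
  by rewrite (logd_mul _ (sid _) (msmooth_cst _ _)) logd_cst addr0 linvK.
have ie := chart_img_center (lie_one G).
have := maurer_cartan schK fg sf X Y ie; rewrite !fE /= !id1.
have cA : continuous A by exact: findim_linear_cont.
have dl u := smooth_at_diff (logd_chart_smooth fg sid u ie).
have AB u v : A u - A v = A (u - v) by rewrite linearB.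
rewrite (diff_linear_comp X cA (dl Y)) (diff_linear_comp Y cA (dl X)) AB mc_id.
by rewrite /= lie_AdN => /oppr_inj.
Qed.

(** The Maurer-Cartan equation for the multiplication on [G x G], at the vectors
    [(X, 0)] and [(0, Z)].  By [logd_mul] the form maps the first one to
    [Ad_(y^-1) X] at [(e, y)] and the second one to the constant [Z] at
    [(x, e)]. *)
Lemma lie_Ad_derivative X Z :
  smooth_at (fun y => lie_Ad (lie_inv (psi1 y)) X) e /\
  'D_Z (fun y => lie_Ad (lie_inv (psi1 y)) X) e = - [[Z, X]].
Proof.
pose f (z : prod_manifold G G) : G := z.1 ** z.2.
have sf z : msmooth f z by exact: (analytic_on_msmooth (@lie_mul_analytic _ _ G) z).
have fgg := findim_prod fg fg.
pose o : prod_manifold G G := (lie_one G, lie_one G).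
have io : chart_img (chart_at o) (e, e) := chart_img_center o.
have ie := chart_img_center (lie_one G).
pose TH u := logd_chart f o u.
have THE x y u v : chart_img (chart_at (lie_one G)) x -> chart_img (chart_at (lie_one G)) y ->
    TH (u, v) (x, y) = lie_Ad (lie_inv (psi1 y)) (logd (M := flat g) psi1 x u)
      + logd (M := flat g) psi1 y v.
  move=> px py; have pxy : chart_img (chart_at o) (x, y).
    exists (psi1 x, psi1 y); first by split; exact: chart_img_dom.
    by rewrite /= /pair_map /= !chart_fun_inv.
  rewrite /TH (logd_chart_logd fgg sf _ pxy).
  have s1 : msmooth (M := flat (g * g)%type) (N := flat g) fst (x, y) := msmooth_flat (smooth_at_fst _).
  have s2 : msmooth (M := flat (g * g)%type) (N := flat g) snd (x, y) := msmooth_flat (smooth_at_snd _).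
  have t1 := msmooth_comp (N := flat g) (g := (psi1 : flat g -> G)) fg s1 (msmooth_chart_inv px).
  have t2 := msmooth_comp (N := flat g) (g := (psi1 : flat g -> G)) fg s2 (msmooth_chart_inv py).
  rewrite (logd_mul (M := flat (g * g)%type) (u, v) t1 t2).
  rewrite (logd_comp (u, v) fg s1 (msmooth_chart_inv px)).
  rewrite (logd_comp (u, v) fg s2 (msmooth_chart_inv py)) /=.
  by rewrite mdiff_flat_fst mdiff_flat_snd.
have l0 y : logd (M := flat g) psi1 y 0 = 0 by rewrite /logd mdiff0 mc_left0.
have le W : logd (M := flat g) psi1 e W = W.
  by rewrite /logd -chart_tangentE // chart_tangent_center chart_inv_center mc_left_one.
have TH1 y : chart_img (chart_at (lie_one G)) y ->
    TH (X, 0) (e, y) = lie_Ad (lie_inv (psi1 y)) X.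
  by move=> py; rewrite THE // le l0 addr0.
have TH2 x : chart_img (chart_at (lie_one G)) x -> TH (0, Z) (x, e) = Z.
  by move=> px; rewrite THE // le l0 lie_Ad0 add0r.
have sTH u : smooth_at (TH u) (e, e) := logd_chart_smooth fgg sf u io.
have n1 : \forall y \near e, TH (X, 0) (e, y) = lie_Ad (lie_inv (psi1 y)) X.
  by apply: filterS (near_chart_img ie) => y; exact: TH1.
have si : smooth_at (fun y : g => (e, y)) e.
  exact: smooth_at_pair (smooth_at_const _ _) (smooth_at_id _).
split; first exact: smooth_at_eq n1 (smooth_at_comp fgg si (sTH (X, 0))).
rewrite -(near_eq_derive _ n1) -(derive_snd_direction _ (sTH (X, 0))).
have mc : 'D_(X, 0) (TH (0, Z)) (e, e) - 'D_(0, Z) (TH (X, 0)) (e, e) =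
    - [[TH (X, 0) (e, e), TH (0, Z) (e, e)]].
  have := @maurer_cartan K n schK G _ (prod_manifold G G) fgg f sf o (e, e) (X, 0) (0, Z) io.
  by [].

have D0 : 'D_(X, 0) (TH (0, Z)) (e, e) = 0.
  rewrite (derive_fst_direction _ (sTH (0, Z))).
  rewrite (@near_eq_derive _ _ _ _ (fun=> Z)); first exact: derive_cst.
  by apply: filterS (near_chart_img ie) => y; exact: TH2.
have e1 : TH (X, 0) (e, e) = X by rewrite (TH1 e ie) chart_inv_center linv1 lie_Ad1.
rewrite D0 e1 (TH2 e ie) in mc; rewrite -(lie_bracketC G X Z).
exact: oppr_inj (etrans (esym (sub0r _)) mc).
Qed.

Section InvariantForm.
Variable bul : g -> g -> K.
Hypothesis hbul : invariant_form G bul.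
Let bl := bul_linear hbul.
Let bs := bul_sym hbul.

(** Derivative at the unit of the invariance under [Ad]. *)
Lemma bul_bracket_skew X Y Z : bul [[Z, X]] Y + bul X [[Z, Y]] = 0.
Proof.
have [sX dX] := lie_Ad_derivative X Z; have [sY dY] := lie_Ad_derivative Y Z.
have := derive_bul bl bs Z sX sY.
rewrite dX dY chart_inv_center linv1 !lie_Ad1.
rewrite (_ : (fun y => _) = fun=> bul X Y); last first.
  by apply: funext => y; exact: (bul_Ad hbul).
rewrite derive_cst (bulNl bl) (bulNr bl bs) -opprD => /esym/eqP.
by rewrite oppr_eq0 => /eqP.
Qed.

Lemma bul_bracket_cycle X Y Z : bul [[X, Y]] Z = bul [[Y, Z]] X.
Proof.
have h := opp_of_add0 (bul_bracket_skew X Z Y).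
exact: etrans (congr1 (bul^~ Z) (lie_bracketC G X Y)) (etrans (bulNl bl _ _) (etrans h (bs _ _))).
Qed.

Lemma bul_bracket_swap X Y Z : bul [[X, Y]] Z = - bul [[Y, X]] Z.
Proof. by rewrite lie_bracketC (bulNl bl). Qed.

End InvariantForm.
End BracketIdentities.

(** * The two-form of a pair of group-valued maps *)

Lemma opp_eq_opp_add (V : zmodType) (a b c : V) : a - b = - c -> - a = - b + c.
Proof. by move=> e; rewrite -[c]opprK -e opprB addKr. Qed.

(** The computation behind [pair_form_deriv]: [au], [av], [aw] are the values of
    the left form of [f] and [bu], [bv], [bw] those of the right form of [h];
    the other variables are derivatives of coefficients, which cancel.  The
    brackets come from the Maurer-Cartan equations, with opposite signs for the
    left and the right form. *)
Lemma polyakov_wiegmann_terms (K : fieldType) (V : zmodType) (br : V -> V -> V)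
    (bul : V -> V -> K) au av aw bu bv bw dvu dwu dwv evu ewu ewv :
  (forall X Y Z, br (X + Y) Z = br X Z + br Y Z) ->
  (forall X Y Z, br X (Y + Z) = br X Y + br X Z) ->
  (forall X Y Z, bul (X + Y) Z = bul X Z + bul Y Z) ->
  (forall X Y, bul X Y = bul Y X) ->
  (forall X Y, bul (- X) Y = - bul X Y) ->
  (forall X Y Z, bul (br X Y) Z = bul (br Y Z) X) ->
  (forall X Y Z, bul (br X Y) Z = - bul (br X Z) Y) ->
  2^-1 * (bul (dvu - br au av) bw + bul av (ewu + br bu bw)
      - (bul (dwu - br au aw) bv + bul aw (evu + br bu bv))
    - (bul dvu bw + bul au (ewv + br bv bw)
      - (bul (dwv - br av aw) bu + bul aw evu))
    + (bul dwu bv + bul au ewv - (bul dwv bu + bul av ewu))) =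
  2^-1 * bul (br au av) aw + 2^-1 * bul (br bu bv) bw
  - 2^-1 * bul (br (au + bu) (av + bv)) (aw + bw).
Proof.
move=> brl brr bl bs bn cyc sw.
have br' X Y Z : bul X (Y + Z) = bul X Y + bul X Z by rewrite !(bs X) bl.
rewrite !(brl, brr) !(bl, br', bn).
rewrite (sw au bv aw) (cyc bu av aw) (cyc au bv bw) (sw bu av bw).
rewrite (bs av (br bu bw)) (bs aw (br bu bv)) (bs au (br bv bw)).
ring.
Qed.

Section PairForm.
Context {K : numFieldType} {n : nat}.
Hypothesis schK : symmetric_derivatives K.
Variable G : lieGroup K n.
Local Notation g := 'rV[K]_n.
Let fg : findim g := findim_row n.
Local Notation "[[ X , Y ]]" := (lie_bracket G X Y).
Variable bul : g -> g -> K.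
Hypothesis hbul : invariant_form G bul.
Let bl := bul_linear hbul.
Let bs := bul_sym hbul.

(** [Ad_a] is orthogonal. *)
Lemma bul_Adl (a : G) X Y : bul (lie_Ad a X) Y = bul X (lie_Ad (lie_inv a) Y).
Proof. by rewrite -[in LHS](lie_AdVK a Y) (bul_Ad hbul). Qed.

Lemma lambda_Ad (a : G) X Y Z :
  bul [[lie_Ad a X, lie_Ad a Y]] (lie_Ad a Z) = bul [[X, Y]] Z.
Proof. by rewrite -(lie_Ad_bracket schK) (bul_Ad hbul). Qed.

Lemma bul_bracket_132 X Y Z : bul [[X, Y]] Z = - bul [[X, Z]] Y.
Proof.
exact: etrans (bul_bracket_cycle schK hbul X Y Z)
  (etrans (bul_bracket_cycle schK hbul Y Z X) (bul_bracket_swap hbul Z X Y)).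
Qed.

Context {E : normedModType K} (M : manifold E) (fE : findim E).
Implicit Types f h : M -> G.

(** The pullback of the right Maurer-Cartan form by [f]. *)
Definition rlogd f p u : g := mc_right (f p) (mdiff f p u).

Lemma rlogd_Ad f p u : rlogd f p u = lie_Ad (f p) (logd f p u).
Proof. exact: mc_right_Ad. Qed.

Lemma logd_Ad_rlogd f p u : logd f p u = lie_Ad (lie_inv (f p)) (rlogd f p u).
Proof. by rewrite rlogd_Ad lie_AdK. Qed.

Lemma rlogd_lin f p : linear (rlogd f p).
Proof. by move=> a u v; rewrite !rlogd_Ad logd_lin lie_Ad_lin. Qed.

(** In this form the pullback of lambda by a product is lambda at the sum
    [logd f + rlogd h], because lambda is Ad-invariant. *)
Lemma logd_mul_rlogd f h p u : msmooth f p -> msmooth h p ->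
  logd (fun q => f q ** h q) p u = lie_Ad (lie_inv (h p)) (logd f p u + rlogd h p u).
Proof. by move=> sf sh; rewrite (logd_mul u sf sh) lie_AdD (rlogd_Ad h) lie_AdK. Qed.

Lemma rlogd_mul f h p u : msmooth f p -> msmooth h p ->
  rlogd (fun q => f q ** h q) p u = lie_Ad (f p) (logd f p u + rlogd h p u).
Proof.
by move=> sf sh; rewrite rlogd_Ad (logd_mul_rlogd u sf sh) -lie_AdM lmulK.
Qed.

Definition pair_form f h : M -> E -> E -> K :=
  pullback2 (N := prod_manifold G G) (fun q => (f q, h q)) (mc_lr bul).

Lemma pair_formE f h p u v : msmooth f p -> msmooth h p ->
  pair_form f h p u v = bul (logd f p u) (rlogd h p v) - bul (logd f p v) (rlogd h p u).
Proof. by move=> sf sh; rewrite /pair_form /pullback2 !mdiff_pair. Qed.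

Section Smooth.
Variables (f h : M -> G) (sf : forall q, msmooth f q) (sh : forall q, msmooth h q).

Let hi (q : M) : G := lie_inv (h q).
Let shi q : msmooth hi q. Proof. exact: msmooth_inv. Qed.

(** The right form is the opposite of the left form of the inverse, whose
    smoothness and exterior derivative are known. *)
Definition rlogd_chart p u x : g := - logd_chart hi p u x.

Let rlogdE p u : rlogd h p u = - logd hi p u.
Proof. exact: rlogd_inv. Qed.

Let pair_in_chart p u v : form2_in_chart p (pair_form f h) u v =
  (fun x => bulo bul (logd_chart f p u x) (rlogd_chart p v x)
          - bulo bul (logd_chart f p v x) (rlogd_chart p u x)).
Proof. by apply: funext => x; rewrite /form2_in_chart pair_formE // !rlogdE. Qed.

Let sA p u x : chart_img (chart_at p) x -> smooth_at (logd_chart f p u) x.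
Proof. exact: logd_chart_smooth. Qed.
Let sB p u x : chart_img (chart_at p) x -> smooth_at (rlogd_chart p u) x.
Proof. by move=> px; apply: smooth_at_opp; exact: logd_chart_smooth. Qed.
Let sAB p u v x : chart_img (chart_at p) x ->
  smooth_at (fun y => bulo bul (logd_chart f p u y) (rlogd_chart p v y)) x.
Proof. by move=> px; apply: smooth_at_bul => //; [exact: sA|exact: sB]. Qed.

Lemma pair_form_form2 : is_form2 (pair_form f h).
Proof.
split.
- move=> p v c u u'; rewrite !pair_formE // logd_lin rlogd_lin.
  by rewrite bl (bulDr bl bs) (bulZr bl bs); ring.
- move=> p u c v v'; rewrite !pair_formE // logd_lin rlogd_lin.
  by rewrite bl (bulDr bl bs) (bulZr bl bs); ring.
- by move=> p u; rewrite pair_formE // subrr.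
- move=> p u v; rewrite pair_in_chart; apply: smooth_at_smooth => x px.
  by apply: smooth_at_sub; exact: sAB.
Qed.

Let D_pair p u v w : let x := chart_fun (chart_at p) p in
  'D_w (form2_in_chart p (pair_form f h) u v) x =
  bul ('D_w (logd_chart f p u) x) (rlogd h p v) + bul (logd f p u) ('D_w (rlogd_chart p v) x)
  - (bul ('D_w (logd_chart f p v) x) (rlogd h p u) + bul (logd f p v) ('D_w (rlogd_chart p u) x)).
Proof.
move=> x; have px : chart_img (chart_at p) x := chart_img_center p.
rewrite pair_in_chart.
have d u' v' := diff_derivable (v := w) (smooth_at_diff (sAB u' v' px)).
rewrite (deriveB (d u v) (d v u)).
rewrite (derive_bul bl bs w (sA u px) (sB v px)) (derive_bul bl bs w (sA v px) (sB u px)).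
by rewrite /rlogd_chart /logd_chart !chart_tangent_center !chart_inv_center -!rlogdE.
Qed.

Let mcA p u v : let x := chart_fun (chart_at p) p in
  'D_u (logd_chart f p v) x = 'D_v (logd_chart f p u) x - [[logd f p u, logd f p v]].
Proof.
move=> x; have := maurer_cartan schK fE sf u v (chart_img_center p).
rewrite {3 4}/logd_chart !chart_tangent_center chart_inv_center -/x => <-.
by rewrite addrC subrK.
Qed.

Let mcB p u v : let x := chart_fun (chart_at p) p in
  'D_u (rlogd_chart p v) x = 'D_v (rlogd_chart p u) x + [[rlogd h p u, rlogd h p v]].
Proof.
move=> x; have := maurer_cartan schK fE shi u v (chart_img_center p).
have dN w z : 'D_z (rlogd_chart p w) x = - 'D_z (logd_chart hi p w) x.
  apply: deriveN; apply: diff_derivable; apply: smooth_at_diff.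
  exact: (logd_chart_smooth fE shi w (chart_img_center p)).
rewrite !dN {3 4}/logd_chart !chart_tangent_center chart_inv_center -/x.
rewrite !rlogdE lie_bracketNl lie_bracketNr opprK.
exact: opp_eq_opp_add.
Qed.

(** The failure of [f |-> lambda_f] to be additive on products is exact. *)
Lemma pair_form_deriv p u v w :
  2^-1 * ext_deriv2 (pair_form f h) p u v w =
  pullback3 f (lambda bul) p u v w + pullback3 h (lambda bul) p u v w
  - pullback3 (fun q => f q ** h q) (lambda bul) p u v w.
Proof.
have lf f' : pullback3 f' (lambda bul) p u v w =
  2^-1 * bul [[logd f' p u, logd f' p v]] (logd f' p w) by [].
have lh : pullback3 h (lambda bul) p u v w =
    2^-1 * bul [[rlogd h p u, rlogd h p v]] (rlogd h p w).
  by rewrite lf !rlogd_Ad lambda_Ad.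
have lfh : pullback3 (fun q => f q ** h q) (lambda bul) p u v w =
    2^-1 * bul [[logd f p u + rlogd h p u, logd f p v + rlogd h p v]]
             (logd f p w + rlogd h p w).
  rewrite lf (logd_mul_rlogd u (sf p) (sh p)) (logd_mul_rlogd v (sf p) (sh p)).
  by rewrite (logd_mul_rlogd w (sf p) (sh p)) lambda_Ad.
rewrite lf lh lfh /ext_deriv2 !D_pair (mcA p u v) (mcA p u w) (mcA p v w).
rewrite (mcB p u v) (mcB p u w) (mcB p v w).
apply: polyakov_wiegmann_terms.
- exact: lie_bracketDl.
- exact: lie_bracketDr.
- exact: bulDl.
- exact: bs.
- exact: bulNl.
- exact: (bul_bracket_cycle schK hbul).
- exact: bul_bracket_132.
Qed.

End Smooth.
End PairForm.

(** The computation behind [pair_form_moment]: [Af] and [Ahi] are the adjoint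
    actions of [f q] and of the inverse of [h q], [XF] and [XH] are [X] moved by
    the inverses of these, [a] and [b] the values of the left form of [f] and of
    the right form of [h]. *)
Lemma moment_terms (K : fieldType) (V : zmodType) (bul : V -> V -> K)
    (Af Ahi : V -> V) (X XF XH a b : V) :
  (forall X Y Z, bul (X + Y) Z = bul X Z + bul Y Z) ->
  (forall X Y, bul X Y = bul Y X) ->
  (forall X Y, Af (X + Y) = Af X + Af Y) ->
  (forall X Y, Ahi (X + Y) = Ahi X + Ahi Y) ->
  (forall Y, bul XF Y = bul X (Af Y)) -> (forall Y, bul Y XH = bul X (Ahi Y)) ->
  bul (X - XF) b - bul a (XH - X) =
  bul X (a + Af a) + bul X (Ahi b + b) - bul X (Ahi (a + b) + Af (a + b)).
Proof.
move=> bl bs Afl Ahl eF eH.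
have br Y Z W : bul Y (Z + W) = bul Y Z + bul Y W by rewrite !(bs Y) bl.
have bn Y Z : bul (- Y) Z = - bul Y Z.
  by apply: (addrI (bul Y Z)); rewrite -bl !subrr; apply: (addrI (bul 0 Z)); rewrite -bl !addr0.
have bnr Y Z : bul Y (- Z) = - bul Y Z by rewrite !(bs Y) bn.
rewrite Afl Ahl !(bl, br, bn, bnr) eF eH (bs a X); ring.
Qed.

Section FundamentalFields.
Context {K : numFieldType} {n : nat} (G : lieGroup K n).
Local Notation g := 'rV[K]_n.
Let fg : findim g := findim_row n.
Context {E : normedModType K} (M : manifold E) (fE : findim E).
Variable act : G -> M -> M.
Hypotheses (act1 : forall q, act (lie_one G) q = q)
  (sact : forall a q, msmooth (fun b => act b q) a).

Definition equivariant (f : M -> G) := forall a q, f (act a q) = a ** f q ** lie_inv a.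

(** Along the orbit of [q] the map [f] is [b |-> b f(q) b^-1], and the
    fundamental field has the velocity [- X] at the unit. *)
Lemma logd_fundamental (f : M -> G) q X : (forall q, msmooth f q) -> equivariant f ->
  logd f q (fundamental_field act X q) = X - lie_Ad (lie_inv (f q)) X.
Proof.
move=> sf ef; set c := f q.
have sid a : msmooth (fun b : G => b) a by exact: msmooth_id.
have sc a : msmooth (fun b : G => b ** c) a by exact: msmooth_rmul.
have si a : msmooth (fun b : G => lie_inv b) a by exact: msmooth_inv.
have e1 : logd (fun b => f (act b q)) (lie_one G) (- X) =
    logd f q (fundamental_field act X q).
  have := logd_comp (- X) fE (sact (lie_one G) q) (sf _).
  by rewrite act1.
rewrite -e1 (_ : (fun b => _) = (fun b => b ** c ** lie_inv b)); last first.
  by apply: funext => b; rewrite ef.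
have idL a u : logd (fun b : G => b) a u = mc_left a u by rewrite /logd mdiff_id.
rewrite (logd_mul _ (sc _) (si _)) (logd_mul _ (sid _) (msmooth_cst _ _)) logd_cst.
rewrite (logd_inv _ (sid _)) idL mc_left_one !linv1 !lie_Ad1 addr0.
by rewrite opprK lie_AdN addrC.
Qed.

Lemma rlogd_fundamental (f : M -> G) q X : (forall q, msmooth f q) -> equivariant f ->
  rlogd f q (fundamental_field act X q) = lie_Ad (f q) X - X.
Proof.
by move=> sf ef; rewrite rlogd_Ad logd_fundamental // lie_AdD lie_AdN lie_AdVK.
Qed.

Variable bul : g -> g -> K.
Hypothesis hbul : invariant_form G bul.
Let bl := bul_linear hbul.
Let bs := bul_sym hbul.

(** Twice the right-hand side of the moment condition for a form with moment
    [f]. *)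
Definition moment_form (f : M -> G) (X : g) q v : K := bul X (logd f q v + rlogd f q v).

Lemma pair_form_moment (f h : M -> G) X q v :
  (forall q, msmooth f q) -> (forall q, msmooth h q) -> equivariant f -> equivariant h ->
  pair_form bul f h q (fundamental_field act X q) v =
  moment_form f X q v + moment_form h X q v - moment_form (fun q => f q ** h q) X q v.
Proof.
move=> sf sh ef eh; rewrite pair_formE // logd_fundamental // rlogd_fundamental //.
rewrite /moment_form (logd_mul_rlogd v (sf q) (sh q)) (rlogd_mul v (sf q) (sh q)).
rewrite (logd_Ad_rlogd h) (rlogd_Ad f).
apply: moment_terms.
- exact: bulDl.
- exact: bs.
- exact: lie_AdD.
- exact: lie_AdD.
- by move=> Y; rewrite (bul_Adl hbul) linvK.
- by move=> Y; rewrite (bs Y) (bul_Adl hbul) .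
Qed.

(** The maps [f] and [h] are conjugated by [a], so that both Maurer-Cartan forms
    are moved by [Ad_a]. *)
Lemma pair_form_invariant (f h : M -> G) a : (forall q, msmooth (act a) q) ->
  (forall q, msmooth f q) -> (forall q, msmooth h q) -> equivariant f -> equivariant h ->
  pullback2 (act a) (pair_form bul f h) = pair_form bul f h.
Proof.
move=> sa sf sh ef eh.
have L (k : M -> G) q u : (forall q, msmooth k q) -> equivariant k ->
    logd k (act a q) (mdiff (act a) q u) = lie_Ad a (logd k q u).
  move=> sk ek; rewrite -(logd_comp u fE (sa q) (sk _)).
  have -> : (fun q' => k (act a q')) = (fun q' => a ** k q' ** lie_inv a).
    by apply: funext => q'; rewrite ek.
  exact: logd_conj.
have Rr (k : M -> G) q u : (forall q, msmooth k q) -> equivariant k ->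
    rlogd k (act a q) (mdiff (act a) q u) = lie_Ad a (rlogd k q u).
  move=> sk ek; rewrite rlogd_Ad L // ek !rlogd_Ad -!lie_AdM.
  by rewrite lmulKV.
apply: funext => q; apply: funext => u; apply: funext => v.
by rewrite /pullback2 !pair_formE // !L // !Rr // !(bul_Ad hbul).
Qed.

End FundamentalFields.

Section PairFormAlgebra.
Context {K : numFieldType} {n : nat} (G : lieGroup K n).
Local Notation g := 'rV[K]_n.
Variable bul : g -> g -> K.
Hypothesis hbul : invariant_form G bul.
Let bl := bul_linear hbul.
Let bs := bul_sym hbul.
Context {E : normedModType K} (M : manifold E).
Implicit Types f h : M -> G.

Lemma pair_form_1l h q u v : msmooth h q -> pair_form bul (fun=> lie_one G) h q u v = 0.
Proof.
move=> sh; rewrite pair_formE //; last exact: msmooth_cst.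
by rewrite !logd_cst !(bul0l bl) subrr.
Qed.

Lemma rlogd_cst (a : G) (p : M) u : rlogd (fun=> a) p u = 0 :> g.
Proof. by rewrite rlogd_Ad logd_cst lie_Ad0. Qed.

Lemma pair_form_1r f q u v : msmooth f q -> pair_form bul f (fun=> lie_one G) q u v = 0.
Proof.
move=> sf; rewrite pair_formE //; last exact: msmooth_cst.
by rewrite !rlogd_cst !(bul0r bl bs) subrr.
Qed.

(** The right form of the inverse of [f] is the opposite of the left form of
    [f], and [bul] is symmetric. *)
Lemma pair_form_inv f q u v : msmooth f q ->
  pair_form bul f (fun q => lie_inv (f q)) q u v = 0.
Proof.
move=> sf; rewrite pair_formE //; last exact: msmooth_inv.
have e w : rlogd (fun q => lie_inv (f q)) q w = - logd f q w.
  by rewrite rlogd_Ad (logd_inv _ sf) lie_AdN lie_AdK.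
by rewrite !e !(bulNr bl bs) (bs (logd f q v)) subrr.
Qed.

Lemma mc_rl_pair (f h : M -> G) q u v : msmooth f q -> msmooth h q ->
  pair_form bul (fun q => lie_inv (f q)) (fun q => lie_inv (h q)) q u v =
  bul (rlogd f q u) (logd h q v) - bul (rlogd f q v) (logd h q u).
Proof.
move=> sf sh; rewrite pair_formE; [|exact: msmooth_inv..].
have el w : logd (fun q => lie_inv (f q)) q w = - rlogd f q w.
  by rewrite (logd_inv _ sf) rlogd_Ad.
have er w : rlogd (fun q => lie_inv (h q)) q w = - logd h q w.
  by rewrite rlogd_Ad (logd_inv _ sh) lie_AdN lie_AdK.
by rewrite !el !er !(bulNr bl bs) !(bulNl bl) !opprK.
Qed.

Lemma pair_form_comp (F : normedModType K) (N : manifold F) (k : N -> M) f h q u v :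
  findim E -> msmooth k q -> msmooth f (k q) -> msmooth h (k q) ->
  pair_form bul (fun q => f (k q)) (fun q => h (k q)) q u v =
  pair_form bul f h (k q) (mdiff k q u) (mdiff k q v).
Proof.
move=> fE sk sf sh; have fg := findim_row (K := K) n.
have s1 : msmooth (fun q => f (k q)) q by exact: msmooth_comp fE sk sf.
have s2 : msmooth (fun q => h (k q)) q by exact: msmooth_comp fE sk sh.
rewrite !pair_formE // !(logd_comp _ fE sk sf).
have r w : rlogd (fun q => h (k q)) q w = rlogd h (k q) (mdiff k q w).
  by rewrite !rlogd_Ad (logd_comp w fE sk sh).
by rewrite !r.
Qed.

End PairFormAlgebra.

(** * Combinations of forms and two-chains *)

Section FormCombinations.
Context {K : numFieldType} {E : normedModType K} (M : manifold E).
Implicit Types a b : M -> E -> E -> K.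

Lemma form2_differentiable a p u v : is_form2 a ->
  differentiable (form2_in_chart p a u v) (chart_fun (chart_at p) p).
Proof.
by move=> fa; have [df _] := form2_smooth fa p u v 1%N; exact: df (chart_img_center p).
Qed.

Lemma form2_smooth_at a p u v x : is_form2 a -> chart_img (chart_at p) x ->
  smooth_at (form2_in_chart p a u v) x.
Proof.
move=> fa px; exists (chart_img (chart_at p)); split=> //.
  exact: chart_img_open (mfd_chart p).
exact: form2_smooth.
Qed.

Lemma is_form2_zero : is_form2 (fun (p : M) u v => 0).
Proof.
split=> //; [by move=> *; rewrite mulr0 addr0|by move=> *; rewrite mulr0 addr0|].
move=> p u v; apply: smooth_at_smooth => x px.
exact: (@smooth_at_const _ _ _ (0 : K^o)).
Qed.

Lemma is_form2_lin (r : K) a b : is_form2 a -> is_form2 b ->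
  is_form2 (fun p u v => r * a p u v + b p u v).
Proof.
move=> fa fb; split.
- by move=> p v c u u'; rewrite (form2_linearl fa) (form2_linearl fb); ring.
- by move=> p v c u u'; rewrite (form2_linearr fa) (form2_linearr fb); ring.
- by move=> p u; rewrite (form2_alternating fa) (form2_alternating fb) mulr0 addr0.
- move=> p u v; apply: smooth_at_smooth => x px.
  exact: (smooth_at_add (smooth_at_scale (smooth_at_const (r : K^o) x)
    (form2_smooth_at u v fa px)) (form2_smooth_at u v fb px)).
Qed.

Lemma ext_deriv2_zero p u v w : ext_deriv2 (fun (p : M) u v => 0) p u v w = 0.
Proof.
have D y : 'D_y (fun _ : E => (0 : K^o)) (chart_fun (chart_at p) p) = 0 by exact: derive_cst.
rewrite /ext_deriv2 /form2_in_chart.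
by apply: etrans (congr2 +%R (congr2 (fun s t => s - t) (D u) (D v)) (D w)) _; rewrite subrr addr0.
Qed.

Lemma ext_deriv2_lin (r : K) a b p u v w : is_form2 a -> is_form2 b ->
  ext_deriv2 (fun p u v => r * a p u v + b p u v) p u v w =
  r * ext_deriv2 a p u v w + ext_deriv2 b p u v w.
Proof.
move=> fa fb; set x := chart_fun (chart_at p) p.
have D y s t : 'D_y (form2_in_chart p (fun p u v => r * a p u v + b p u v) s t) x =
    r * 'D_y (form2_in_chart p a s t) x + 'D_y (form2_in_chart p b s t) x.
  have da := diff_derivable (v := y) (form2_differentiable p s t fa).
  have db := diff_derivable (v := y) (form2_differentiable p s t fb).
  have dra := @derivableZ _ _ _ _ r _ _ da.
  have -> : form2_in_chart p (fun p u v => r * a p u v + b p u v) s t =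
    (r \*: form2_in_chart p a s t) + form2_in_chart p b s t by [].
  by rewrite (deriveD dra db) (deriveZ r da).
rewrite /ext_deriv2 !D -/x.
move: ('D_u _ _) ('D_v _ _) ('D_w _ _) ('D_u _ _) ('D_v _ _) ('D_w _ _) => *.
ring.
Qed.

Lemma is_form2_sum (I : Type) (s : seq I) (m : I -> K) (a : I -> M -> E -> E -> K) :
  (forall i, is_form2 (a i)) ->
  is_form2 (fun p u v => \sum_(i <- s) m i * a i p u v).
Proof.
move=> fa; elim: s => [|i s IH].
  have -> : (fun p u v => \sum_(i <- [::]) m i * a i p u v) = (fun (p : M) u v => 0).
    by apply: funext => p; apply: funext => u; apply: funext => v; rewrite big_nil.
  exact: is_form2_zero.
have -> : (fun p u v => \sum_(j <- i :: s) m j * a j p u v) =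
    (fun p u v => m i * a i p u v + \sum_(j <- s) m j * a j p u v).
  by apply: funext => p; apply: funext => u; apply: funext => v; rewrite big_cons.
exact: is_form2_lin.
Qed.

Lemma ext_deriv2_sum (I : Type) (s : seq I) (m : I -> K) (a : I -> M -> E -> E -> K) p u v w :
  (forall i, is_form2 (a i)) ->
  ext_deriv2 (fun p u v => \sum_(i <- s) m i * a i p u v) p u v w =
  \sum_(i <- s) m i * ext_deriv2 (a i) p u v w.
Proof.
move=> fa; elim: s => [|i s IH].
  have -> : (fun p u v => \sum_(i <- [::]) m i * a i p u v) = (fun (p : M) u v => 0).
    by apply: funext => p'; apply: funext => u'; apply: funext => v'; rewrite big_nil.
  by rewrite ext_deriv2_zero big_nil.
have -> : (fun p u v => \sum_(j <- i :: s) m j * a j p u v) =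
    (fun p u v => m i * a i p u v + \sum_(j <- s) m j * a j p u v).
  by apply: funext => p'; apply: funext => u'; apply: funext => v'; rewrite big_cons.
by rewrite (ext_deriv2_lin _ _ _ _ _ (fa i) (is_form2_sum s m fa)) IH big_cons.
Qed.

End FormCombinations.

Section LinearExtension.
Variables (X : choiceType) (V : zmodType).
Implicit Types (f : X -> V) (c : {freeg X / int}).

(** Chains with different supports can be summed over a common sequence; this
    gives additivity in the chain. *)
Lemma linear_ext_widen f c (s : seq X) : uniq s -> {subset dom c <= s} ->
  linear_ext f c = \sum_(x <- s) f x *~ coeff x c.
Proof.
move=> us sub; rewrite [RHS](bigID (mem (dom c))) /= [X in _ + X]big1 ?addr0; last first.
  by move=> x /coeff_outdom ->; rewrite mulr0z.
rewrite -big_filter; apply: perm_big; apply: uniq_perm.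
- exact: uniq_dom.
- exact: filter_uniq.
- by move=> x; rewrite mem_filter; apply/idP/andP => [h|[]//]; split=> //; exact: sub.
Qed.

Lemma linear_extD f c c' : linear_ext f (c + c') = linear_ext f c + linear_ext f c'.
Proof.
pose s := undup (dom c ++ dom c' ++ dom (c + c')).
have us : uniq s by exact: undup_uniq.
rewrite !(@linear_ext_widen f _ s) //; try by move=> x h; rewrite mem_undup !mem_cat h ?orbT.
by rewrite -big_split; apply: eq_bigr => x _ /=; rewrite coeffD mulrzDr.
Qed.

Lemma linear_ext0 f : linear_ext f 0 = 0.
Proof. by apply: (addrI (linear_ext f 0)); rewrite -linear_extD !addr0. Qed.

Lemma linear_extN f c : linear_ext f (- c) = - linear_ext f c.
Proof.
by apply: (addrI (linear_ext f c)); rewrite -linear_extD !subrr linear_ext0.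
Qed.

Lemma linear_extMz f c m : linear_ext f (c *~ m) = linear_ext f c *~ m.
Proof.
have H (k : nat) : linear_ext f (c *+ k) = linear_ext f c *+ k.
  by elim: k => [|k IH]; rewrite ?mulr0n ?linear_ext0 // !mulrS linear_extD IH.
by case: m => k; rewrite /intmul ?H // linear_extN H.
Qed.

Lemma linear_ext_sum f (I : Type) (r : seq I) (C : I -> {freeg X / int}) :
  linear_ext f (\sum_(i <- r) C i) = \sum_(i <- r) linear_ext f (C i).
Proof. exact: (big_morph _ (linear_extD f) (linear_ext0 f)). Qed.

Lemma linear_extU f x : linear_ext f << x >> = f x.
Proof.
rewrite (@linear_ext_widen f _ [:: x]) //; last by move=> y; rewrite domU1.
by rewrite big_seq1 coeffU eqxx.
Qed.

End LinearExtension.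

Section BarBoundary.
Variables (F : groupType) (V : zmodType) (A : F -> V).
Hypothesis A1 : A 1%g = 0.
Local Open Scope group_scope.

Lemma linear_ext_bar1 (w : F) :
  linear_ext (fun x : nontrivial F => A (val x)) (bar1 w) = A w.
Proof.
rewrite /bar1; case: insubP => [x _ <-|]; first exact: linear_extU.
by rewrite negbK => /eqP ->; rewrite linear_ext0 A1.
Qed.

(** A function on the group that vanishes at the unit, evaluated on a boundary. *)
Lemma linear_ext_boundary (c : chain2 F) :
  linear_ext (fun x : nontrivial F => A (val x)) (boundary2 c) =
  linear_ext (fun uv => A (val uv.2) - A (val uv.1 * val uv.2) + A (val uv.1))%R c.
Proof.
rewrite /boundary2 {2}/linear_ext linear_ext_sum; apply: eq_bigr => uv _.
by rewrite linear_extMz !linear_extD linear_extN !linear_ext_bar1.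
Qed.

(** The cell [[u|v]] of the normalized complex, which is 0 if an entry is
    trivial. *)
Definition bar2 (u v : F) : chain2 F :=
  if insub u is Some u' then
    if insub v is Some v' then << (u', v') >> else 0%R
  else 0%R.

Lemma linear_ext_bar2 (B : F -> F -> V) (u v : F) :
  (forall w, B 1 w = 0%R) -> (forall w, B w 1 = 0%R) ->
  linear_ext (fun uv : nontrivial F * nontrivial F => B (val uv.1) (val uv.2)) (bar2 u v) = B u v.
Proof.
move=> B1 B2; rewrite /bar2; case: insubP => [u' _ <-|]; last first.
  by rewrite negbK => /eqP ->; rewrite linear_ext0 B1.
case: insubP => [v' _ <-|]; first by rewrite linear_extU.
by rewrite negbK => /eqP ->; rewrite linear_ext0 B2.
Qed.

End BarBoundary.

Section BarBoundary2.
Variable F : groupType.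
Local Open Scope group_scope.

Lemma bar1_1 : bar1 (1 : F) = 0%R.
Proof. by rewrite /bar1 insubF // eqxx. Qed.

Lemma boundary_bar2 (u v : F) : boundary2 (bar2 u v) = (bar1 v - bar1 (u * v) + bar1 u)%R.
Proof.
apply: (linear_ext_bar2 (B := fun u v => (bar1 v - bar1 (u * v) + bar1 u)%R)) => w.
- by rewrite mul1g bar1_1 subrr addr0.
- by rewrite mulg1 bar1_1 sub0r addNr.
Qed.

Lemma boundary2D (c c' : chain2 F) : boundary2 (c + c') = (boundary2 c + boundary2 c')%R.
Proof. exact: linear_extD. Qed.
Lemma boundary2N (c : chain2 F) : boundary2 (- c) = (- boundary2 c)%R.
Proof. exact: linear_extN. Qed.

End BarBoundary2.

(** * Two-chains of the free group and their forms *)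

Section WordEvaluation.
Context {K : numFieldType} {n : nat} (G : lieGroup K n).
Variable T : choiceType.
Implicit Types (f : T -> G) (s : seq (T * bool)) (u v : free_group T).

Definition letter_eval f (a : T * bool) : G := if a.2 then lie_inv (f a.1) else f a.1.

Definition word_eval f s : G := foldr (fun a b => letter_eval f a ** b) (lie_one G) s.

Lemma free_evalE f u : free_eval f u = word_eval f (free_word u).
Proof. by []. Qed.

Lemma letter_eval_inv f a : letter_eval f (letter_inv a) = lie_inv (letter_eval f a).
Proof. by case: a => x [] //=; rewrite /letter_eval /= linvK. Qed.

(** Cancelling adjacent inverse letters does not change the value. *)
Lemma word_eval_push f a s : word_eval f (push a s) = letter_eval f a ** word_eval f s.
Proof.
case: s => [|b s] //=; case: eqP => [->|_] //=.
by rewrite letter_eval_inv lmulKI.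
Qed.

Lemma word_eval_foldr f s s' :
  word_eval f (foldr (@push T) s' s) = word_eval f s ** word_eval f s'.
Proof. by elim: s => [|a s IH] /=; rewrite ?lmul1 // word_eval_push IH lmulA. Qed.

Lemma free_evalM f u v : free_eval f (u * v)%g = free_eval f u ** free_eval f v.
Proof. exact: word_eval_foldr. Qed.

Lemma free_evalV f u : free_eval f (u^-1)%g = lie_inv (free_eval f u).
Proof. by apply: linv_unique; rewrite -free_evalM mulgV. Qed.

Lemma free_eval_gen f x : free_eval f (free_gen x) = f x.
Proof. exact: lmulr1. Qed.

Lemma word_eval_conj f a s :
  word_eval (fun x => a ** f x ** lie_inv a) s = a ** word_eval f s ** lie_inv a.
Proof.
elim: s => [|b s IH] /=; first by rewrite lmulr1 lmulrV.
rewrite IH !lmulA; congr (_ ** _ ** _).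
by rewrite /letter_eval; case: b.2; rewrite ?linvM ?linvK ?lmulA lmulKV.
Qed.

End WordEvaluation.

Section SurfaceWords.
Context {K : numFieldType} {n : nat} (G : lieGroup K n).
Local Notation g := 'rV[K]_n.
Let fg : findim g := findim_row n.

Lemma findim_gpow k : findim (@gpow_model K n k).
Proof. by elim: k => [|k IH] /=; do ?apply: findim_prod. Qed.

Lemma msmooth_coord k i (q : gpow G k) :
  msmooth (fun q : gpow G k => (gpow_coord q i).1) q /\
  msmooth (fun q : gpow G k => (gpow_coord q i).2) q.
Proof.
elim: k q => [|k IH] q /=; first by split; [exact: msmooth_fst|exact: msmooth_snd].
have sG2 := msmooth_snd q; have sGk := msmooth_fst q.
case: eqP => _.
  by split; [exact: (msmooth_fst_comp fg fg sG2)|exact: (msmooth_snd_comp fg fg sG2)].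
have [s1 s2] := IH q.1; split.
  exact: (@msmooth_comp _ _ _ _ (gpow G k.+1) (gpow G k) G fst _ q (findim_gpow k) sGk s1).
exact: (@msmooth_comp _ _ _ _ (gpow G k.+1) (gpow G k) G fst _ q (findim_gpow k) sGk s2).
Qed.

Lemma msmooth_word_map k (u : surface_free k.+1) (q : gpow G k) : msmooth (word_map u) q.
Proof.
have -> : word_map u = (fun q : gpow G k => word_eval (fun x : 'I_k.+1 * bool =>
    let c := gpow_coord q x.1 in if x.2 then c.2 else c.1) (free_word u)) by [].
elim: (free_word u) => [|a s IH]; first exact: msmooth_cst.
apply: (msmooth_mul _ IH); have [s1 s2] := msmooth_coord a.1.1 q.
have sc : msmooth (fun q : gpow G k =>
    if a.1.2 then (gpow_coord q a.1.1).2 else (gpow_coord q a.1.1).1) q by case: a.1.2.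
by rewrite /letter_eval; case: a.2 => //; exact: msmooth_inv sc.
Qed.

Lemma word_map1 k : word_map (1 : surface_free k.+1)%g = (fun q : gpow G k => lie_one G).
Proof. by []. Qed.

Lemma word_mapM k (u v : surface_free k.+1) :
  word_map (u * v)%g = (fun q : gpow G k => word_map u q ** word_map v q).
Proof. by apply: funext => q; exact: free_evalM. Qed.

Lemma word_mapV k (u : surface_free k.+1) :
  word_map (u^-1)%g = (fun q : gpow G k => lie_inv (word_map u q)).
Proof. by apply: funext => q; exact: free_evalV. Qed.

Lemma gpow_coord_conj k a i (q : gpow G k) :
  gpow_coord (gpow_conj a q) i =
  (a ** (gpow_coord q i).1 ** lie_inv a, a ** (gpow_coord q i).2 ** lie_inv a).
Proof. by elim: k q => [|k IH] q //=; case: eqP => // _; exact: IH. Qed.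

Lemma word_map_equivariant k (u : surface_free k.+1) :
  equivariant (@gpow_conj K n G k) (word_map u).
Proof.
move=> a q; rewrite /word_map -[RHS]word_eval_conj free_evalE; congr word_eval.
by apply: funext => x; rewrite gpow_coord_conj /=; case: x.2.
Qed.

Lemma gpow_conj1 k (q : gpow G k) : gpow_conj (lie_one G) q = q.
Proof.
elim: k q => [|k IH] q /=; rewrite ?IH linv1 !lmul1 !lmulr1; first by case: q.
by case: q => q' [].
Qed.

Lemma gpow_conjM k a b (q : gpow G k) : gpow_conj (a ** b) q = gpow_conj a (gpow_conj b q).
Proof. by elim: k q => [|k IH] q /=; rewrite ?IH linvM !lmulA. Qed.

Lemma msmooth_conj_pair (E : normedModType K) (M : manifold E) (f h : M -> G) p :
  msmooth f p -> msmooth h p -> msmooth (fun q => f q ** h q ** lie_inv (f q)) p.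
Proof. by move=> sf sh; apply: msmooth_mul; [exact: msmooth_mul|exact: msmooth_inv]. Qed.

Lemma msmooth_gpow_conj k (z : prod_manifold G (gpow G k)) :
  msmooth (M := prod_manifold G (gpow G k)) (fun z => gpow_conj z.1 z.2) z.
Proof.
elim: k z => [|k IH] z; have s0 := msmooth_fst z; have s2 := msmooth_snd z.
  exact: (msmooth_pair (msmooth_conj_pair s0 (msmooth_fst_comp fg fg s2))
                   (msmooth_conj_pair s0 (msmooth_snd_comp fg fg s2))).
have sk := msmooth_fst_comp (findim_gpow k) (findim_prod fg fg) s2.
have sl := msmooth_snd_comp (findim_gpow k) (findim_prod fg fg) s2.
have t0 := @msmooth_comp2 _ _ _ _ _ G (gpow G k) (prod_manifold G (gpow G k.+1)) (gpow G k)
  fst (fun z => z.2.1) (fun z => gpow_conj z.1 z.2) z fg (findim_gpow k) s0 sk (IH _).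
exact: (msmooth_pair t0 (msmooth_pair (msmooth_conj_pair s0 (msmooth_fst_comp fg fg sl))
                              (msmooth_conj_pair s0 (msmooth_snd_comp fg fg sl)))).
Qed.

Lemma msmooth_gpow_conj_l k a (q : gpow G k) : msmooth (fun b => gpow_conj b q) a.
Proof.
exact: (@msmooth_comp2 _ _ _ _ _ G (gpow G k) G (gpow G k) (fun b => b) (fun=> q)
  (fun z => gpow_conj z.1 z.2) a fg (findim_gpow k) (msmooth_id _) (msmooth_cst _ _) (msmooth_gpow_conj _)).
Qed.

Lemma msmooth_gpow_conj_r k a (q : gpow G k) : msmooth (gpow_conj a) q.
Proof.
exact: (@msmooth_comp2 _ _ _ _ _ G (gpow G k) (gpow G k) (gpow G k) (fun=> a) (fun q => q)
  (fun z => gpow_conj z.1 z.2) q fg (findim_gpow k) (msmooth_cst _ _) (msmooth_id _) (msmooth_gpow_conj _)).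
Qed.

End SurfaceWords.

Section RepresentationForms.
Context {K : numFieldType} {n : nat}.
Hypothesis schK : symmetric_derivatives K.
Variable G : lieGroup K n.
Local Notation g := 'rV[K]_n.
Let fg : findim g := findim_row n.
Variable bul : g -> g -> K.
Hypothesis hbul : invariant_form G bul.
Let bl := bul_linear hbul.
Let bs := bul_sym hbul.
Variable k : nat.
Implicit Types (u v : surface_free k.+1) (c : chain2 (surface_free k.+1)).
Local Notation M := (gpow G k).
Let fM := findim_gpow (K := K) (n := n) k.

Definition word_form u v := pair_form bul (@word_map K n G k u) (word_map v).

Lemma chain_form_sum c : chain_form bul c = (fun (q : M) U V =>
  \sum_(x <- dom c) ((coeff x c)%:~R * 2^-1) * word_form (val x.1) (val x.2) q U V).
Proof.
apply: funext => q; apply: funext => U; apply: funext => V.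
by apply: eq_bigr => x _; rewrite -mulrzl mulrA.
Qed.

Lemma chain_form_form2 c : is_form2 (M := M) (chain_form bul c).
Proof.
rewrite chain_form_sum; apply: is_form2_sum => x.
by apply: (pair_form_form2 hbul fM) => q; exact: msmooth_word_map.
Qed.

(** [B] is the value of a form, or of a derivative of it, on the cells; its half
    is the evaluation of [A] on boundaries. *)
Lemma chain_sum_boundary c (A : surface_free k.+1 -> K) (B : surface_free k.+1 -> surface_free k.+1 -> K)
    (w : surface_free k.+1) : boundary2 c = bar1 w -> A 1%g = 0 ->
  (forall u v, 2^-1 * B u v = A u + A v - A (u * v)%g) ->
  \sum_(x <- dom c) ((coeff x c)%:~R * 2^-1) * B (val x.1) (val x.2) = A w.
Proof.
move=> bc A1 BA; rewrite -(linear_ext_bar1 A1 w) -bc linear_ext_boundary //.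
apply: eq_bigr => x _; rewrite -mulrA BA mulrzl; congr (_ *~ _).
by rewrite -addrA addrC.
Qed.

Theorem hom_weakly_quasi_hamiltonian c : boundary2 c = bar1 (relator k.+1) ->
  weakly_quasi_hamiltonian bul (hom_qdata G bul c).
Proof.
move=> bc; split.
- exact: gpow_conj1.
- exact: gpow_conjM.
- by apply: (msmooth_smooth_map (findim_prod fg fM) fM) => z; exact: msmooth_gpow_conj.
- exact: chain_form_form2.
- move=> a /=; rewrite chain_form_sum.
  apply: funext => q; apply: funext => U; apply: funext => V.
  apply: eq_bigr => x _; congr (_ * _).
  have := pair_form_invariant fM hbul (a := a) (@msmooth_gpow_conj_r K n G k a)
    (@msmooth_word_map K n G k (val x.1)) (@msmooth_word_map K n G k (val x.2))
    (@word_map_equivariant K n G k _) (@word_map_equivariant K n G k _).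
  by move/(congr1 (fun F => F q U V)).
- by apply: (msmooth_smooth_map fM fg) => q; exact: msmooth_word_map.
- exact: word_map_equivariant.
- apply: funext => q; apply: funext => U; apply: funext => V; apply: funext => W /=.
  rewrite chain_form_sum (ext_deriv2_sum _ (fun x : nontrivial _ * nontrivial _ => (coeff x c)%:~R * 2^-1)); last first.
    by move=> x; apply: (pair_form_form2 hbul fM) => q'; exact: msmooth_word_map.
  apply: (@chain_sum_boundary c (fun w => pullback3 (word_map w) (lambda bul) q U V W)
    (fun u v => ext_deriv2 (word_form u v) q U V W)) => // [|u v].
    by rewrite /pullback3 /lambda !mdiff_cst !mc_left0 (bul0r bl bs) mulr0.
  rewrite word_mapM; apply: (pair_form_deriv schK hbul fM) => q'; exact: msmooth_word_map.
- move=> X q V /=; rewrite chain_form_sum.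
  apply: etrans (@chain_sum_boundary c (fun w => 2^-1 * moment_form bul (word_map w) X q V)
    (fun u v => word_form u v q (fundamental_field (@gpow_conj K n G k) X q) V) _ bc _ _) _ => //.
    by rewrite /moment_form rlogd_cst logd_cst addr0 (bul0r bl bs) mulr0.
  move=> u v; rewrite word_mapM -mulrDr -mulrBr; congr (_ * _).
  exact: (@pair_form_moment K n G _ M fM (@gpow_conj K n G k) (@gpow_conj1 K n G k)
    (@msmooth_gpow_conj_l K n G k) bul hbul (word_map u) (word_map v) X q V
    (msmooth_word_map u) (msmooth_word_map v) (word_map_equivariant u) (word_map_equivariant v)).
Qed.

End RepresentationForms.

(** * The chain of iterated fusion *)

(** The boundary of [handle_chain], the letters standing for the cells of the
    two generators, of their inverses, of their product, of the product of the
    inverses and of the commutator. *)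
Lemma handle_cancel (V : zmodType) (a b a' b' ab c r : V) :
  (a' - 0 + a) + (b' - 0 + b) - (b - ab + a) - (b' - c + a') - (c - r + ab) = r.
Proof.
rewrite !subr0 !opprD !opprK.
rewrite (AC (2*2*3*3*3) (12*(1*10)*(2*7)*(3*8)*(4*5)*(6*13)*(9*11)))%AC.
by rewrite /= !subrr !addr0.
Qed.

Lemma fusion_cancel (V : zmodType) (p c r : V) : p + (c - (c - r + p)) = r.
Proof. by rewrite opprD opprB (AC (1*(1*3)) (3*(1*5)*(2*4)))%AC /= !subrr !addr0. Qed.

Lemma handle_form_terms (K : fieldType) (h a b c : K) :
  h * 0 + h * 0 - h * a - h * b - h * c = - (h * (a + b)) - h * c.
Proof. by ring. Qed.

Section FusionChain.
Variable l : nat.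
Local Notation F := (surface_free l.+1).
Local Open Scope group_scope.

Definition gen_x (j : nat) : F := free_gen (inord j, false).
Definition gen_y (j : nat) : F := free_gen (inord j, true).
Definition gen_comm (j : nat) : F := gen_x j * gen_y j * (gen_x j)^-1 * (gen_y j)^-1.
Definition partial_relator (m : nat) : F := \prod_(0 <= j < m) gen_comm j.

(** The first two cells have the form 0 and correct the boundary, the next two
    give the double, the last one its internal fusion. *)
Definition handle_chain (j : nat) : chain2 F :=
  (bar2 (gen_x j) (gen_x j)^-1%g + bar2 (gen_y j) (gen_y j)^-1%g
   - bar2 (gen_x j) (gen_y j) - bar2 (gen_x j)^-1%g (gen_y j)^-1%g
   - bar2 (gen_x j * gen_y j)%g ((gen_x j)^-1 * (gen_y j)^-1)%g)%R.

(** For [j = 0] the fusion cell has a trivial entry and contributes nothing. *)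
Definition fusion_chain (m : nat) : chain2 F :=
  (\sum_(0 <= j < m) (handle_chain j - bar2 (partial_relator j) (gen_comm j)))%R.

Lemma partial_relatorS m : partial_relator m.+1 = partial_relator m * gen_comm m.
Proof. by rewrite /partial_relator big_nat_recr. Qed.

Lemma partial_relator_full : partial_relator l.+1 = relator l.+1.
Proof.
rewrite /partial_relator big_mkord; apply: eq_bigr => j _.
by rewrite /gen_comm /gen_x /gen_y inord_val.
Qed.

Lemma boundary_handle_chain j : boundary2 (handle_chain j) = bar1 (gen_comm j).
Proof.
have e : gen_x j * gen_y j * ((gen_x j)^-1 * (gen_y j)^-1) = gen_comm j by rewrite mulgA.
rewrite /handle_chain !boundary2D !boundary2N !boundary_bar2 e !mulgV bar1_1.
exact: handle_cancel.
Qed.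

Lemma boundary_fusion_chain m : boundary2 (fusion_chain m) = bar1 (partial_relator m).
Proof.
elim: m => [|m IH].
  by rewrite /fusion_chain /partial_relator !big_geq // bar1_1; exact: linear_ext0.
rewrite /fusion_chain big_nat_recr //= -/(fusion_chain m).
rewrite (boundary2D (fusion_chain m)) (boundary2D (handle_chain m)) boundary2N IH.
rewrite boundary_handle_chain boundary_bar2 -partial_relatorS.
exact: fusion_cancel.
Qed.

End FusionChain.

Section HandleForms.
Context {K : numFieldType} {n : nat} (G : lieGroup K n).
Local Notation g := 'rV[K]_n.
Let fg : findim g := findim_row n.
Variable bul : g -> g -> K.
Hypothesis hbul : invariant_form G bul.
Let bl := bul_linear hbul.
Let bs := bul_sym hbul.

Section Handle.
Context {E : normedModType K} (M : manifold E).
Implicit Types x y : M -> G.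

Definition handle_map x y (q : M) : G := x q ** y q ** (lie_inv (x q) ** lie_inv (y q)).

(** The form of the fused double, pulled back by [(x, y)]. *)
Definition handle_form x y (q : M) (U V : E) : K :=
  - (2^-1 * (pair_form bul x y q U V +
      pair_form bul (fun q => lie_inv (x q)) (fun q => lie_inv (y q)) q U V))
  - 2^-1 * pair_form bul (fun q => x q ** y q) (fun q => lie_inv (x q) ** lie_inv (y q)) q U V.

Lemma msmooth_handle_map x y q : msmooth x q -> msmooth y q -> msmooth (handle_map x y) q.
Proof. by move=> sx sy; do ?[apply: msmooth_mul|apply: msmooth_inv]. Qed.

End Handle.

Lemma handle_form_comp (E E' : normedModType K) (M : manifold E) (N : manifold E')
    (k : N -> M) (x y : M -> G) q U V : findim E -> msmooth k q ->
  (forall p, msmooth x p) -> (forall p, msmooth y p) ->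
  handle_form (fun q => x (k q)) (fun q => y (k q)) q U V =
  handle_form x y (k q) (mdiff k q U) (mdiff k q V).
Proof.
move=> fE sk sx sy; have sxi p := msmooth_inv (sx p); have syi p := msmooth_inv (sy p).
rewrite /handle_form (pair_form_comp bul U V fE sk (sx _) (sy _)).
rewrite (pair_form_comp bul U V fE sk (sxi _) (syi _)).
by rewrite (pair_form_comp bul U V fE sk (msmooth_mul (sx _) (sy _)) (msmooth_mul (sxi _) (syi _))).
Qed.

Lemma fusion_double_form (q : prod_manifold G G) U V :
  q_form (fusion bul (Defs.double G bul)) q U V = handle_form (M := prod_manifold G G) fst snd q U V.
Proof.
have s1 := @msmooth_fst _ _ _ G G q; have s2 := @msmooth_snd _ _ _ G G q.
rewrite /handle_form (mc_rl_pair hbul U V s1 s2) (pair_formE bul U V s1 s2).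
by rewrite /logd /rlogd !mdiff_fst !mdiff_snd /= mulNr.
Qed.

Variable k : nat.
Definition coord_x (j : nat) (q : gpow G k) : G := (gpow_coord q j).1.
Definition coord_y (j : nat) (q : gpow G k) : G := (gpow_coord q j).2.

Fixpoint partial_map (m : nat) (q : gpow G k) : G :=
  if m is m'.+1 then partial_map m' q ** handle_map (coord_x m') (coord_y m') q
  else lie_one G.

Definition fused_form (m : nat) (q : gpow G k) U V : K :=
  \sum_(0 <= j < m) (handle_form (coord_x j) (coord_y j) q U V
    - 2^-1 * pair_form bul (partial_map j) (handle_map (coord_x j) (coord_y j)) q U V).

Lemma msmooth_coord_x j q : msmooth (coord_x j) q. Proof. by have [] := msmooth_coord j q. Qed.
Lemma msmooth_coord_y j q : msmooth (coord_y j) q. Proof. by have [] := msmooth_coord j q. Qed.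

Lemma msmooth_partial_map m q : msmooth (partial_map m) q.
Proof.
elim: m => [|m IH]; first exact: msmooth_cst.
by apply: (msmooth_mul IH); apply: msmooth_handle_map; [exact: msmooth_coord_x|exact: msmooth_coord_y].
Qed.

Lemma word_map_gen_x j : (j < k.+1)%N -> word_map (gen_x k j) = coord_x j.
Proof. by move=> jk; apply: funext => q; rewrite /word_map free_eval_gen /= inordK. Qed.

Lemma word_map_gen_y j : (j < k.+1)%N -> word_map (gen_y k j) = coord_y j.
Proof. by move=> jk; apply: funext => q; rewrite /word_map free_eval_gen /= inordK. Qed.

Lemma word_map_gen_comm j : (j < k.+1)%N ->
  word_map (gen_comm k j) = handle_map (coord_x j) (coord_y j).
Proof.
move=> jk; apply: funext => q; rewrite /gen_comm !word_mapM !word_mapV.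
by rewrite word_map_gen_x // word_map_gen_y // /handle_map !lmulA.
Qed.

Lemma word_map_partial_relator m : (m <= k.+1)%N ->
  word_map (partial_relator k m) = partial_map m.
Proof.
elim: m => [|m IH] mk; first by rewrite /partial_relator big_geq.
by rewrite partial_relatorS word_mapM IH 1?ltnW // word_map_gen_comm.
Qed.

Lemma chain_formD c c' (q : gpow G k) U V :
  chain_form bul (c + c') q U V = chain_form bul c q U V + chain_form bul c' q U V.
Proof. exact: linear_extD. Qed.

Lemma chain_formN c (q : gpow G k) U V :
  chain_form bul (- c) q U V = - chain_form bul c q U V.
Proof. exact: linear_extN. Qed.

Lemma chain_form_bar2 u v (q : gpow G k) U V :
  chain_form bul (bar2 u v) q U V =
  2^-1 * pair_form bul (word_map u) (word_map v) q U V.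
Proof.
apply: (linear_ext_bar2 (B := fun u v => 2^-1 * pair_form bul (word_map u) (word_map v) q U V)) => w.
  by rewrite word_map1 (pair_form_1l hbul) ?mulr0 //; exact: msmooth_word_map.
by rewrite word_map1 (pair_form_1r hbul) ?mulr0 //; exact: msmooth_word_map.
Qed.

Lemma chain_form_handle j (q : gpow G k) U V : (j < k.+1)%N ->
  chain_form bul (handle_chain k j) q U V = handle_form (coord_x j) (coord_y j) q U V.
Proof.
move=> jk; rewrite /handle_chain !chain_formD !chain_formN !chain_form_bar2.
rewrite (word_mapM G (gen_x k j) (gen_y k j)) (word_mapM G (gen_x k j)^-1%g).
rewrite (word_mapV G (gen_x k j)) (word_mapV G (gen_y k j)) (word_map_gen_x jk) (word_map_gen_y jk).
rewrite (pair_form_inv hbul U V (msmooth_coord_x j q)) (pair_form_inv hbul U V (msmooth_coord_y j q)).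
exact: handle_form_terms.
Qed.

Lemma chain_form_fusion m (q : gpow G k) U V : (m <= k.+1)%N ->
  chain_form bul (fusion_chain k m) q U V = fused_form m q U V.
Proof.
rewrite /fused_form; elim: m => [|m IH] mk.
  by rewrite /fusion_chain !big_geq //; exact: linear_ext0.
rewrite big_nat_recr //= -IH 1?ltnW // /fusion_chain big_nat_recr //= -/(fusion_chain k m).
rewrite (chain_formD (fusion_chain k m)) (chain_formD (handle_chain k m)) chain_formN.
rewrite (chain_form_bar2 (partial_relator k m) (gen_comm k m)) (chain_form_handle _ _ _ mk).
by rewrite (word_map_gen_comm mk) (word_map_partial_relator (ltnW mk)).
Qed.

End HandleForms.

Section FusedDoubles.
Context {K : numFieldType} {n : nat} (G : lieGroup K n).
Local Notation g := 'rV[K]_n.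
Let fg : findim g := findim_row n.
Variable bul : g -> g -> K.
Hypothesis hbul : invariant_form G bul.
Let bl := bul_linear hbul.
Let bs := bul_sym hbul.

Lemma coord_x_fst k j (q : gpow G k.+1) : (j < k.+1)%N -> coord_x j q = coord_x j q.1.
Proof. by move=> jk; rewrite /coord_x /= ltn_eqF. Qed.

Lemma coord_y_fst k j (q : gpow G k.+1) : (j < k.+1)%N -> coord_y j q = coord_y j q.1.
Proof. by move=> jk; rewrite /coord_y /= ltn_eqF. Qed.

Lemma coord_x_last k (q : gpow G k.+1) : coord_x k.+1 q = q.2.1.
Proof. by rewrite /coord_x /= eqxx. Qed.

Lemma coord_y_last k (q : gpow G k.+1) : coord_y k.+1 q = q.2.2.
Proof. by rewrite /coord_y /= eqxx. Qed.

Lemma partial_map_fst k m (q : gpow G k.+1) : (m <= k.+1)%N ->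
  partial_map m q = partial_map m q.1.
Proof.
elim: m => [|m IH] // mk; rewrite [LHS]/= [RHS]/= (IH (ltnW mk)).
by rewrite /handle_map coord_x_fst // coord_y_fst.
Qed.

Lemma fused_doubles_act k : q_act (fused_doubles G bul k) = @gpow_conj K n G k.
Proof.
elim: k => [|k IH] //; apply: funext => a; apply: funext => q.
by rewrite [LHS]/= IH.
Qed.

Lemma fused_doubles_map k : q_map (fused_doubles G bul k) = partial_map k.+1.
Proof.
elim: k => [|k IH]; apply: funext => q.
  by rewrite [RHS]/= lmul1.
rewrite [LHS]/= IH [RHS]/= -/(partial_map k.+1 q).
rewrite -(partial_map_fst q (leqnn k.+1)) /=.
by congr (_ ** _); rewrite /handle_map coord_x_last coord_y_last.
Qed.

(** The last fusion adds the last handle and the last cell; the other terms are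
    pulled back from the preceding power. *)
Lemma fused_doubles_form k (q : gpow G k) U V :
  q_form (fused_doubles G bul k) q U V = fused_form bul k.+1 q U V.
Proof.
elim: k q U V => [|k IH] q U V.
  rewrite [LHS](fusion_double_form hbul) /fused_form big_nat1.
  rewrite (pair_form_1l hbul); last first.
    by apply: msmooth_handle_map; [exact: msmooth_coord_x|exact: msmooth_coord_y].
  by rewrite mulr0 subr0.
have sf := @msmooth_fst _ _ _ (gpow G k) (prod_manifold G G) q.
have ss := @msmooth_snd _ _ _ (gpow G k) (prod_manifold G G) q.
have s1 p := @msmooth_fst _ _ _ G G p; have s2 p := @msmooth_snd _ _ _ G G p.
have fGG := findim_prod fg fg.
have ex j : (j < k.+1)%N -> @coord_x K n G k.+1 j = (fun q => coord_x j q.1).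
  by move=> jk; apply: funext => q'; exact: coord_x_fst.
have ey j : (j < k.+1)%N -> @coord_y K n G k.+1 j = (fun q => coord_y j q.1).
  by move=> jk; apply: funext => q'; exact: coord_y_fst.
have ep j : (j <= k.+1)%N -> @partial_map K n G k.+1 j = (fun q => partial_map j q.1).
  by move=> jk; apply: funext => q'; exact: partial_map_fst.
have lx : @coord_x K n G k.+1 k.+1 = (fun q => q.2.1).
  by apply: funext => q'; exact: coord_x_last.
have ly : @coord_y K n G k.+1 k.+1 = (fun q => q.2.2).
  by apply: funext => q'; exact: coord_y_last.
rewrite /fused_form big_nat_recr //=.
have -> : \sum_(0 <= j < k.+1) (handle_form bul (coord_x j) (coord_y j) q U V
    - 2^-1 * pair_form bul (partial_map j) (handle_map (coord_x j) (coord_y j)) q U V) =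
  fused_form bul k.+1 q.1 U.1 V.1.
  apply: eq_big_nat => j /andP[_ jk].
  rewrite (ex _ jk) (ey _ jk) (ep _ (ltnW jk)).
  rewrite (handle_form_comp bul U V (findim_gpow k) sf (msmooth_coord_x j) (msmooth_coord_y j)).
  rewrite (pair_form_comp bul U V (findim_gpow k) sf (msmooth_partial_map j _)
    (msmooth_handle_map (msmooth_coord_x j _) (msmooth_coord_y j _))).
  by rewrite !mdiff_fst.
rewrite lx ly (handle_form_comp bul U V fGG ss s1 s2) !mdiff_snd.
have e2 := fusion_double_form hbul q.2 U.2 V.2.
have step : q_form (fused_doubles G bul k.+1) q U V =
    q_form (fused_doubles G bul k) q.1 U.1 V.1
    + q_form (fusion bul (Defs.double G bul)) q.2 U.2 V.2
    - 2^-1 * pair_form bul (fun q : gpow G k.+1 => q_map (fused_doubles G bul k) q.1)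
        (fun q => handle_map (fun q : gpow G k.+1 => q.2.1) (fun q => q.2.2) q) q U V by [].
have ep' : (fun q : gpow G k.+1 => q_map (fused_doubles G bul k) q.1) = partial_map k.+1.
  by apply: funext => q'; rewrite fused_doubles_map partial_map_fst.
rewrite (IH q.1 U.1 V.1) e2 ep' in step.
exact: etrans step (esym (addrA _ _ _)).
Qed.

Theorem fused_doubles_hom k :
  fused_doubles G bul k = hom_qdata G bul (fusion_chain k k.+1).
Proof.
have ea := fused_doubles_act k; have em := fused_doubles_map k.
have ef : q_form (fused_doubles G bul k) = chain_form bul (fusion_chain k k.+1).
  apply: funext => q; apply: funext => U; apply: funext => V.
  by rewrite fused_doubles_form (chain_form_fusion hbul).
rewrite -(word_map_partial_relator G (leqnn k.+1)) partial_relator_full in em.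
by rewrite /hom_qdata -ea -ef -em; case: (fused_doubles G bul k).
Qed.

End FusedDoubles.

(** * Kernels of the fused forms *)

Lemma form2_anti {K : numFieldType} {E : normedModType K} (M : manifold E)
    (a : M -> E -> E -> K) p u v : is_form2 a -> a p u v = - a p v u.
Proof.
move=> fa; have al := form2_alternating fa p.
have Dl x y z : a p (x + y) z = a p x z + a p y z.
  by rewrite -[x]scale1r (form2_linearl fa) mul1r scale1r.
have Dr x y z : a p z (x + y) = a p z x + a p z y.
  by rewrite -[x]scale1r (form2_linearr fa) mul1r scale1r.
have := al (u + v); rewrite Dl !Dr !al add0r addr0 => /eqP.
by rewrite addr_eq0 => /eqP.
Qed.

Lemma half_sum (K : numFieldType) (A B : K) :
  - (2^-1 * (A + B)) - 2^-1 * (0 - - (A - B)) = - A.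
Proof.
have h : (2 : K)^-1 * 2 = 1 by rewrite mulVf // pnatr_eq0.
by transitivity (- (2^-1 * 2 * A)); [ring|rewrite h mul1r].
Qed.

Lemma double_eq0 (K : numFieldType) (A : K) : - 2^-1 * (A + A) = 0 -> A = 0.
Proof.
move=> /eqP; rewrite mulNr oppr_eq0 mulf_eq0 invr_eq0 pnatr_eq0 /= -mulr2n.
by rewrite mulrn_eq0 /= => /eqP.
Qed.

Lemma add0_opp (V : zmodType) (x y : V) : x + y = 0 -> y = - x.
Proof. by move=> e; apply/eqP; rewrite -addr_eq0 addrC e. Qed.

Section OrthogonalMaps.
Context {K : numFieldType} {V : zmodType}.
Variables (bul : V -> V -> K) (A Ai B Bi : V -> V).
Hypotheses (bl : forall X Y Z, bul (X + Y) Z = bul X Z + bul Y Z)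
  (bs : forall X Y, bul X Y = bul Y X)
  (nd : forall X, (forall Y, bul X Y = 0) -> X = 0)
  (AD : forall X Y, A (X + Y) = A X + A Y) (AK : forall X, Ai (A X) = X)
  (AVK : forall X, A (Ai X) = X) (Ab : forall X Y, bul (A X) Y = bul X (Ai Y))
  (BD : forall X Y, B (X + Y) = B X + B Y) (BK : forall X, Bi (B X) = X)
  (BVK : forall X, B (Bi X) = X) (Bb : forall X Y, bul (B X) Y = bul X (Bi Y)).

Let br X Y Z : bul X (Y + Z) = bul X Y + bul X Z. Proof. by rewrite !(bs X) bl. Qed.
Let b0 X : bul 0 X = 0. Proof. by apply: (addrI (bul 0 X)); rewrite -bl !addr0. Qed.
Let b0r X : bul X 0 = 0. Proof. by rewrite bs b0. Qed.
Let bn X Y : bul (- X) Y = - bul X Y.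
Proof. by apply: (addrI (bul X Y)); rewrite -bl !subrr b0. Qed.
Let bnr X Y : bul X (- Y) = - bul X Y. Proof. by rewrite !(bs X) bn. Qed.
Let A0 : A 0 = 0. Proof. by apply: (addrI (A 0)); rewrite -AD !addr0. Qed.
Let B0 : B 0 = 0. Proof. by apply: (addrI (B 0)); rewrite -BD !addr0. Qed.
Let AN X : A (- X) = - A X.
Proof. by apply: (addrI (A X)); rewrite -AD !subrr A0. Qed.
Let BiD X Y : Bi (X + Y) = Bi X + Bi Y.
Proof. by rewrite -{1}(BVK X) -{1}(BVK Y) -BD BK. Qed.
Let Ai0 : Ai 0 = 0. Proof. by rewrite -{1}A0 AK. Qed.
Let BiN X : Bi (- X) = - Bi X.
Proof. by apply: (addrI (Bi X)); rewrite -BiD !subrr -{1}B0 BK. Qed.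
Let Aib X Y : bul (Ai X) Y = bul X (A Y). Proof. by rewrite -{2}(AVK X) Ab AK. Qed.
Let Bib X Y : bul (Bi X) Y = bul X (B Y). Proof. by rewrite -{2}(BVK X) Bb BK. Qed.

(** For a kernel vector of a fusion, [xi] and [eta] are the values of the left
    form of the first moment and of the right form of the second one, and [A] is
    the adjoint action of the first moment.  The hypothesis is the pairing with
    the fundamental field of [Y] for the first factor. *)
Lemma fusion_kernel xi eta : xi + eta = 0 ->
  (forall Y, - (2^-1 * bul Y (xi + A xi)) - 2^-1 * (bul xi 0 - bul (Y - Ai Y) eta) = 0) ->
  xi = 0.
Proof.
move=> e H; apply: nd => Y; have := H Y.
rewrite (add0_opp e) br b0r bnr bl bn Aib half_sum => /eqP.
by rewrite oppr_eq0 bs => /eqP.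
Qed.

(** The kernel condition of the fused double in left trivializations of both
    factors, [A] and [B] being the adjoint actions of the two components. *)
Lemma double_kernel_vectors x y :
  (forall u w, - 2^-1 * (bul x (B w) - bul u (B y) + (bul (A x) w - bul (A u) y))
    - 2^-1 * (bul (Bi (x + B y)) (- Ai (A u + w))
              - bul (Bi (u + B w)) (- Ai (A x + y))) = 0) ->
  Bi (x + B y) - Ai (A x + y) = 0 -> x = 0 /\ y = 0.
Proof.
move=> H e; have xiE : Bi (x + B y) = Bi x + y by rewrite BiD BK.
have etaE : - Ai (A x + y) = - Bi (x + B y) := add0_opp e.
have xi0 : Bi (x + B y) = 0.
  (* the velocity of the action of the first copy of the group *)
  apply: nd => Y; rewrite bs; have := H (- Ai Y) Y.
  have eBi : Bi (- Ai Y + B Y) = Y - Bi (Ai Y) by rewrite BiD BiN BK addrC.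
  have f1 : bul x (B Y) = bul Y (Bi x) by rewrite bs Bb.
  have f2 : bul (- Ai Y) (B y) = - bul Y (A (B y)) by rewrite bn Aib.
  have f5 : bul (Y - Bi (Ai Y)) (Bi (x + B y)) = bul Y (Bi (x + B y)) - bul Y (A (x + B y)).
    by rewrite bl bn Bib BVK Aib.
  rewrite AN AVK addNr Ai0 oppr0 b0r etaE bnr eBi f1 f2 f5 (bn Y) (bs (A x)) => h.
  apply: oppr_inj; rewrite oppr0 -[RHS]h; apply/esym.
  apply: etrans (half_sum (bul Y (Bi (x + B y))) (bul Y (A (x + B y)))).
  congr (_ - _); rewrite mulNr; congr (- (_ * _)).
  by rewrite xiE AD !br; ring.
have ByE : B y = - x.
  by apply: add0_opp; rewrite -(BVK (x + B y)) xi0 B0.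
have yE : y = - A x.
  apply: add0_opp; rewrite -(AVK (A x + y)).
  by rewrite -[Ai _]opprK etaE xi0 oppr0 oppr0 A0.
have x0 : x = 0.
  apply: nd => u; rewrite bs; apply: double_eq0; have := H u 0.
  rewrite etaE xi0 oppr0 b0 b0r B0 !b0r subrr mulr0 subr0 !sub0r.
  by rewrite ByE yE !bnr !opprK Ab AK.
by split; rewrite // yE x0 A0 oppr0.
Qed.

End OrthogonalMaps.

Section Kernels.
Context {K : numFieldType} {n : nat} (G : lieGroup K n).
Local Notation g := 'rV[K]_n.
Let fg : findim g := findim_row n.
Variable bul : g -> g -> K.
Hypotheses (hbul : invariant_form G bul) (hnd : nondegenerate_form bul).
Let bl := bul_linear hbul.
Let bs := bul_sym hbul.

(** The vanishing of [logd] expresses that [V] is in the kernel of the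
    differential of the moment map. *)
Definition trivial_kernel (E : normedModType K) (M : manifold E) (A : qdata G M) : Prop :=
  forall q V, (forall W, q_form A q V W = 0) -> logd (q_map A) q V = 0 -> V = 0.

Lemma lie_Ad_inj (a : G) X : lie_Ad a X = 0 -> X = 0 :> g.
Proof. by move=> e; rewrite -(lie_AdK a X) e lie_Ad0. Qed.

Let fuse_l (q : prod_manifold G G) : G := q.1 ** q.2.
Let fuse_r (q : prod_manifold G G) : G := lie_inv q.1 ** lie_inv q.2.

Lemma double_kernel : trivial_kernel (fusion bul (Defs.double G bul)).
Proof.
move=> q V kV.
have s1 := @msmooth_fst _ _ _ G G q; have s2 := @msmooth_snd _ _ _ G G q.
have sl : msmooth fuse_l q by exact: msmooth_mul.
have sr : msmooth fuse_r q by apply: msmooth_mul; exact: msmooth_inv.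
pose al (W : g * g) : g := mc_left q.1 W.1; pose be (W : g * g) : g := mc_left q.2 W.2.
pose p1 (z : prod_manifold G G) : G := z.1; pose p2 (z : prod_manifold G G) : G := z.2.
have l1 W : logd p1 q W = al W by rewrite /logd mdiff_fst.
have l2 W : logd p2 q W = be W by rewrite /logd mdiff_snd.
have r1 W : rlogd p1 q W = lie_Ad q.1 (al W) by rewrite rlogd_Ad l1.
have r2 W : rlogd p2 q W = lie_Ad q.2 (be W) by rewrite rlogd_Ad l2.
have ll W : logd fuse_l q W = lie_Ad (lie_inv q.2) (al W + lie_Ad q.2 (be W)).
  by rewrite (logd_mul_rlogd (f := p1) (h := p2) W s1 s2) l1 r2.
have rr W : rlogd fuse_r q W = - lie_Ad (lie_inv q.1) (lie_Ad q.1 (al W) + be W).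
  rewrite (rlogd_mul W (msmooth_inv (f := p1) s1) (msmooth_inv (f := p2) s2)).
  rewrite (logd_inv (f := p1) _ s1) l1 rlogd_Ad (logd_inv (f := p2) _ s2) l2.
  by rewrite !lie_AdN lie_AdK -opprD lie_AdN.
have form W : q_form (fusion bul (Defs.double G bul)) q V W =
    - 2^-1 * (bul (al V) (lie_Ad q.2 (be W)) - bul (al W) (lie_Ad q.2 (be V))
      + (bul (lie_Ad q.1 (al V)) (be W) - bul (lie_Ad q.1 (al W)) (be V)))
    - 2^-1 * (bul (logd fuse_l q V) (rlogd fuse_r q W)
              - bul (logd fuse_l q W) (rlogd fuse_r q V)).
  rewrite -(pair_formE bul V W sl sr).
  by rewrite -!mc_right_Ad.
rewrite (logd_mul_rlogd V sl sr) => /lie_Ad_inj e.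
have [x0 y0] : al V = 0 /\ be V = 0.
  apply: (@double_kernel_vectors K g bul (lie_Ad q.1) (lie_Ad (lie_inv q.1))
    (lie_Ad q.2) (lie_Ad (lie_inv q.2))).
  - exact: bulDl.
  - exact: bs.
  - exact: hnd.
  - exact: lie_AdD.
  - exact: lie_AdK.
  - exact: lie_AdVK.
  - exact: (bul_Adl hbul).
  - exact: lie_AdD.
  - exact: lie_AdK.
  - exact: lie_AdVK.
  - exact: (bul_Adl hbul).
  - move=> u w; have [w1 e1] := mc_left_surj q.1 u; have [w2 e2] := mc_left_surj q.2 w.
    have := form (w1, w2); rewrite kV !ll !rr.
    have -> : al (w1, w2) = u by exact: e1.
    have -> : be (w1, w2) = w by exact: e2.
    by move/esym.
  - by rewrite -ll -rr.
rewrite (surjective_pairing V).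
by congr pair; [exact: mc_left_inj x0|exact: mc_left_inj y0].
Qed.

(** A common kernel vector [V] satisfies [theta V = - theta' V] for the two
    moments.  Pairing with the fundamental fields of the first factor gives
    [theta V = 0].  The fusion term then vanishes on [V], so that each component
    of [V] is a common kernel vector of its factor. *)
Lemma fusion_trivial_kernel (E F : normedModType K) (M : manifold E) (N : manifold F)
    (A : qdata G M) (B : qdata G N) : findim E -> findim F ->
  weakly_quasi_hamiltonian bul A -> weakly_quasi_hamiltonian bul B ->
  trivial_kernel A -> trivial_kernel B ->
  trivial_kernel (fusion bul (prod_qdata A B)).
Proof.
move=> fE fF hA hB kA kB q V kV.
have sA := smooth_map_msmooth (wqh_map_smooth hA); have sB := smooth_map_msmooth (wqh_map_smooth hB).
have s1 := @msmooth_fst _ _ _ M N q; have s2 := @msmooth_snd _ _ _ M N q.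
pose PA (z : prod_manifold M N) : G := q_map A z.1.
pose PB (z : prod_manifold M N) : G := q_map B z.2.
have sPA : msmooth PA q by exact: (@msmooth_comp _ _ _ _ (prod_manifold M N) M G fst _ q fE s1 (sA _)).
have sPB : msmooth PB q by exact: (@msmooth_comp _ _ _ _ (prod_manifold M N) N G snd _ q fF s2 (sB _)).
have lA W : logd PA q W = logd (q_map A) q.1 W.1.
  by rewrite (logd_comp (M := M) (N := prod_manifold M N) (k := fst) W fE s1 (sA _)) mdiff_fst.
have lB W : logd PB q W = logd (q_map B) q.2 W.2.
  by rewrite (logd_comp (M := N) (N := prod_manifold M N) (k := snd) W fF s2 (sB _)) mdiff_snd.
have rB W : rlogd PB q W = rlogd (q_map B) q.2 W.2 by rewrite !rlogd_Ad lB.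
have form W : q_form (fusion bul (prod_qdata A B)) q V W =
    q_form A q.1 V.1 W.1 + q_form B q.2 V.2 W.2
    - 2^-1 * (bul (logd PA q V) (rlogd PB q W) - bul (logd PA q W) (rlogd PB q V)).
  by rewrite -(pair_formE bul V W sPA sPB).
rewrite (logd_mul_rlogd (f := PA) (h := PB) V sPA sPB) => /lie_Ad_inj e.
have rB0 p : rlogd (q_map B) p 0 = 0 by rewrite rlogd_Ad /logd mdiff0 mc_left0 lie_Ad0.
have lA0 p : logd (q_map A) p 0 = 0 by rewrite /logd mdiff0 mc_left0.
have zA p v : q_form A p v 0 = 0.
  have := form2_linearr (wqh_form hA) p v (-1) 0 0.
  by rewrite scaler0 addr0 mulN1r addNr.
have zB p v : q_form B p v 0 = 0.
  have := form2_linearr (wqh_form hB) p v (-1) 0 0.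
  by rewrite scaler0 addr0 mulN1r addNr.
have sact a p : msmooth (fun b => q_act A b p) a.
  exact: (@msmooth_comp2 _ _ _ _ _ G M G M (fun b => b) (fun=> p) (fun z => q_act A z.1 z.2) a
    fg fE (msmooth_id _) (msmooth_cst _ _) (smooth_map_msmooth (wqh_act_smooth hA) _)).
have xi0 : logd PA q V = 0.
  apply: (@fusion_kernel K g bul (lie_Ad (q_map A q.1)) (lie_Ad (lie_inv (q_map A q.1)))
    (bulDl bl) bs hnd (lie_AdK _) (lie_AdVK _) (bul_Adl hbul _) _ _ e) => Y.
  pose W : E * F := (fundamental_field (q_act A) Y q.1, 0).
  have eB : rlogd PB q W = 0 := etrans (rB W) (rB0 _).
  have eA : logd PA q W = Y - lie_Ad (lie_inv (q_map A q.1)) Y.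
    apply: etrans (lA W) _.
    exact: (logd_fundamental fE (wqh_act1 hA) sact _ Y sA (wqh_equivariant hA)).
  have e1 : q_form A q.1 V.1 W.1 + q_form B q.2 V.2 W.2 =
      - (2^-1 * bul Y (logd PA q V + lie_Ad (q_map A q.1) (logd PA q V))).
    have m1 := etrans (form2_anti q.1 V.1 W.1 (wqh_form hA))
                      (congr1 -%R (wqh_moment hA Y q.1 V.1)).
    apply: etrans (congr2 +%R m1 (zB q.2 V.2)) _; rewrite addr0.
    rewrite (lA V) -mc_right_Ad; exact: erefl.
  pose Fm s x y := s - 2^-1 * (bul (logd PA q V) y - bul x (rlogd PB q V)).
  have Fc s s' x x' y y' : s = s' -> x = x' -> y = y' -> Fm s x y = Fm s' x' y'.
    by move=> -> -> ->.
  exact: etrans (Fc _ _ _ _ _ _ (esym e1) (esym eA) (esym eB)) (etrans (esym (form W)) (kV W)).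
have eta0 : rlogd PB q V = 0 by rewrite xi0 add0r in e.
have V1 : V.1 = 0.
  apply: (kA q.1) => [w|]; last by rewrite -lA.
  have := form (w, 0); rewrite kV xi0 eta0 (bul0l bl) (bul0r bl bs) zB.
  by rewrite subrr mulr0 subr0 addr0.
have V2 : V.2 = 0.
  apply: (kB q.2) => [w|]; last first.
    by apply: (@lie_Ad_inj (q_map B q.2)); rewrite -rlogd_Ad -rB.
  have := form (0, w); rewrite kV xi0 eta0 (bul0l bl) (bul0r bl bs) zA.
  by rewrite subrr mulr0 subr0 add0r.
by rewrite (surjective_pairing V) V1 V2.
Qed.

(** Where the moment is central, [theta] and [theta'] agree; by the moment
    condition a kernel vector is then in the kernel of [theta]. *)
Lemma trivial_kernel_weakly_nondegenerate (E : normedModType K) (M : manifold E)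
    (A : qdata G M) :
  weakly_quasi_hamiltonian bul A -> trivial_kernel A -> weakly_nondegenerate A.
Proof.
move=> hA kA q cq V kV; apply: (kA q V kV); apply: hnd => X.
have := wqh_moment hA X q V; rewrite (form2_anti _ _ _ (wqh_form hA)) kV oppr0.
rewrite mc_right_Ad (lie_Ad_central _ cq) -/(logd (q_map A) q V) (bulDr bl bs).
by move=> e; rewrite bs; apply: double_eq0; rewrite mulNr -e oppr0.
Qed.

End Kernels.

Theorem mainTheorem7 (R : realType) (k : ground_field) (n : nat)
    (G : lieGroup (scalars R k) n)
    (bul : 'rV[scalars R k]_n -> 'rV[scalars R k]_n -> scalars R k)
    (hbul : invariant_form G bul) (hnd : nondegenerate_form bul) (l : nat) :
  weakly_quasi_hamiltonian bul (fused_doubles G bul l) /\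
  weakly_nondegenerate (fused_doubles G bul l) /\
  exists c : chain2 (surface_free l.+1),
    boundary2 c = bar1 (relator l.+1) /\
    forall (X : 'rV[scalars R k]_n) (O : set 'rV[scalars R k]_n),
      exp_domain (q_map (fused_doubles G bul l)) X O ->
      ham_eq (exponentiation bul (fused_doubles G bul l) O)
             (extended_moduli_space G bul c O).
Proof.
have schK : symmetric_derivatives (scalars R k) by move=> E m f x u v; exact: schwarz.
have bc m : boundary2 (fusion_chain m m.+1) = bar1 (relator m.+1).
  by rewrite boundary_fusion_chain partial_relator_full.
have hq m : weakly_quasi_hamiltonian bul (fused_doubles G bul m).
  rewrite (fused_doubles_hom hbul m); exact: (hom_weakly_quasi_hamiltonian schK hbul (bc m)).
have tk m : trivial_kernel (fused_doubles G bul m).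
  elim: m => [|m IH]; first exact: (double_kernel hbul hnd).
  have fg := @findim_row (scalars R k) n.
  exact: (fusion_trivial_kernel hbul hnd (findim_gpow m) (findim_prod fg fg) (hq m) (hq 0%N)
    IH (double_kernel hbul hnd)).
split; first exact: hq.
split; first exact: (trivial_kernel_weakly_nondegenerate hbul hnd (hq l) (tk l)).
exists (fusion_chain l l.+1); split; first exact: bc.
move=> X O _; rewrite /extended_moduli_space -(fused_doubles_hom hbul l).
by split=> // z _; split.
Qed.
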